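(* Consider the system and notation described in the context, and suppose $0<a_1<\sqrt{4d_1r}$ and $L>L_1^*$. (i) If $x_1\ge L^*$ (large protection zone), $m\le p^{-1}e^{-|\frac{a_1}{d_1}-\frac{a_2}{d_2}|L}$ and $\tilde w^2(L)\le h$, then the system possesses a unique coexistence steady state $(u,w)$, and it is globally asymptotically stable. (ii) If $x_1<L^*$ (small protection zone), $m<\min\{m^*,\,p^{-1}e^{-|\frac{a_1}{d_1}-\frac{a_2}{d_2}|L}\}$ and $\tilde w^2(L)\le h$, then the system possesses a unique coexistence steady state $(u,w)$, and it is globally asymptotically stable.
   Context: Let $d_1,d_2,r,m,p,q,h,L>0$, $a_1>0$, $a_2\ge0$ and $0\le x_1<L$. Let $\chi_{(x_1,L]}(x)=1$ for $x_1<x\le L$ and $0$ for $0\le x\le x_1$. Consider the system $u_t=d_1u_{xx}-a_1u_x+u(r-u-m\chi_{(x_1,L]}w)$, $x\in(0,L)$; $w_t=d_2w_{xx}-a_2w_x+h-qw-puw$, $x\in(x_1,L)$; $d_1u_x(0,t)-a_1u(0,t)=u_x(L,t)=0$, $d_2w_x(x_1,t)-a_2w(x_1,t)=w_x(L,t)=0$; nonnegative, not identically zero initial data. A coexistence steady state is a time-independent solution $(u,w)$ with $u>0$ on $[0,L]$ and $w>0$ on $[x_1,L]$; it is globally asymptotically stable if every solution with nonnegative nontrivial initial data converges to it uniformly as $t\to\infty$. Let $\tilde w$ be the unique positive solution of $d_2w''-a_2w'+h-qw=0$ on $(x_1,L)$, $d_2w'(x_1)-a_2w(x_1)=w'(L)=0$.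 For $0\le y_1<y_2\le L$, $d>0$, $a\ge0$, bounded $s$, $\lambda_1(d,a,s,(y_1,y_2))$ is the principal eigenvalue of $d\varphi''-a\varphi'+s\varphi=\lambda\varphi$ on $(y_1,y_2)$, $d\varphi'(y_1)-a\varphi(y_1)=\varphi'(y_2)=0$. When $x_1<L^*$ (and the other hypotheses hold), $m^*=m^*(x_1)>0$ denotes the value of $m$ at which $\lambda_1(d_1,a_1,r-m\chi_{(x_1,L]}\tilde w,(0,L))=0$ (this eigenvalue is strictly decreasing in $m$). For $0<a_1<\sqrt{4d_1r}$: $L^*=2d_1\big(\pi-\arctan\frac{\sqrt{4d_1r-a_1^2}}{a_1}\big)/\sqrt{4d_1r-a_1^2}$; $L_1^*=2d_1\arctan\big(\frac{a_1\sqrt{4d_1r-a_1^2}}{2d_1r-a_1^2}\big)/\sqrt{4d_1r-a_1^2}$ if $a_1\le\sqrt{2d_1r}$ and $L_1^*=2d_1\big(\pi+\arctan\frac{a_1\sqrt{4d_1r-a_1^2}}{2d_1r-a_1^2}\big)/\sqrt{4d_1r-a_1^2}$ if $\sqrt{2d_1r}<a_1<\sqrt{4d_1r}$. *)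

(* Defs.v *)
From Stdlib Require Import Reals Lra List.
From Coquelicot Require Import Coquelicot.
Open Scope R_scope.

(* characteristic function of (x1, L] (used only on [0,L]) *)
Definition chi (x1 x : R) : R := if Rle_dec x x1 then 0 else 1.

Definition deriv_on (a b : R) (f f' : R -> R) : Prop :=
  forall x, a <= x <= b ->
    filterlim (fun y => (f y - f x) / (y - x))
      (within (fun y => a <= y <= b /\ y <> x) (locally x)) (locally (f' x)).

Definition cont_on (a b : R) (f : R -> R) : Prop :=
  forall x, a <= x <= b ->
    filterlim f (within (fun y => a <= y <= b) (locally x)) (locally (f x)).

(* Principal eigenvalue lam of  d phi'' - a phi' + s phi = lam phi on (y1,y2),
   d phi'(y1) - a phi(y1) = phi'(y2) = 0 : the eigenvalue admitting a positive
   eigenfunction.  The eigenfunction is C^1 on [y1,y2] and the equation holds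
   pointwise off a finite set (s may be piecewise continuous). *)
Definition principal_eig (d a : R) (s : R -> R) (y1 y2 lam : R) : Prop :=
  exists phi phi' : R -> R,
    deriv_on y1 y2 phi phi' /\ cont_on y1 y2 phi' /\
    (forall x, y1 <= x <= y2 -> 0 < phi x) /\
    d * phi' y1 - a * phi y1 = 0 /\ phi' y2 = 0 /\
    exists E : list R, forall x, y1 < x < y2 -> ~ In x E ->
      exists phi'', is_derive phi' x phi'' /\
        d * phi'' - a * phi' x + s x * phi x = lam * phi x.

Definition tilde_w (d2 a2 h q x1 L : R) (wt : R -> R) : Prop :=
  exists wt' : R -> R,
    deriv_on x1 L wt wt' /\ cont_on x1 L wt' /\
    (forall x, x1 <= x <= L -> 0 < wt x) /\
    d2 * wt' x1 - a2 * wt x1 = 0 /\ wt' L = 0 /\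
    forall x, x1 < x < L -> exists w'', is_derive wt' x w'' /\
      d2 * w'' - a2 * wt' x + h - q * wt x = 0.

Definition Lstar (d1 a1 r : R) : R :=
  2 * d1 * (PI - atan (sqrt (4 * d1 * r - a1 ^ 2) / a1)) / sqrt (4 * d1 * r - a1 ^ 2).

(* At a1^2 = 2 d1 r the arctan of (positive)/0 is read as its limit PI/2. *)
Definition Lstar1 (d1 a1 r : R) : R :=
  let s := sqrt (4 * d1 * r - a1 ^ 2) in
  if Rlt_dec (a1 ^ 2) (2 * d1 * r) then
    2 * d1 * atan (a1 * s / (2 * d1 * r - a1 ^ 2)) / s
  else if Req_EM_T (a1 ^ 2) (2 * d1 * r) then
    2 * d1 * (PI / 2) / s
  else
    2 * d1 * (PI + atan (a1 * s / (2 * d1 * r - a1 ^ 2))) / s.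

Definition coexistence_ss (d1 d2 r m p q h L a1 a2 x1 : R) (U W : R -> R) : Prop :=
  exists U' W' : R -> R,
    deriv_on 0 L U U' /\ cont_on 0 L U' /\
    deriv_on x1 L W W' /\ cont_on x1 L W' /\
    d1 * U' 0 - a1 * U 0 = 0 /\ U' L = 0 /\
    d2 * W' x1 - a2 * W x1 = 0 /\ W' L = 0 /\
    (forall x, 0 < x < L -> x <> x1 -> exists U'', is_derive U' x U'' /\
        d1 * U'' - a1 * U' x + U x * (r - U x - m * chi x1 x * W x) = 0) /\
    (forall x, x1 < x < L -> exists W'', is_derive W' x W'' /\
        d2 * W'' - a2 * W' x + h - q * W x - p * U x * W x = 0) /\
    (forall x, 0 <= x <= L -> 0 < U x) /\
    (forall x, x1 <= x <= L -> 0 < W x).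

Definition init_data (x1 L : R) (u0 w0 : R -> R) : Prop :=
  cont_on 0 L u0 /\ cont_on x1 L w0 /\
  (forall x, 0 <= x <= L -> 0 <= u0 x) /\ (forall x, x1 <= x <= L -> 0 <= w0 x) /\
  (exists x, 0 <= x <= L /\ u0 x <> 0) /\ (exists x, x1 <= x <= L /\ w0 x <> 0).

Definition solution (d1 d2 r m p q h L a1 a2 x1 : R) (u0 w0 : R -> R)
    (u w : R -> R -> R) : Prop :=
  (forall x t, 0 <= x <= L -> 0 <= t ->
     filterlim (fun z : R * R => u (fst z) (snd z))
       (within (fun z : R * R => 0 <= fst z <= L /\ 0 <= snd z) (locally (x, t)))
       (locally (u x t))) /\
  (forall x t, x1 <= x <= L -> 0 <= t ->
     filterlim (fun z : R * R => w (fst z) (snd z))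
       (within (fun z : R * R => x1 <= fst z <= L /\ 0 <= snd z) (locally (x, t)))
       (locally (w x t))) /\
  (forall x, 0 <= x <= L -> u x 0 = u0 x) /\
  (forall x, x1 <= x <= L -> w x 0 = w0 x) /\
  exists ux wx : R -> R -> R, forall t, 0 < t ->
    deriv_on 0 L (fun x => u x t) (fun x => ux x t) /\
    cont_on 0 L (fun x => ux x t) /\
    deriv_on x1 L (fun x => w x t) (fun x => wx x t) /\
    cont_on x1 L (fun x => wx x t) /\
    d1 * ux 0 t - a1 * u 0 t = 0 /\ ux L t = 0 /\
    d2 * wx x1 t - a2 * w x1 t = 0 /\ wx L t = 0 /\
    (forall x, 0 < x < L -> x <> x1 -> exists uxx ut,
       is_derive (fun y => ux y t) x uxx /\ is_derive (fun s => u x s) t ut /\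
       ut = d1 * uxx - a1 * ux x t + u x t * (r - u x t - m * chi x1 x * w x t)) /\
    (forall x, x1 < x < L -> exists wxx wt,
       is_derive (fun y => wx y t) x wxx /\ is_derive (fun s => w x s) t wt /\
       wt = d2 * wxx - a2 * wx x t + h - q * w x t - p * u x t * w x t).

Definition converges_to (x1 L : R) (u w : R -> R -> R) (U W : R -> R) : Prop :=
  forall eps, 0 < eps -> exists T, forall t, T <= t ->
    (forall x, 0 <= x <= L -> Rabs (u x t - U x) < eps) /\
    (forall x, x1 <= x <= L -> Rabs (w x t - W x) < eps).

Definition unique_GAS_coexistence (d1 d2 r m p q h L a1 a2 x1 : R) : Prop :=
  exists U W : R -> R,
    coexistence_ss d1 d2 r m p q h L a1 a2 x1 U W /\
    (forall U2 W2, coexistence_ss d1 d2 r m p q h L a1 a2 x1 U2 W2 ->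
        (forall x, 0 <= x <= L -> U2 x = U x) /\
        (forall x, x1 <= x <= L -> W2 x = W x)) /\
    (forall u0 w0 (u w : R -> R -> R), init_data x1 L u0 w0 ->
        solution d1 d2 r m p q h L a1 a2 x1 u0 w0 u w ->
        converges_to x1 L u w U W).

(* Main.v *)
Require Import Defs.
From Stdlib Require Import Reals Lra Lia List Classical ClassicalEpsilon FunctionalExtensionality.
From Coquelicot Require Import Coquelicot.
Open Scope R_scope.

(* The system is competitive, hence monotone for the order (larger u, smaller w).
   Starting from the pair (dl phi, (1 + ee) wt), where phi is a positive strict subsolution of
   the u-equation linearised at (0, wt), and from the pair (M, 0), the iteration that solves at
   each step two linear boundary value problems with constant coefficients increases,
   respectively decreases, to two ordered coexistence states.  By the maximum principle every
   orbit eventually enters the order interval between the two starting pairs, and then follows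
   each iterate up to an arbitrarily small error, so that it is squeezed between the two limits.
   The limits coincide: if (u1, w1) and (u2, w2) are coexistence states with u1 <= u2 and
   w2 <= w1, then multiplying the fluxes of u2/u1 and w1/w2 by increasing functions of these
   ratios and adding them gives, with U = u2 - u1 and W = w1 - w2, a quantity that vanishes at
   the ends and whose derivative dominates a cubic form in (U, W), which is nonnegative
   precisely because m p is small and w1 w2 <= wt(L)^2 <= h.  An arbitrary
   coexistence state is a stationary orbit, so uniqueness follows from the same squeezing. *)

Lemma ball_R (x eps y : R) : ball x eps y <-> Rabs (y - x) < eps.
Proof. reflexivity. Qed.

Lemma Rabs_lt_iff (x e : R) : Rabs x < e <-> - e < x < e.
Proof. split; [intros H; apply Rabs_def2 in H; lra | intros H; apply Rabs_def1; lra]. Qed.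

Lemma Rabs_le_iff (x e : R) : Rabs x <= e <-> - e <= x <= e.
Proof. split; [apply Rabs_le_between | apply Rabs_le]. Qed.

Lemma is_derive_eps (f : R -> R) (x l : R) : is_derive f x l <->
  forall eps, 0 < eps -> exists de, 0 < de /\
    forall y, Rabs (y - x) < de -> Rabs (f y - f x - l * (y - x)) <= eps * Rabs (y - x).
Proof.
  rewrite is_derive_Reals. split.
  - intros H eps He. destruct (H eps He) as [de Hde]. exists de. split; [apply cond_pos|].
    intros y Hy. destruct (Req_dec y x) as [->|Hne].
    + replace (f x - f x - l * (x - x)) with 0 by ring. rewrite Rminus_diag, Rabs_R0. lra.
    + assert (Hn : y - x <> 0) by lra.
      specialize (Hde (y - x) Hn Hy). replace (x + (y - x)) with y in Hde by ring.
      replace (f y - f x - l * (y - x)) with (((f y - f x) / (y - x) - l) * (y - x)) by (field; lra).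
      rewrite Rabs_mult. apply Rmult_le_compat_r; [apply Rabs_pos | lra].
  - intros H eps He. destruct (H (eps / 2) ltac:(lra)) as [de [Hd Hde]].
    exists (mkposreal de Hd). intros k Hk Hk2. simpl in Hk2.
    specialize (Hde (x + k)). replace (x + k - x) with k in Hde by ring. specialize (Hde Hk2).
    replace ((f (x + k) - f x) / k - l) with ((f (x + k) - f x - l * k) / k) by (field; auto).
    unfold Rdiv. rewrite Rabs_mult, Rabs_inv.
    assert (0 < Rabs k) by (apply Rabs_pos_lt; auto).
    apply Rmult_lt_reg_r with (Rabs k); auto. rewrite Rmult_assoc, Rinv_l by lra. nra.
Qed.

Lemma continuous_eps (f : R -> R) (x : R) : continuous f x <->
  forall eps, 0 < eps -> exists de, 0 < de /\ forall y, Rabs (y - x) < de -> Rabs (f y - f x) < eps.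
Proof.
  unfold continuous. split.
  - intros H eps He. destruct (proj1 (filterlim_locally f (f x)) H (mkposreal eps He)) as [de Hde].
    exists de. split; [apply cond_pos|]. intros y Hy. apply (Hde y). exact Hy.
  - intros H. apply filterlim_locally. intros eps. destruct (H eps (cond_pos eps)) as [de [Hd Hde]].
    exists (mkposreal de Hd). intros y Hy. apply Hde. exact Hy.
Qed.

Lemma continuous_pt (f : R -> R) (x : R) : continuous f x -> continuity_pt f x.
Proof. intros H. apply continuity_pt_filterlim. exact H. Qed.

Lemma is_derive_cont (f : R -> R) (x l : R) : is_derive f x l -> continuous f x.
Proof. intros H. apply (ex_derive_continuous f x). exists l; exact H. Qed.

Lemma cont_on_eps (a b : R) (f : R -> R) : cont_on a b f <->
  forall x, a <= x <= b -> forall eps, 0 < eps -> exists de, 0 < de /\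
    forall y, a <= y <= b -> Rabs (y - x) < de -> Rabs (f y - f x) < eps.
Proof.
  split.
  - intros H x Hx eps He.
    destruct (proj1 (filterlim_locally f (f x)) (H x Hx) (mkposreal eps He)) as [de Hde].
    exists de. split; [apply cond_pos|]. intros y Hy Hyx. apply (Hde y); auto.
  - intros H x Hx. apply filterlim_locally. intros eps.
    destruct (H x Hx eps (cond_pos eps)) as [de [Hd Hde]].
    exists (mkposreal de Hd). intros y Hy Hy2. apply Hde; auto.
Qed.

Lemma continuous_cont_on (a b : R) (f : R -> R) :
  (forall x, a <= x <= b -> continuous f x) -> cont_on a b f.
Proof.
  intros H. apply cont_on_eps. intros x Hx eps He.
  destruct (proj1 (continuous_eps f x) (H x Hx) eps He) as [de [Hd Hde]].
  exists de; split; auto.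
Qed.

Lemma deriv_on_eps (a b : R) (f f' : R -> R) : deriv_on a b f f' <->
  forall x, a <= x <= b -> forall eps, 0 < eps -> exists de, 0 < de /\
    forall y, a <= y <= b -> Rabs (y - x) < de ->
      Rabs (f y - f x - f' x * (y - x)) <= eps * Rabs (y - x).
Proof.
  split.
  - intros H x Hx eps He.
    destruct (proj1 (filterlim_locally _ (f' x)) (H x Hx) (mkposreal eps He)) as [de Hde].
    exists de. split; [apply cond_pos|]. intros y Hy Hyx.
    destruct (Req_dec y x) as [->|Hne].
    + replace (f x - f x - f' x * (x - x)) with 0 by ring. rewrite Rminus_diag, Rabs_R0. lra.
    + assert (Hb : Rabs ((f y - f x) / (y - x) - f' x) < eps) by (apply (Hde y); auto).
      replace (f y - f x - f' x * (y - x)) with (((f y - f x) / (y - x) - f' x) * (y - x)) by (field; lra).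
      rewrite Rabs_mult. apply Rmult_le_compat_r; [apply Rabs_pos | lra].
  - intros H x Hx. apply filterlim_locally. intros eps. pose proof (cond_pos eps) as He.
    destruct (H x Hx (eps / 2) ltac:(lra)) as [de [Hd Hde]].
    exists (mkposreal de Hd). intros y Hy [Hab Hne].
    specialize (Hde y Hab Hy). apply ball_R.
    replace ((f y - f x) / (y - x) - f' x) with ((f y - f x - f' x * (y - x)) / (y - x)) by (field; lra).
    unfold Rdiv. rewrite Rabs_mult, Rabs_inv.
    assert (0 < Rabs (y - x)) by (apply Rabs_pos_lt; lra).
    apply Rmult_lt_reg_r with (Rabs (y - x)); auto. rewrite Rmult_assoc, Rinv_l by lra. nra.
Qed.

Lemma is_derive_deriv_on (a b : R) (f f' : R -> R) :
  (forall x, a <= x <= b -> is_derive f x (f' x)) -> deriv_on a b f f'.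
Proof.
  intros H. apply deriv_on_eps. intros x Hx eps He.
  destruct (proj1 (is_derive_eps f x (f' x)) (H x Hx) eps He) as [de [Hd Hde]].
  exists de; split; auto.
Qed.

Lemma deriv_on_is_derive (a b : R) (f f' : R -> R) (x : R) :
  deriv_on a b f f' -> a < x < b -> is_derive f x (f' x).
Proof.
  intros H Hx. apply is_derive_eps. intros eps He.
  destruct (proj1 (deriv_on_eps a b f f') H x ltac:(lra) eps He) as [de [Hd Hde]].
  exists (Rmin de (Rmin (x - a) (b - x))). split.
  - repeat apply Rmin_pos; lra.
  - intros y Hy. apply Rmin_Rgt in Hy. destruct Hy as [Hy1 Hy2].
    apply Rmin_Rgt in Hy2. destruct Hy2 as [Hy2 Hy3].
    apply Hde; auto. apply Rabs_lt_iff in Hy2. apply Rabs_lt_iff in Hy3.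
    apply Rabs_lt_iff in Hy1. lra.
Qed.

Lemma deriv_on_cont_on (a b : R) (f f' : R -> R) : deriv_on a b f f' -> cont_on a b f.
Proof.
  intros H. apply cont_on_eps. intros x Hx eps He.
  destruct (proj1 (deriv_on_eps a b f f') H x Hx 1 ltac:(lra)) as [de [Hd Hde]].
  pose proof (Rabs_pos (f' x)) as Hp.
  exists (Rmin de (eps / (Rabs (f' x) + 1))). split.
  - apply Rmin_pos; auto. apply Rdiv_lt_0_compat; lra.
  - intros y Hy Hyx. apply Rmin_Rgt in Hyx. destruct Hyx as [H1 H2].
    specialize (Hde y Hy H1).
    assert (Rabs (f y - f x) <= (Rabs (f' x) + 1) * Rabs (y - x)).
    { replace (f y - f x) with ((f y - f x - f' x * (y - x)) + f' x * (y - x)) by ring.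
      eapply Rle_trans; [apply Rabs_triang|]. rewrite Rabs_mult. lra. }
    apply Rgt_lt in H2. apply Rmult_lt_compat_l with (r := Rabs (f' x) + 1) in H2; [|lra].
    replace ((Rabs (f' x) + 1) * (eps / (Rabs (f' x) + 1))) with eps in H2 by (field; lra). lra.
Qed.

Lemma cont_on_sub (a b a' b' : R) (f : R -> R) :
  a <= a' -> b' <= b -> cont_on a b f -> cont_on a' b' f.
Proof.
  intros Ha Hb H. apply cont_on_eps. intros x Hx eps He.
  destruct (proj1 (cont_on_eps a b f) H x ltac:(lra) eps He) as [de [Hd Hde]].
  exists de; split; auto. intros y Hy. apply Hde. lra.
Qed.

Lemma cont_on_comp2 (a b : R) (f g : R -> R) (op : R -> R -> R) :
  (forall x, a <= x <= b -> filterlim (fun z : R * R => op (fst z) (snd z))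
       (filter_prod (locally (f x)) (locally (g x))) (locally (op (f x) (g x)))) ->
  cont_on a b f -> cont_on a b g -> cont_on a b (fun x => op (f x) (g x)).
Proof.
  intros Hop Hf Hg x Hx.
  eapply (filterlim_comp_2 f g op); [apply Hf; auto | apply Hg; auto | apply Hop; auto].
Qed.

Lemma cont_on_plus (a b : R) (f g : R -> R) :
  cont_on a b f -> cont_on a b g -> cont_on a b (fun x => f x + g x).
Proof.
  apply (cont_on_comp2 a b f g Rplus). intros x _. apply (filterlim_plus (f x) (g x)).
Qed.

Lemma cont_on_mult (a b : R) (f g : R -> R) :
  cont_on a b f -> cont_on a b g -> cont_on a b (fun x => f x * g x).
Proof.
  apply (cont_on_comp2 a b f g Rmult). intros x _. apply (filterlim_mult (f x) (g x)).
Qed.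

Lemma cont_on_comp (a b : R) (f g : R -> R) :
  cont_on a b f -> (forall x, a <= x <= b -> continuous g (f x)) -> cont_on a b (fun x => g (f x)).
Proof.
  intros Hf Hg x Hx. eapply filterlim_comp; [apply Hf; auto | apply Hg; auto].
Qed.

Lemma cont_on_const (a b c : R) : cont_on a b (fun _ => c).
Proof. apply continuous_cont_on. intros; apply continuous_const. Qed.

Lemma cont_on_opp (a b : R) (f : R -> R) : cont_on a b f -> cont_on a b (fun x => - f x).
Proof. intros H. apply (cont_on_comp a b f Ropp); auto. intros x _.
  apply (continuous_opp (V := R_NormedModule) (fun y : R => y) (f x)), continuous_id.
Qed.

Lemma cont_on_minus (a b : R) (f g : R -> R) :
  cont_on a b f -> cont_on a b g -> cont_on a b (fun x => f x - g x).
Proof. intros Hf Hg. apply (cont_on_plus a b f (fun x => - g x)); auto. apply cont_on_opp; auto. Qed.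

Lemma cont_on_div (a b : R) (f g : R -> R) :
  cont_on a b f -> cont_on a b g -> (forall x, a <= x <= b -> g x <> 0) ->
  cont_on a b (fun x => f x / g x).
Proof.
  intros Hf Hg Hn. apply (cont_on_mult a b f (fun x => / g x)); auto.
  apply (cont_on_comp a b g Rinv); auto. intros x Hx. apply continuous_Rinv; auto.
Qed.

Definition clamp (a b x : R) : R := Rmax a (Rmin x b).

Lemma clamp_in (a b x : R) : a <= b -> a <= clamp a b x <= b.
Proof. intros H. unfold clamp, Rmax, Rmin. repeat destruct (Rle_dec _ _); lra. Qed.

Lemma clamp_id (a b x : R) : a <= x <= b -> clamp a b x = x.
Proof. intros H. unfold clamp, Rmax, Rmin. repeat destruct (Rle_dec _ _); lra. Qed.

Lemma clamp_lip (a b x y : R) : a <= b -> Rabs (clamp a b x - clamp a b y) <= Rabs (x - y).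
Proof.
  intros H. unfold clamp, Rmax, Rmin. unfold Rabs.
  repeat destruct (Rle_dec _ _); repeat destruct (Rcase_abs _); lra.
Qed.

Lemma cont_on_clamp (a b : R) (f : R -> R) (x : R) :
  a <= b -> cont_on a b f -> continuous (fun y => f (clamp a b y)) x.
Proof.
  intros Hab H. apply continuous_eps. intros eps He.
  destruct (proj1 (cont_on_eps a b f) H (clamp a b x) (clamp_in a b x Hab) eps He) as [de [Hd Hde]].
  exists de; split; auto. intros y Hy. apply Hde. apply clamp_in; auto.
  eapply Rle_lt_trans; [apply clamp_lip; auto | auto].
Qed.

Lemma cont_on_max (a b : R) (f : R -> R) : a <= b -> cont_on a b f ->
  exists x0, a <= x0 <= b /\ forall x, a <= x <= b -> f x <= f x0.
Proof.
  intros Hab H.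
  destruct (continuity_ab_maj (fun y => f (clamp a b y)) a b Hab) as [M [HM1 HM2]].
  { intros c _. apply continuous_pt, cont_on_clamp; auto. }
  exists M; split; auto. intros x Hx. specialize (HM1 x Hx).
  rewrite !clamp_id in HM1; auto.
Qed.

Lemma cont_on_min (a b : R) (f : R -> R) : a <= b -> cont_on a b f ->
  exists x0, a <= x0 <= b /\ forall x, a <= x <= b -> f x0 <= f x.
Proof.
  intros Hab H. destruct (cont_on_max a b (fun x => - f x) Hab) as [x0 [H0 H1]].
  { apply cont_on_opp; auto. }
  exists x0; split; auto. intros x Hx. specialize (H1 x Hx). lra.
Qed.

Lemma cont_on_bounded (a b : R) (f : R -> R) : a <= b -> cont_on a b f ->
  exists B, 0 < B /\ forall x, a <= x <= b -> Rabs (f x) <= B.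
Proof.
  intros Hab H. destruct (cont_on_max a b f Hab H) as [x0 [_ H0]].
  destruct (cont_on_min a b f Hab H) as [x2 [_ H2]].
  exists (Rabs (f x0) + Rabs (f x2) + 1). split.
  - pose proof (Rabs_pos (f x0)). pose proof (Rabs_pos (f x2)). lra.
  - intros x Hx. specialize (H0 x Hx). specialize (H2 x Hx). apply Rabs_le_iff.
    pose proof (Rle_abs (f x0)). pose proof (Rabs_pos (f x0)).
    pose proof (Rle_abs (- f x2)). pose proof (Rabs_pos (f x2)). rewrite Rabs_Ropp in *. lra.
Qed.

Lemma is_derive_local (f g : R -> R) (a b x l : R) : a < x < b ->
  (forall y, a < y < b -> f y = g y) -> is_derive f x l -> is_derive g x l.
Proof.
  intros Hx E H. apply is_derive_ext_loc with (2 := H).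
  assert (Hp : 0 < Rmin (x - a) (b - x)) by (apply Rmin_pos; lra).
  assert (HE : forall y, Rabs (y - x) < Rmin (x - a) (b - x) -> f y = g y).
  { intros y Hy. apply E. apply Rmin_Rgt in Hy. destruct Hy as [H1 H2].
    apply Rgt_lt, Rabs_lt_iff in H1. apply Rgt_lt, Rabs_lt_iff in H2. lra. }
  exists (mkposreal _ Hp). exact HE.
Qed.

Lemma mean_value_sign (a b : R) (f : R -> R) (P : R -> Prop) : a < b -> cont_on a b f ->
  (exists l, P l) ->
  (forall x, a < x < b -> exists l, is_derive f x l /\ P l) ->
  exists l, P l /\ f b - f a = l * (b - a).
Proof.
  intros Hab Hc [l0 Hl0] Hd.
  set (F := fun y => f (clamp a b y)).
  destruct (MVT_gen F a b (fun x => if Rlt_dec a x then if Rlt_dec x b then Derive f x else l0 else l0)) as [c [Hc1 Hc2]].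
  - intros x Hx. rewrite Rmin_left, Rmax_right in Hx by lra.
    destruct (Rlt_dec a x); [|lra]. destruct (Rlt_dec x b); [|lra].
    destruct (Hd x Hx) as [l [Hl _]].
    apply (is_derive_local f F a b); auto.
    + intros y Hy. unfold F. rewrite clamp_id; auto. lra.
    + rewrite (is_derive_unique f x l Hl). exact Hl.
  - intros x _. apply continuous_pt, cont_on_clamp; auto; lra.
  - unfold F in Hc2. rewrite !clamp_id in Hc2 by lra.
    eexists; split; [|exact Hc2]. rewrite Rmin_left, Rmax_right in Hc1 by lra.
    destruct (Rlt_dec a c); auto. destruct (Rlt_dec c b); auto.
    destruct (Hd c ltac:(lra)) as [l [Hl HP]]. rewrite (is_derive_unique f c l Hl). auto.
Qed.

Lemma nondecr_on (a b : R) (f : R -> R) : cont_on a b f ->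
  (forall x, a < x < b -> exists l, is_derive f x l /\ 0 <= l) ->
  forall x y, a <= x -> x <= y -> y <= b -> f x <= f y.
Proof.
  intros Hc Hd x y Hx Hxy Hy. destruct (Req_dec x y) as [->|Hne]; [lra|].
  destruct (mean_value_sign x y f (fun l => 0 <= l)) as [l [Hl E]].
  - lra.
  - apply (cont_on_sub a b); auto.
  - exists 0; lra.
  - intros c Hc2. apply Hd. lra.
  - nra.
Qed.

Lemma nondecr_on_punctured (a b e : R) (f : R -> R) : cont_on a b f ->
  (forall x, a < x < b -> x <> e -> exists l, is_derive f x l /\ 0 <= l) ->
  forall x y, a <= x -> x <= y -> y <= b -> f x <= f y.
Proof.
  intros Hc Hd x y Hx Hxy Hy.
  destruct (Rle_dec e x) as [H1|H1]; [|destruct (Rle_dec y e) as [H2|H2]].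
  - apply (nondecr_on x y); try lra; [apply (cont_on_sub a b); auto; lra | intros; apply Hd; lra].
  - apply (nondecr_on x y); try lra; [apply (cont_on_sub a b); auto; lra | intros; apply Hd; lra].
  - apply Rnot_le_lt in H1; apply Rnot_le_lt in H2; apply Rle_trans with (f e).
    + apply (nondecr_on x e); try lra; [apply (cont_on_sub a b); auto; lra | intros; apply Hd; lra].
    + apply (nondecr_on e y); try lra; [apply (cont_on_sub a b); auto; lra | intros; apply Hd; lra].
Qed.

Lemma derive_at_puncture (f f' : R -> R) (e de : R) : 0 < de -> continuous f e -> continuous f' e ->
  (forall x, Rabs (x - e) < de -> x <> e -> is_derive f x (f' x)) -> is_derive f e (f' e).
Proof.
  intros Hde Hf Hf' Hd. apply is_derive_eps. intros eps He.
  destruct (proj1 (continuous_eps f' e) Hf' eps He) as [d2 [Hd2 H2]].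
  exists (Rmin de d2). split; [apply Rmin_pos; auto|]. intros y Hy.
  apply Rmin_Rgt in Hy. destruct Hy as [Hy1 Hy2]. apply Rgt_lt in Hy1. apply Rgt_lt in Hy2.
  assert (Hcont : forall x, Rabs (x - e) < de -> continuous f x).
  { intros x Hx. destruct (Req_dec x e) as [->|]; auto. apply (is_derive_cont f x (f' x)); auto. }
  apply Rabs_lt_iff in Hy1. apply Rabs_lt_iff in Hy2.
  assert (Hkey : forall lo hi, lo < hi -> Rabs (lo - e) < Rmin de d2 -> Rabs (hi - e) < Rmin de d2 ->
     (lo = e \/ hi = e) -> Rabs (f hi - f lo - f' e * (hi - lo)) <= eps * (hi - lo)).
  { intros lo hi Hlh Hlo Hhi Hor.
    apply Rmin_Rgt in Hlo. apply Rmin_Rgt in Hhi. destruct Hlo as [Hlo1 Hlo2]. destruct Hhi as [Hhi1 Hhi2].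
    apply Rgt_lt, Rabs_lt_iff in Hlo1. apply Rgt_lt, Rabs_lt_iff in Hlo2.
    apply Rgt_lt, Rabs_lt_iff in Hhi1. apply Rgt_lt, Rabs_lt_iff in Hhi2.
    destruct (mean_value_sign lo hi f (fun l => Rabs (l - f' e) <= eps)) as [l [Hl E]]; auto.
    - apply continuous_cont_on. intros x Hx. apply Hcont. apply Rabs_lt_iff. lra.
    - exists (f' e). rewrite Rminus_diag, Rabs_R0. lra.
    - intros x Hx. exists (f' x). split.
      + apply Hd; [apply Rabs_lt_iff; lra | destruct Hor; lra].
      + left. apply H2. apply Rabs_lt_iff. lra.
    - rewrite E. replace (l * (hi - lo) - f' e * (hi - lo)) with ((l - f' e) * (hi - lo)) by ring.
      rewrite Rabs_mult, (Rabs_right (hi - lo)) by lra. apply Rmult_le_compat_r; lra. }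
  assert (He0 : Rabs (e - e) < Rmin de d2).
  { rewrite Rminus_diag, Rabs_R0. apply Rmin_pos; auto. }
  assert (Hym : Rabs (y - e) < Rmin de d2).
  { apply Rmin_glb_lt; apply Rabs_lt_iff; lra. }
  destruct (Rtotal_order y e) as [H|[->|H]].
  - rewrite (Rabs_left (y - e)) by lra. specialize (Hkey y e H Hym He0 (or_intror eq_refl)).
    rewrite <- Rabs_Ropp. replace (- (f y - f e - f' e * (y - e))) with (f e - f y - f' e * (e - y)) by ring.
    lra.
  - replace (f e - f e - f' e * (e - e)) with 0 by ring. rewrite Rminus_diag, Rabs_R0. lra.
  - rewrite (Rabs_right (y - e)) by lra. apply Hkey; auto.
Qed.

Lemma second_derivative_test (F F' : R -> R) (x0 de l : R) : 0 < de ->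
  (forall y, Rabs (y - x0) < de -> is_derive F y (F' y)) ->
  (forall y, Rabs (y - x0) < de -> F y <= F x0) ->
  is_derive F' x0 l -> F' x0 = 0 /\ l <= 0.
Proof.
  intros Hde HF Hmax Hl.
  assert (Hx : Rabs (x0 - x0) < de) by (rewrite Rminus_diag, Rabs_R0; auto).
  assert (H0 : F' x0 = 0).
  { pose proof (proj1 (is_derive_eps F x0 (F' x0)) (HF x0 Hx)) as Hd.
    destruct (Req_dec (F' x0) 0) as [|Hn]; auto. exfalso.
    assert (Hp : 0 < Rabs (F' x0)) by (apply Rabs_pos_lt; auto).
    destruct (Hd (Rabs (F' x0) / 2) ltac:(lra)) as [d1 [Hd1 H1]].
    set (s := Rmin de d1 / 2).
    assert (Hs : 0 < s) by (unfold s; pose proof (Rmin_pos de d1 Hde Hd1); lra).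
    assert (Hs1 : s < de) by (unfold s; pose proof (Rmin_l de d1); lra).
    assert (Hs2 : s < d1) by (unfold s; pose proof (Rmin_r de d1); lra).
    destruct (Rle_lt_dec 0 (F' x0)) as [Hle|Hlt].
    - rewrite Rabs_right in * by lra. specialize (H1 (x0 + s)). specialize (Hmax (x0 + s)).
      replace (x0 + s - x0) with s in * by ring. rewrite (Rabs_right s) in * by lra.
      specialize (H1 Hs2). specialize (Hmax Hs1). apply Rabs_le_iff in H1. nra.
    - rewrite Rabs_left in * by lra. specialize (H1 (x0 - s)). specialize (Hmax (x0 - s)).
      replace (x0 - s - x0) with (- s) in * by ring. rewrite Rabs_Ropp, (Rabs_right s) in * by lra.
      specialize (H1 Hs2). specialize (Hmax Hs1). apply Rabs_le_iff in H1. nra. }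
  split; auto. destruct (Rle_lt_dec l 0) as [|Hlt]; auto. exfalso.
  destruct (proj1 (is_derive_eps F' x0 l) Hl (l / 2) ltac:(lra)) as [d1 [Hd1 H1]].
  set (s := Rmin de d1 / 2).
  assert (Hs : 0 < s) by (unfold s; pose proof (Rmin_pos de d1 Hde Hd1); lra).
  assert (Hs1 : s < de) by (unfold s; pose proof (Rmin_l de d1); lra).
  assert (Hs2 : s < d1) by (unfold s; pose proof (Rmin_r de d1); lra).
  destruct (mean_value_sign x0 (x0 + s) F (fun l => 0 < l)) as [k [Hk E]].
  - lra.
  - apply continuous_cont_on. intros y Hy. apply (is_derive_cont F y (F' y)). apply HF.
    apply Rabs_lt_iff. lra.
  - exists 1; lra.
  - intros y Hy. exists (F' y). split.
    + apply HF. apply Rabs_lt_iff; lra.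
    + specialize (H1 y ltac:(apply Rabs_lt_iff; lra)). rewrite (Rabs_right (y - x0)) in H1 by lra.
      apply Rabs_le_iff in H1. nra.
  - specialize (Hmax (x0 + s)). replace (x0 + s - x0) with s in * by ring.
    rewrite (Rabs_right s) in Hmax by lra. specialize (Hmax Hs1). nra.
Qed.

Definition cont_rect (a b c d : R) (z : R -> R -> R) : Prop :=
  forall x t, a <= x <= b -> c <= t <= d -> forall eps, 0 < eps -> exists de, 0 < de /\
    forall y s, a <= y <= b -> c <= s <= d -> Rabs (y - x) < de -> Rabs (s - t) < de ->
      Rabs (z y s - z x t) < eps.

Lemma cont_rect_bounded (a b c d : R) (z : R -> R -> R) : cont_rect a b c d z ->
  exists B, 0 < B /\ forall x t, a <= x <= b -> c <= t <= d -> Rabs (z x t) <= B.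
Proof.
  intros H.
  assert (Hex : forall x t, exists de : posreal, de <= / (Rabs (z x t) + 1) /\
     (a <= x <= b -> c <= t <= d -> forall y s, a <= y <= b -> c <= s <= d ->
        Rabs (y - x) < de -> Rabs (s - t) < de -> Rabs (z y s - z x t) < 1)).
  { intros x t. pose proof (Rabs_pos (z x t)) as Hp.
    assert (Hi : 0 < / (Rabs (z x t) + 1)) by (apply Rinv_0_lt_compat; lra).
    destruct (classic (a <= x <= b /\ c <= t <= d)) as [[Hx Ht]|Hn].
    - destruct (H x t Hx Ht 1 ltac:(lra)) as [de [Hd Hde]].
      assert (Hm : 0 < Rmin de (/ (Rabs (z x t) + 1))) by (apply Rmin_pos; auto).
      exists (mkposreal _ Hm). simpl. split; [apply Rmin_r|]. intros _ _ y s Hy Hs H1 H2.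
      apply Hde; auto. apply Rlt_le_trans with (1 := H1), Rmin_l. apply Rlt_le_trans with (1 := H2), Rmin_l.
    - exists (mkposreal _ Hi). simpl. split; [lra|]. intros; exfalso; apply Hn; auto. }
  assert (Hch : exists de : R -> R -> posreal, forall x t, de x t <= / (Rabs (z x t) + 1) /\
     (a <= x <= b -> c <= t <= d -> forall y s, a <= y <= b -> c <= s <= d ->
        Rabs (y - x) < de x t -> Rabs (s - t) < de x t -> Rabs (z y s - z x t) < 1)).
  { exists (fun x t => proj1_sig (constructive_indefinite_description _ (Hex x t))).
    intros x t. destruct (constructive_indefinite_description _ (Hex x t)); auto. }
  destruct Hch as [de Hde].
  destruct (compactness_value_2d a b c d de) as [d0 Hd0].
  pose proof (cond_pos d0) as Hd0p. assert (0 < / d0) by (apply Rinv_0_lt_compat; auto).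
  exists (/ d0 + 1). split; [lra|]. intros x t Hx Ht. apply NNPP. intros Hn.
  apply (Hd0 x t Hx Ht). intros [u [v [Hu [Hv [H1 [H2 H3]]]]]]. apply Hn.
  destruct (Hde u v) as [Hb Hl]. specialize (Hl Hu Hv x t Hx Ht H1 H2).
  pose proof (Rabs_pos (z u v)) as Hp.
  assert (Hq : Rabs (z u v) + 1 <= / d0).
  { rewrite <- (Rinv_inv (Rabs (z u v) + 1)). apply Rinv_le_contravar; lra. }
  pose proof (Rabs_triang_inv (z x t) (z u v)). lra.
Qed.

Lemma cont_rect_max (a b c d : R) (z : R -> R -> R) : a <= b -> c <= d -> cont_rect a b c d z ->
  exists x0 t0, a <= x0 <= b /\ c <= t0 <= d /\
    forall x t, a <= x <= b -> c <= t <= d -> z x t <= z x0 t0.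
Proof.
  intros Hab Hcd H. destruct (cont_rect_bounded a b c d z H) as [B [HB HBz]].
  destruct (completeness (fun v => exists x t, a <= x <= b /\ c <= t <= d /\ v = z x t)) as [S [HS1 HS2]].
  - exists B. intros v [x [t [Hx [Ht ->]]]]. specialize (HBz x t Hx Ht). apply Rabs_le_iff in HBz. lra.
  - exists (z a c), a, c. repeat split; lra.
  - apply NNPP. intros Hn.
    assert (Hlt : forall x t, a <= x <= b -> c <= t <= d -> z x t < S).
    { intros x t Hx Ht. destruct (HS1 (z x t) ltac:(exists x, t; auto)) as [|E]; auto.
      exfalso. apply Hn. exists x, t. repeat split; try lra. intros y s Hy Hs. rewrite E.
      apply HS1. exists y, s; auto. }
    destruct (cont_rect_bounded a b c d (fun x t => / (S - z x t))) as [B2 [HB2 HBz2]].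
    { intros x t Hx Ht eps He. pose proof (Hlt x t Hx Ht) as Hl.
      assert (Hc : continuous (fun v => / (S - v)) (z x t)).
      { apply continuous_Rinv_comp; [|lra].
        apply (continuous_minus (fun _ => S) (fun v => v)); [apply continuous_const|apply continuous_id]. }
      destruct (proj1 (continuous_eps _ _) Hc eps He) as [d1 [Hd1 H1]].
      destruct (H x t Hx Ht d1 Hd1) as [d2 [Hd2 H2]].
      exists d2. split; auto. }
    assert (Hub : S <= S - / B2).
    { apply HS2. intros v [x [t [Hx [Ht ->]]]]. pose proof (Hlt x t Hx Ht) as Hl.
      specialize (HBz2 x t Hx Ht). 
      assert (Hi : 0 < / (S - z x t)) by (apply Rinv_0_lt_compat; lra).
      rewrite Rabs_right in HBz2 by lra.
      apply Rinv_le_contravar in HBz2; auto. rewrite Rinv_inv in HBz2. lra. }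
    assert (0 < / B2) by (apply Rinv_0_lt_compat; auto). lra.
Qed.

(** * Maximum principle *)

Definition cont_strip (a b : R) (z : R -> R -> R) : Prop :=
  forall x t, a <= x <= b -> 0 <= t -> forall eps, 0 < eps -> exists de, 0 < de /\
    forall y s, a <= y <= b -> 0 <= s -> Rabs (y - x) < de -> Rabs (s - t) < de ->
      Rabs (z y s - z x t) < eps.

Definition lslope (f : R -> R) (x l : R) : Prop :=
  forall eps, 0 < eps -> exists de, 0 < de /\
    forall y, x - de < y <= x -> Rabs (f y - f x - l * (y - x)) <= eps * (x - y).

Definition rslope (f : R -> R) (x l : R) : Prop :=
  forall eps, 0 < eps -> exists de, 0 < de /\
    forall y, x <= y < x + de -> Rabs (f y - f x - l * (y - x)) <= eps * (y - x).

(* Subsolutions of z_t = d z_xx - al z_x + f with the no-flux condition at a and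
   the Neumann condition at b; convex kinks (zl <= zr) are allowed at e1 and e2. *)
Definition Sub (d al a b e1 e2 : R) (z f : R -> R -> R) : Prop :=
  cont_strip a b z /\ exists zl zr : R -> R -> R, forall t, 0 < t ->
    (forall x, a < x <= b -> lslope (fun y => z y t) x (zl x t)) /\
    (forall x, a <= x < b -> rslope (fun y => z y t) x (zr x t)) /\
    (forall x, a < x < b -> zl x t <= zr x t) /\
    al * z a t <= d * zr a t /\ zl b t <= 0 /\
    (forall x, a < x < b -> x <> e1 -> x <> e2 -> zl x t = zr x t /\
       exists zxx zt, is_derive (fun y => zr y t) x zxx /\ is_derive (fun s => z x s) t zt /\
         zt <= d * zxx - al * zr x t + f x t).

Lemma slopes_is_derive (f : R -> R) (x l : R) : lslope f x l -> rslope f x l -> is_derive f x l.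
Proof.
  intros H1 H2. apply is_derive_eps. intros eps He.
  destruct (H1 eps He) as [d1 [Hd1 K1]]. destruct (H2 eps He) as [d2 [Hd2 K2]].
  exists (Rmin d1 d2). split; [apply Rmin_pos; auto|]. intros y Hy.
  apply Rmin_Rgt in Hy. destruct Hy as [Hy1 Hy2].
  apply Rgt_lt, Rabs_lt_iff in Hy1. apply Rgt_lt, Rabs_lt_iff in Hy2.
  destruct (Rle_dec y x) as [Hle|Hle].
  - rewrite (Rabs_left1 (y - x)) by lra. replace (- (y - x)) with (x - y) by ring. apply K1. lra.
  - rewrite (Rabs_right (y - x)) by lra. apply K2. lra.
Qed.

Lemma is_derive_slopes (f : R -> R) (x l : R) : is_derive f x l -> lslope f x l /\ rslope f x l.
Proof.
  intros H. split; intros eps He;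
  destruct (proj1 (is_derive_eps f x l) H eps He) as [de [Hd Hde]]; exists de; split; auto; intros y Hy.
  - replace (x - y) with (Rabs (y - x)) by (rewrite Rabs_left1; lra). apply Hde. apply Rabs_lt_iff. lra.
  - replace (y - x) with (Rabs (y - x)) at 2 by (rewrite Rabs_right; lra). apply Hde. apply Rabs_lt_iff. lra.
Qed.

Lemma deriv_on_lslope (a b : R) (f f' : R -> R) (x : R) :
  deriv_on a b f f' -> a < x <= b -> lslope f x (f' x).
Proof.
  intros H Hx eps He.
  destruct (proj1 (deriv_on_eps a b f f') H x ltac:(lra) eps He) as [de [Hd Hde]].
  exists (Rmin de (x - a)). split; [apply Rmin_pos; lra|]. intros y Hy.
  pose proof (Rmin_l de (x - a)). pose proof (Rmin_r de (x - a)).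
  replace (x - y) with (Rabs (y - x)) by (rewrite Rabs_left1; lra). apply Hde; [lra|].
  apply Rabs_lt_iff. lra.
Qed.

Lemma deriv_on_rslope (a b : R) (f f' : R -> R) (x : R) :
  deriv_on a b f f' -> a <= x < b -> rslope f x (f' x).
Proof.
  intros H Hx eps He.
  destruct (proj1 (deriv_on_eps a b f f') H x ltac:(lra) eps He) as [de [Hd Hde]].
  exists (Rmin de (b - x)). split; [apply Rmin_pos; lra|]. intros y Hy.
  pose proof (Rmin_l de (b - x)). pose proof (Rmin_r de (b - x)).
  replace (y - x) with (Rabs (y - x)) at 2 by (rewrite Rabs_right; lra). apply Hde; [lra|].
  apply Rabs_lt_iff. lra.
Qed.

Lemma derive_left_max (H : R -> R) (t0 l : R) : 0 < t0 ->
  (forall t, 0 <= t <= t0 -> H t <= H t0) -> is_derive H t0 l -> 0 <= l.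
Proof.
  intros Ht Hm Hd. destruct (Rle_lt_dec 0 l) as [|Hl]; auto. exfalso.
  destruct (proj1 (is_derive_slopes H t0 l Hd) (- l / 2) ltac:(lra)) as [de [Hde K]].
  set (s := Rmin de t0 / 2).
  assert (Hs : 0 < s) by (unfold s; pose proof (Rmin_pos de t0 Hde Ht); lra).
  assert (Hs1 : s < de) by (unfold s; pose proof (Rmin_l de t0); lra).
  assert (Hs2 : s < t0) by (unfold s; pose proof (Rmin_r de t0); lra).
  specialize (K (t0 - s) ltac:(lra)). specialize (Hm (t0 - s) ltac:(lra)).
  apply Rabs_le_iff in K. nra.
Qed.

Lemma abs_sub_local (x0 e : R) : x0 <> e -> exists sg de, (sg = 1 \/ sg = -1) /\ 0 < de /\
  forall y, Rabs (y - x0) < de -> Rabs (y - e) = sg * (y - e).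
Proof.
  intros H. destruct (Rlt_dec x0 e) as [Hl|Hl].
  - exists (-1), (e - x0). split; [auto|]. split; [lra|]. intros y Hy. apply Rabs_lt_iff in Hy.
    rewrite Rabs_left; lra.
  - exists 1, (x0 - e). split; [auto|]. split; [lra|]. intros y Hy. apply Rabs_lt_iff in Hy.
    rewrite Rabs_right; lra.
Qed.

(* The comparison function bends up at both ends and has concave kinks at e1 and e2,
   so a maximum of z minus a multiple of it can only occur at a point where the
   differential inequality is available. *)
Lemma max_principle (d al a b e1 e2 T C : R) (z f : R -> R -> R) :
  0 < d -> 0 <= al -> a < b -> Sub d al a b e1 e2 z f ->
  (forall x, a <= x <= b -> z x 0 <= 0) ->
  (forall x t, a < x < b -> x <> e1 -> x <> e2 -> 0 < t <= T -> 0 < z x t -> f x t <= C * z x t) ->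
  forall x t, a <= x <= b -> 0 <= t <= T -> z x t <= 0.
Proof.
  intros Hd Hal Hab [Hcont [zl [zr Hz]]] H0 Hf x1 t1 Hx1 Ht1.
  destruct (Rle_lt_dec (z x1 t1) 0) as [|Hpos]; auto. exfalso.
  set (N := 3 / (b - a)).
  assert (HN : 0 < N) by (unfold N; apply Rdiv_lt_0_compat; lra).
  assert (HNab : N * (b - a) = 3) by (unfold N; field; lra).
  set (A := 1 + N * (b - a) ^ 2 + 2 * (Rabs a + Rabs b) + Rabs e1 + Rabs e2).
  set (K := fun x => A + N * (x - a) * (x - b) - Rabs (x - e1) - Rabs (x - e2)).
  assert (HK : forall x, a <= x <= b -> 1 <= K x).
  { intros x Hx. unfold K, A.
    assert (Rabs x <= Rabs a + Rabs b).
    { pose proof (Rabs_pos a). pose proof (Rabs_pos b). pose proof (Rle_abs b). pose proof (Rle_abs (- a)).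
      rewrite Rabs_Ropp in *. apply Rabs_le_iff. lra. }
    pose proof (Rabs_triang x (- e1)). pose proof (Rabs_triang x (- e2)). rewrite Rabs_Ropp in *.
    replace (x + - e1) with (x - e1) in * by ring. replace (x + - e2) with (x - e2) in * by ring.
    assert (Hq : 0 <= (b - a) ^ 2 + (x - a) * (x - b)).
    { replace ((b - a)^2 + (x - a) * (x - b)) with ((x-a)*(x-a) + (b-x)*(b-x) + (x-a)*(b-x)) by ring.
      assert (0 <= (x-a)*(b-x)) by (apply Rmult_le_pos; lra). nra. }
    pose proof (Rmult_le_pos N _ (Rlt_le _ _ HN) Hq). lra. }
  set (Lam := Rabs C + 2 * d * N + 5 * al + 1).
  assert (HCL : C + (2 * d * N + 5 * al + 1) <= Lam) by (unfold Lam; pose proof (Rle_abs C); lra).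
  set (zz := fun x t => z x t * exp (- Lam * t)).
  set (eps := zz x1 t1 / (2 * K x1)).
  assert (Hzz1 : 0 < zz x1 t1) by (unfold zz; apply Rmult_lt_0_compat; auto; apply exp_pos).
  assert (Heps : 0 < eps).
  { unfold eps. apply Rdiv_lt_0_compat; auto. specialize (HK x1 Hx1). lra. }
  set (Z := fun x t => zz x t - eps * K x).
  assert (HZ1 : 0 < Z x1 t1).
  { unfold Z, eps. specialize (HK x1 Hx1). replace (zz x1 t1 / (2 * K x1) * K x1) with (zz x1 t1 / 2) by (field; lra). lra. }
  assert (HKc : forall x, continuous K x).
  { intros x. unfold K.
    apply (continuous_minus (fun x => A + N * (x - a) * (x - b) - Rabs (x - e1)) (fun x => Rabs (x - e2)));
      [apply (continuous_minus (fun x => A + N * (x - a) * (x - b)) (fun x => Rabs (x - e1)))|].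
    - apply (ex_derive_continuous (fun x => A + N * (x - a) * (x - b))). auto_derive; auto.
    - apply continuous_comp; [|apply continuous_Rabs].
      apply (ex_derive_continuous (fun x => x - e1)). auto_derive; auto.
    - apply continuous_comp; [|apply continuous_Rabs].
      apply (ex_derive_continuous (fun x => x - e2)). auto_derive; auto. }
  assert (HZc : cont_rect a b 0 T Z).
  { intros x t Hx Ht ee Hee.
    set (B := Rabs (z x t) + 1). assert (HB : 0 < B) by (unfold B; pose proof (Rabs_pos (z x t)); lra).
    assert (Hec : continuous (fun s => exp (- Lam * s)) t).
    { apply (ex_derive_continuous (fun s => exp (- Lam * s))). auto_derive; auto. }
    set (E := exp (- Lam * t) + 1). assert (HE : 1 < E) by (unfold E; pose proof (exp_pos (- Lam * t)); lra).
    destruct (proj1 (continuous_eps _ _) Hec (Rmin 1 (ee / (4 * B))) ltac:(apply Rmin_pos; [lra|apply Rdiv_lt_0_compat; lra])) as [d1 [Hd1 D1]].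
    destruct (Hcont x t Hx ltac:(lra) (Rmin 1 (ee / (4 * E))) ltac:(apply Rmin_pos; [lra|apply Rdiv_lt_0_compat; lra])) as [d2 [Hd2 D2]].
    destruct (proj1 (continuous_eps _ _) (HKc x) (ee / (4 * eps)) ltac:(apply Rdiv_lt_0_compat; lra)) as [d3 [Hd3 D3]].
    exists (Rmin d1 (Rmin d2 d3)). split; [repeat apply Rmin_pos; auto|].
    intros y s Hy Hs Hyx Hst. apply Rmin_Rgt in Hyx. apply Rmin_Rgt in Hst.
    destruct Hyx as [Hyx1 Hyx2]. destruct Hst as [Hst1 Hst2]. apply Rmin_Rgt in Hyx2. apply Rmin_Rgt in Hst2.
    specialize (D1 s Hst1). specialize (D2 y s Hy ltac:(lra) (proj1 Hyx2) (proj1 Hst2)). specialize (D3 y (proj2 Hyx2)).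
    unfold Z, zz.
    set (Es := exp (- Lam * s)) in *. set (Et := exp (- Lam * t)) in *.
    replace (z y s * Es - eps * K y - (z x t * Et - eps * K x))
      with ((z y s - z x t) * Es + z x t * (Es - Et) - eps * (K y - K x)) by ring.
    assert (HEs : 0 < Es) by (unfold Es; apply exp_pos).
    pose proof (Rmin_l 1 (ee / (4 * B))). pose proof (Rmin_r 1 (ee / (4 * B))).
    pose proof (Rmin_r 1 (ee / (4 * E))).
    assert (HEs2 : Es <= E) by (unfold E; apply Rabs_lt_iff in D1; lra).
    assert (T1 : Rabs ((z y s - z x t) * Es) <= ee / 4).
    { rewrite Rabs_mult, (Rabs_right Es) by lra.
      apply Rle_trans with (ee / (4 * E) * E); [|right; field; lra].
      apply Rmult_le_compat; try apply Rabs_pos; lra. }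
    assert (T2 : Rabs (z x t * (Es - Et)) <= ee / 4).
    { rewrite Rabs_mult. apply Rle_trans with (B * (ee / (4 * B))); [|right; field; lra].
      apply Rmult_le_compat; try apply Rabs_pos; [unfold B|]; lra. }
    assert (T3 : Rabs (eps * (K y - K x)) <= ee / 4).
    { rewrite Rabs_mult, (Rabs_right eps) by lra. apply Rle_trans with (eps * (ee / (4 * eps))); [|right; field; lra].
      apply Rmult_le_compat_l; lra. }
    apply Rabs_le_iff in T1. apply Rabs_le_iff in T2. apply Rabs_le_iff in T3. apply Rabs_lt_iff. lra. }
  destruct (cont_rect_max a b 0 T Z ltac:(lra) ltac:(lra) HZc) as [x0 [t0 [Hx0 [Ht0 Hmax]]]].
  assert (HZ0 : 0 < Z x0 t0) by (specialize (Hmax x1 t1 Hx1 Ht1); lra).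
  set (E := exp (- Lam * t0)). assert (HE : 0 < E) by apply exp_pos.
  set (ep := eps / E). assert (Hep : 0 < ep) by (apply Rdiv_lt_0_compat; auto).
  assert (Hepe : ep * E = eps) by (unfold ep; field; lra).
  assert (Hzpos : ep < z x0 t0).
  { unfold Z, zz in HZ0. fold E in HZ0. rewrite <- Hepe in HZ0. specialize (HK x0 Hx0).
    assert (0 < (z x0 t0 - ep * K x0) * E) by lra.
    assert (0 < z x0 t0 - ep * K x0) by (apply Rmult_lt_reg_r with E; lra). nra. }
  assert (Ht0p : 0 < t0).
  { destruct (Rle_lt_or_eq_dec 0 t0 (proj1 Ht0)) as [|Heq]; auto. subst t0. specialize (H0 x0 Hx0). lra. }
  assert (Hcmp : forall x, a <= x <= b -> z x t0 - z x0 t0 <= ep * (K x - K x0)).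
  { intros x Hx. specialize (Hmax x t0 Hx Ht0). unfold Z, zz in Hmax. fold E in Hmax. rewrite <- Hepe in Hmax.
    apply Rmult_le_reg_r with E; auto. lra. }
  destruct (Hz t0 Ht0p) as [Hl [Hr [Hlr [Hba [Hbb Hin]]]]].
  destruct (Req_dec x0 a) as [Ea|Na].
  { subst x0. destruct (Hr a ltac:(lra) (ep / 4) ltac:(lra)) as [de [Hde D]].
    set (s := Rmin (de / 2) ((b - a) / 6)).
    assert (Hs : 0 < s) by (unfold s; apply Rmin_pos; lra).
    assert (Hs1 : s <= de / 2) by apply Rmin_l. assert (Hs2 : s <= (b - a) / 6) by apply Rmin_r.
    specialize (D (a + s) ltac:(lra)). specialize (Hcmp (a + s) ltac:(lra)).
    apply Rabs_le_iff in D. replace (a + s - a) with s in D by ring.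
    assert (0 <= zr a t0) by (apply Rmult_le_reg_l with d; auto; rewrite Rmult_0_r;
      apply Rle_trans with (2 := Hba); apply Rmult_le_pos; lra).
    assert (K (a + s) - K a <= - s / 2).
    { unfold K. pose proof (Rabs_triang (a + s - e1) (- s)). pose proof (Rabs_triang (a + s - e2) (- s)).
      rewrite Rabs_Ropp, (Rabs_right s) in * by lra.
      replace (a + s - e1 + - s) with (a - e1) in * by ring. replace (a + s - e2 + - s) with (a - e2) in * by ring.
      replace (a + s - a) with s by ring. replace (a - a) with 0 by ring.
      assert (N * s * (a + s - b) <= - (5/2) * s).
      { replace (N * s * (a + s - b)) with (s * (N * s - N * (b - a))) by ring. rewrite HNab.
        assert (N * s <= N * ((b - a) / 6)) by (apply Rmult_le_compat_l; lra). nra. }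
      lra. }
    nra. }
  destruct (Req_dec x0 b) as [Eb|Nb].
  { subst x0. destruct (Hl b ltac:(lra) (ep / 4) ltac:(lra)) as [de [Hde D]].
    set (s := Rmin (de / 2) ((b - a) / 6)).
    assert (Hs : 0 < s) by (unfold s; apply Rmin_pos; lra).
    assert (Hs1 : s <= de / 2) by apply Rmin_l. assert (Hs2 : s <= (b - a) / 6) by apply Rmin_r.
    specialize (D (b - s) ltac:(lra)). specialize (Hcmp (b - s) ltac:(lra)).
    apply Rabs_le_iff in D. replace (b - s - b) with (- s) in D by ring. replace (b - (b - s)) with s in D by ring.
    assert (K (b - s) - K b <= - s / 2).
    { unfold K. pose proof (Rabs_triang (b - s - e1) s). pose proof (Rabs_triang (b - s - e2) s).
      rewrite (Rabs_right s) in * by lra.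
      replace (b - s - e1 + s) with (b - e1) in * by ring. replace (b - s - e2 + s) with (b - e2) in * by ring.
      replace (b - s - b) with (- s) by ring. replace (b - b) with 0 by ring.
      assert (N * (b - s - a) * (- s) <= - (5/2) * s).
      { replace (N * (b - s - a) * (- s)) with (s * (N * s - N * (b - a))) by ring. rewrite HNab.
        assert (N * s <= N * ((b - a) / 6)) by (apply Rmult_le_compat_l; lra). nra. }
      lra. }
    nra. }
  assert (Hx0i : a < x0 < b) by lra.
  destruct (classic (x0 = e1 \/ x0 = e2)) as [Hex|Hnex].
  { destruct (Hr x0 ltac:(lra) (ep / 4) ltac:(lra)) as [de [Hde D]].
    destruct (Hl x0 ltac:(lra) (ep / 4) ltac:(lra)) as [de' [Hde' D']].
    set (s := Rmin (Rmin (de / 2) (de' / 2)) (Rmin (Rmin (x0 - a) (b - x0)) (/ (4 * N)))).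
    assert (Hi : 0 < / (4 * N)) by (apply Rinv_0_lt_compat; lra).
    assert (Hs : 0 < s) by (unfold s; repeat apply Rmin_pos; lra).
    pose proof (Rmin_l (Rmin (de / 2) (de' / 2)) (Rmin (Rmin (x0 - a) (b - x0)) (/ (4 * N)))) as M1.
    pose proof (Rmin_r (Rmin (de / 2) (de' / 2)) (Rmin (Rmin (x0 - a) (b - x0)) (/ (4 * N)))) as M2.
    fold s in M1, M2.
    pose proof (Rmin_l (de / 2) (de' / 2)). pose proof (Rmin_r (de / 2) (de' / 2)).
    pose proof (Rmin_l (Rmin (x0 - a) (b - x0)) (/ (4 * N))). pose proof (Rmin_r (Rmin (x0 - a) (b - x0)) (/ (4 * N))).
    pose proof (Rmin_l (x0 - a) (b - x0)). pose proof (Rmin_r (x0 - a) (b - x0)).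
    assert (HNs : N * s <= 1 / 4).
    { apply Rle_trans with (N * / (4 * N)); [apply Rmult_le_compat_l; lra | right; field; lra]. }
    specialize (D (x0 + s) ltac:(lra)). specialize (D' (x0 - s) ltac:(lra)).
    pose proof (Hcmp (x0 + s) ltac:(lra)) as C1. pose proof (Hcmp (x0 - s) ltac:(lra)) as C2.
    apply Rabs_le_iff in D. apply Rabs_le_iff in D'. specialize (Hlr x0 Hx0i).
    replace (x0 + s - x0) with s in D by ring. replace (x0 - s - x0) with (- s) in D' by ring.
    replace (x0 - (x0 - s)) with s in D' by ring.
    assert (Hcvx : forall e, 0 <= Rabs (x0 + s - e) + Rabs (x0 - s - e) - 2 * Rabs (x0 - e)).
    { intros e. pose proof (Rabs_triang (x0 + s - e) (x0 - s - e)).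
      replace (x0 + s - e + (x0 - s - e)) with (2 * (x0 - e)) in * by ring.
      rewrite Rabs_mult, (Rabs_right 2) in * by lra. lra. }
    assert (Hk1 : forall e, x0 = e -> Rabs (x0 + s - e) + Rabs (x0 - s - e) - 2 * Rabs (x0 - e) = 2 * s).
    { intros e <-. replace (x0 + s - x0) with s by ring. replace (x0 - s - x0) with (- s) by ring.
      rewrite Rminus_diag, Rabs_R0, Rabs_Ropp, Rabs_right by lra. ring. }
    assert (K (x0 + s) + K (x0 - s) - 2 * K x0 <= 2 * (N * s) * s - 2 * s).
    { unfold K. pose proof (Hcvx e1). pose proof (Hcvx e2).
      destruct Hex as [He|He]; pose proof (Hk1 _ He); lra. }
    assert (Hlt : 0 <= s * (zr x0 t0 - zl x0 t0)) by (apply Rmult_le_pos; lra).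
    assert ((K (x0 + s) + K (x0 - s) - 2 * K x0) * ep <= (- (3/2) * s) * ep).
    { apply Rmult_le_compat_r; [lra|].
      assert (N * s * s <= 1 / 4 * s) by (apply Rmult_le_compat_r; lra). lra. }
    assert (0 < ep * s) by (apply Rmult_lt_0_compat; auto). lra. }
  assert (Hne1 : x0 <> e1) by tauto. assert (Hne2 : x0 <> e2) by tauto.
  destruct (abs_sub_local x0 e1 Hne1) as [s1 [r1 [Hs1 [Hr1 Habs1]]]].
  destruct (abs_sub_local x0 e2 Hne2) as [s2 [r2 [Hs2 [Hr2 Habs2]]]].
  destruct (Hin x0 Hx0i Hne1 Hne2) as [_ [zxx [zt [Hzxx [Hzt Hpde]]]]].
  set (F := fun y => z y t0 - ep * (A + N * (y - a) * (y - b) - s1 * (y - e1) - s2 * (y - e2))).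
  set (F' := fun y => zr y t0 - ep * (N * (2 * y - a - b) - s1 - s2)).
  assert (Hnear : exists de, 0 < de /\ forall y, Rabs (y - x0) < de -> a < y < b /\ y <> e1 /\ y <> e2 /\
     Rabs (y - e1) = s1 * (y - e1) /\ Rabs (y - e2) = s2 * (y - e2)).
  { assert (P1 : 0 < Rabs (x0 - e1)) by (apply Rabs_pos_lt; lra).
    assert (P2 : 0 < Rabs (x0 - e2)) by (apply Rabs_pos_lt; lra).
    exists (Rmin (Rmin r1 r2) (Rmin (Rmin (x0 - a) (b - x0)) (Rmin (Rabs (x0 - e1)) (Rabs (x0 - e2))))).
    split; [repeat apply Rmin_pos; lra|]. intros y Hy.
    repeat match goal with H : Rabs _ < Rmin _ _ |- _ => apply Rmin_Rgt in H; destruct H as [? ?]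
      | H : Rmin _ _ > _ |- _ => apply Rmin_Rgt in H; destruct H as [? ?] end.
    repeat split; auto.
    - assert (Q : Rabs (y - x0) < x0 - a) by lra. apply Rabs_lt_iff in Q. lra.
    - assert (Q : Rabs (y - x0) < b - x0) by lra. apply Rabs_lt_iff in Q. lra.
    - intros ->. rewrite Rabs_minus_sym in *. lra.
    - intros ->. rewrite Rabs_minus_sym in *. lra. }
  destruct Hnear as [de [Hde Hnear]].
  destruct (second_derivative_test F F' x0 de (zxx - ep * (2 * N))) as [Q1 Q2]; auto.
  - intros y Hy. destruct (Hnear y Hy) as [Hyab [Hy1 [Hy2 _]]].
    apply (is_derive_minus (fun y => z y t0) (fun y => ep * (A + N * (y - a) * (y - b) - s1 * (y - e1) - s2 * (y - e2)))).
    + destruct (Hin y Hyab Hy1 Hy2) as [Heq _]. apply slopes_is_derive.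
      * rewrite <- Heq. apply Hl; lra.
      * apply Hr; lra.
    + auto_derive; auto. ring.
  - intros y Hy. destruct (Hnear y Hy) as [Hyab [_ [_ [R1 R2]]]].
    destruct (Hnear x0) as [_ [_ [_ [R3 R4]]]]; [rewrite Rminus_diag, Rabs_R0; auto|].
    specialize (Hcmp y ltac:(lra)). unfold K in Hcmp. unfold F. rewrite R1, R2, R3, R4 in Hcmp. lra.
  - apply (is_derive_minus (fun y => zr y t0) (fun y => ep * (N * (2 * y - a - b) - s1 - s2))); auto.
    auto_derive; auto. ring.
  - unfold F' in Q1.
    assert (Htime : 0 <= (zt - Lam * z x0 t0) * E).
    { apply (derive_left_max (fun t => z x0 t * exp (- Lam * t)) t0); auto.
      - intros t Ht. specialize (Hmax x0 t Hx0 ltac:(lra)). unfold Z, zz in Hmax. lra.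
      - replace ((zt - Lam * z x0 t0) * E) with (zt * E + z x0 t0 * (- Lam * E)) by ring.
        apply (is_derive_mult (fun t => z x0 t) (fun t => exp (- Lam * t)) t0 zt (- Lam * E)); auto.
        + unfold E. auto_derive; auto. ring.
        + intros; apply Rmult_comm. }
    assert (Htime2 : 0 <= zt - Lam * z x0 t0).
    { apply Rmult_le_reg_r with E; lra. }
    specialize (Hf x0 t0 Hx0i Hne1 Hne2 ltac:(lra) ltac:(lra)).
    assert (Hzr : zr x0 t0 = ep * (N * (2 * x0 - a - b) - s1 - s2)) by lra.
    assert (HNx : - 3 <= N * (2 * x0 - a - b) <= 3).
    { replace (N * (2 * x0 - a - b)) with (2 * (N * (x0 - a)) - N * (b - a)) by ring. rewrite HNab.
      assert (0 <= N * (x0 - a)) by (apply Rmult_le_pos; lra).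
      assert (N * (x0 - a) <= N * (b - a)) by (apply Rmult_le_compat_l; lra). lra. }
    assert (Hzr2 : - (al * zr x0 t0) <= al * (5 * ep)).
    { rewrite Hzr. assert (- (ep * (N * (2 * x0 - a - b) - s1 - s2)) <= 5 * ep).
      { replace (- (ep * (N * (2 * x0 - a - b) - s1 - s2))) with (ep * - (N * (2 * x0 - a - b) - s1 - s2)) by ring.
        rewrite (Rmult_comm 5). apply Rmult_le_compat_l; [lra|]. destruct Hs1, Hs2; lra. }
      replace (- (al * (ep * (N * (2 * x0 - a - b) - s1 - s2)))) with (al * - (ep * (N * (2 * x0 - a - b) - s1 - s2))) by ring.
      apply Rmult_le_compat_l; lra. }
    assert (Hzxx2 : d * zxx <= d * (ep * (2 * N))) by (apply Rmult_le_compat_l; lra).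
    assert (HLz : (C + (2 * d * N + 5 * al + 1)) * z x0 t0 <= Lam * z x0 t0) by (apply Rmult_le_compat_r; lra).
    assert (Hq : (2 * d * N + 5 * al) * ep <= (2 * d * N + 5 * al) * z x0 t0).
    { apply Rmult_le_compat_l; [|lra]. assert (0 < d * N) by (apply Rmult_lt_0_compat; auto). lra. }
    lra.
Qed.

Lemma cont_strip_cont_on (a b t : R) (z : R -> R -> R) : 0 <= t ->
  cont_strip a b z -> cont_on a b (fun x => z x t).
Proof.
  intros Ht H. apply cont_on_eps. intros x Hx eps He.
  destruct (H x t Hx Ht eps He) as [de [Hd D]]. exists de; split; auto.
  intros y Hy Hyx. apply D; auto. rewrite Rminus_diag, Rabs_R0; auto.
Qed.

Lemma cont_strip_rect (a b T : R) (z : R -> R -> R) : cont_strip a b z -> cont_rect a b 0 T z.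
Proof.
  intros H x t Hx Ht eps He. destruct (H x t Hx ltac:(lra) eps He) as [de [Hd D]].
  exists de; split; auto. intros y s Hy Hs. apply D; auto; lra.
Qed.

Lemma cont_strip_plus (a b : R) (z w : R -> R -> R) :
  cont_strip a b z -> cont_strip a b w -> cont_strip a b (fun x t => z x t + w x t).
Proof.
  intros H1 H2 x t Hx Ht eps He.
  destruct (H1 x t Hx Ht (eps / 2) ltac:(lra)) as [d1 [Hd1 D1]].
  destruct (H2 x t Hx Ht (eps / 2) ltac:(lra)) as [d2 [Hd2 D2]].
  exists (Rmin d1 d2). split; [apply Rmin_pos; auto|]. intros y s Hy Hs A B.
  apply Rmin_Rgt in A. apply Rmin_Rgt in B.
  specialize (D1 y s Hy Hs (proj1 A) (proj1 B)). specialize (D2 y s Hy Hs (proj2 A) (proj2 B)).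
  apply Rabs_lt_iff in D1. apply Rabs_lt_iff in D2. apply Rabs_lt_iff. lra.
Qed.

Lemma cont_strip_time (a b : R) (g : R -> R) :
  (forall t, 0 <= t -> continuous g t) -> cont_strip a b (fun _ t => g t).
Proof.
  intros H x t Hx Ht eps He. destruct (proj1 (continuous_eps g t) (H t Ht) eps He) as [de [Hd D]].
  exists de; split; auto.
Qed.

Lemma cont_strip_space (a b : R) (v : R -> R) : cont_on a b v -> cont_strip a b (fun x _ => v x).
Proof.
  intros H x t Hx Ht eps He. destruct (proj1 (cont_on_eps a b v) H x Hx eps He) as [de [Hd D]].
  exists de; split; auto.
Qed.

Lemma cont_strip_mult (a b : R) (g z : R -> R -> R) :
  cont_strip a b g -> cont_strip a b z -> cont_strip a b (fun x t => g x t * z x t).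
Proof.
  intros H1 H2 x t Hx Ht eps He.
  set (G := Rabs (g x t) + 1). set (Z := Rabs (z x t) + 1).
  assert (HG : 0 < G) by (unfold G; pose proof (Rabs_pos (g x t)); lra).
  assert (HZ : 0 < Z) by (unfold Z; pose proof (Rabs_pos (z x t)); lra).
  destruct (H1 x t Hx Ht (Rmin 1 (eps / (2 * Z))) ltac:(apply Rmin_pos; [lra|apply Rdiv_lt_0_compat; lra])) as [d1 [Hd1 D1]].
  destruct (H2 x t Hx Ht (eps / (2 * G)) ltac:(apply Rdiv_lt_0_compat; lra)) as [d2 [Hd2 D2]].
  exists (Rmin d1 d2). split; [apply Rmin_pos; auto|]. intros y s Hy Hs A B.
  apply Rmin_Rgt in A. apply Rmin_Rgt in B.
  specialize (D1 y s Hy Hs (proj1 A) (proj1 B)). specialize (D2 y s Hy Hs (proj2 A) (proj2 B)).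
  apply Rmin_Rgt in D1. destruct D1 as [D1 D1'].
  replace (g y s * z y s - g x t * z x t) with (g y s * (z y s - z x t) + (g y s - g x t) * z x t) by ring.
  eapply Rle_lt_trans; [apply Rabs_triang|]. rewrite !Rabs_mult.
  assert (Hgy : Rabs (g y s) <= G).
  { unfold G. pose proof (Rabs_triang (g x t) (g y s - g x t)).
    replace (g x t + (g y s - g x t)) with (g y s) in * by ring. lra. }
  assert (T1 : Rabs (g y s) * Rabs (z y s - z x t) <= G * Rabs (z y s - z x t))
    by (apply Rmult_le_compat_r; [apply Rabs_pos|auto]).
  assert (T2 : G * Rabs (z y s - z x t) < eps / 2).
  { apply Rlt_le_trans with (G * (eps / (2 * G))); [apply Rmult_lt_compat_l; auto|right; field; lra]. }
  assert (T3 : Rabs (g y s - g x t) * Rabs (z x t) <= Rabs (g y s - g x t) * Z)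
    by (apply Rmult_le_compat_l; [apply Rabs_pos|unfold Z; lra]).
  assert (T4 : Rabs (g y s - g x t) * Z < eps / 2).
  { apply Rlt_le_trans with (eps / (2 * Z) * Z); [apply Rmult_lt_compat_r; auto|right; field; lra]. }
  lra.
Qed.

Lemma cont_strip_shift (a b T : R) (z : R -> R -> R) : 0 <= T ->
  cont_strip a b z -> cont_strip a b (fun x t => z x (t + T)).
Proof.
  intros HT H x t Hx Ht eps He. destruct (H x (t + T) Hx ltac:(lra) eps He) as [de [Hd D]].
  exists de; split; auto. intros y s Hy Hs A B. apply D; auto; [lra|].
  replace (s + T - (t + T)) with (s - t) by ring. auto.
Qed.

Lemma lslope_plus (f g : R -> R) (x l k : R) :
  lslope f x l -> lslope g x k -> lslope (fun y => f y + g y) x (l + k).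
Proof.
  intros H1 H2 eps He.
  destruct (H1 (eps / 2) ltac:(lra)) as [d1 [Hd1 D1]]. destruct (H2 (eps / 2) ltac:(lra)) as [d2 [Hd2 D2]].
  exists (Rmin d1 d2). split; [apply Rmin_pos; auto|]. intros y Hy.
  pose proof (Rmin_l d1 d2). pose proof (Rmin_r d1 d2).
  specialize (D1 y ltac:(lra)). specialize (D2 y ltac:(lra)).
  apply Rabs_le_iff in D1. apply Rabs_le_iff in D2. apply Rabs_le_iff. lra.
Qed.

Lemma rslope_plus (f g : R -> R) (x l k : R) :
  rslope f x l -> rslope g x k -> rslope (fun y => f y + g y) x (l + k).
Proof.
  intros H1 H2 eps He.
  destruct (H1 (eps / 2) ltac:(lra)) as [d1 [Hd1 D1]]. destruct (H2 (eps / 2) ltac:(lra)) as [d2 [Hd2 D2]].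
  exists (Rmin d1 d2). split; [apply Rmin_pos; auto|]. intros y Hy.
  pose proof (Rmin_l d1 d2). pose proof (Rmin_r d1 d2).
  specialize (D1 y ltac:(lra)). specialize (D2 y ltac:(lra)).
  apply Rabs_le_iff in D1. apply Rabs_le_iff in D2. apply Rabs_le_iff. lra.
Qed.

Lemma lslope_scale (f : R -> R) (x l c : R) : lslope f x l -> lslope (fun y => c * f y) x (c * l).
Proof.
  intros H eps He. pose proof (Rabs_pos c) as Hc.
  destruct (H (eps / (Rabs c + 1)) ltac:(apply Rdiv_lt_0_compat; lra)) as [de [Hd D]].
  exists de; split; auto. intros y Hy. specialize (D y Hy).
  replace (c * f y - c * f x - c * l * (y - x)) with (c * (f y - f x - l * (y - x))) by ring.
  rewrite Rabs_mult. apply Rle_trans with (Rabs c * (eps / (Rabs c + 1) * (x - y))).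
  - apply Rmult_le_compat_l; auto.
  - apply Rle_trans with ((Rabs c + 1) * (eps / (Rabs c + 1) * (x - y))); [|right; field; lra].
    apply Rmult_le_compat_r; [|lra]. apply Rmult_le_pos; [|lra]. left; apply Rdiv_lt_0_compat; lra.
Qed.

Lemma rslope_scale (f : R -> R) (x l c : R) : rslope f x l -> rslope (fun y => c * f y) x (c * l).
Proof.
  intros H eps He. pose proof (Rabs_pos c) as Hc.
  destruct (H (eps / (Rabs c + 1)) ltac:(apply Rdiv_lt_0_compat; lra)) as [de [Hd D]].
  exists de; split; auto. intros y Hy. specialize (D y Hy).
  replace (c * f y - c * f x - c * l * (y - x)) with (c * (f y - f x - l * (y - x))) by ring.
  rewrite Rabs_mult. apply Rle_trans with (Rabs c * (eps / (Rabs c + 1) * (y - x))).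
  - apply Rmult_le_compat_l; auto.
  - apply Rle_trans with ((Rabs c + 1) * (eps / (Rabs c + 1) * (y - x))); [|right; field; lra].
    apply Rmult_le_compat_r; [|lra]. apply Rmult_le_pos; [|lra]. left; apply Rdiv_lt_0_compat; lra.
Qed.

Lemma Sub_plus (d al a b e1 e2 : R) (z w f g : R -> R -> R) :
  Sub d al a b e1 e2 z f -> Sub d al a b e1 e2 w g ->
  Sub d al a b e1 e2 (fun x t => z x t + w x t) (fun x t => f x t + g x t).
Proof.
  intros [Hc [zl [zr H]]] [Kc [wl [wr K]]]. split; [apply cont_strip_plus; auto|].
  exists (fun x t => zl x t + wl x t), (fun x t => zr x t + wr x t). intros t Ht.
  destruct (H t Ht) as [H1 [H2 [H3 [H4 [H5 H6]]]]]. destruct (K t Ht) as [K1 [K2 [K3 [K4 [K5 K6]]]]].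
  split; [|split; [|split; [|split; [|split]]]].
  - intros x Hx. apply (lslope_plus (fun y => z y t) (fun y => w y t)); auto.
  - intros x Hx. apply (rslope_plus (fun y => z y t) (fun y => w y t)); auto.
  - intros x Hx. specialize (H3 x Hx). specialize (K3 x Hx). lra.
  - lra.
  - lra.
  - intros x Hx E1 E2. destruct (H6 x Hx E1 E2) as [Hq [zxx [zt [A1 [A2 A3]]]]].
    destruct (K6 x Hx E1 E2) as [Kq [wxx [wt [B1 [B2 B3]]]]].
    split; [lra|]. exists (zxx + wxx), (zt + wt). split; [|split; [|lra]].
    + apply (is_derive_plus (fun y => zr y t) (fun y => wr y t)); auto.
    + apply (is_derive_plus (fun s => z x s) (fun s => w x s)); auto.
Qed.

Lemma Sub_mult_time (d al a b e1 e2 : R) (z f : R -> R -> R) (g g' : R -> R) :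
  (forall t, is_derive g t (g' t)) -> (forall t, 0 <= g t) ->
  Sub d al a b e1 e2 z f ->
  Sub d al a b e1 e2 (fun x t => g t * z x t) (fun x t => g t * f x t + g' t * z x t).
Proof.
  intros Hg Hp [Hc [zl [zr H]]]. split.
  - apply (cont_strip_mult a b (fun _ t => g t) z); auto. apply cont_strip_time.
    intros t _. apply (is_derive_cont g t (g' t)); auto.
  - exists (fun x t => g t * zl x t), (fun x t => g t * zr x t). intros t Ht.
    destruct (H t Ht) as [H1 [H2 [H3 [H4 [H5 H6]]]]]. pose proof (Hp t) as Hgt.
    split; [|split; [|split; [|split; [|split]]]].
    + intros x Hx. apply (lslope_scale (fun y => z y t)); auto.
    + intros x Hx. apply (rslope_scale (fun y => z y t)); auto.
    + intros x Hx. apply Rmult_le_compat_l; auto.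
    + replace (al * (g t * z a t)) with (g t * (al * z a t)) by ring.
      replace (d * (g t * zr a t)) with (g t * (d * zr a t)) by ring. apply Rmult_le_compat_l; auto.
    + rewrite <- (Rmult_0_r (g t)). apply Rmult_le_compat_l; auto.
    + intros x Hx E1 E2. destruct (H6 x Hx E1 E2) as [Hq [zxx [zt [A1 [A2 A3]]]]].
      split; [rewrite Hq; auto|]. exists (g t * zxx), (g' t * z x t + g t * zt). split; [|split].
      * apply (is_derive_scal (fun y => zr y t)); auto.
      * apply (is_derive_mult g (fun s => z x s)); auto. intros; apply Rmult_comm.
      * apply Rmult_le_compat_l with (r := g t) in A3; auto. lra.
Qed.

Lemma Sub_scale (d al a b e1 e2 c : R) (z f : R -> R -> R) : 0 <= c ->
  Sub d al a b e1 e2 z f -> Sub d al a b e1 e2 (fun x t => c * z x t) (fun x t => c * f x t).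
Proof.
  intros Hc H. pose proof (Sub_mult_time d al a b e1 e2 z f (fun _ => c) (fun _ => 0)
     (fun t => is_derive_const c t) (fun _ => Hc) H) as K.
  replace (fun x t => c * f x t) with (fun x t => c * f x t + 0 * z x t); auto.
  apply functional_extensionality; intros x. apply functional_extensionality; intros t. ring.
Qed.

Lemma Sub_neg_time (d al a b e1 e2 : R) (g g' : R -> R) : 0 <= al ->
  (forall t, is_derive g t (g' t)) -> (forall t, 0 <= g t) ->
  Sub d al a b e1 e2 (fun _ t => - g t) (fun _ t => - g' t).
Proof.
  intros Hal Hg Hp.
  assert (Hd : forall t, is_derive (fun s => - g s) t (- g' t)).
  { intros t. apply (is_derive_opp g); auto. }
  split.
  - apply (cont_strip_time a b (fun t => - g t)). intros t _. apply (is_derive_cont _ _ _ (Hd t)).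
  - exists (fun _ _ => 0), (fun _ _ => 0). intros t Ht.
    assert (Hs : forall x, lslope (fun _ => - g t) x 0 /\ rslope (fun _ => - g t) x 0).
    { intros x. apply is_derive_slopes. apply (is_derive_const (- g t)). }
    split; [|split; [|split; [|split; [|split]]]].
    + intros x _. apply Hs.
    + intros x _. apply Hs.
    + intros; lra.
    + pose proof (Rmult_le_pos al (g t) Hal (Hp t)). lra.
    + lra.
    + intros x Hx _ _. split; auto. exists 0, (- g' t). split; [apply (is_derive_const 0)|]. split; auto. lra.
Qed.

Lemma Sub_shift (d al a b e1 e2 T : R) (z f : R -> R -> R) : 0 <= T ->
  Sub d al a b e1 e2 z f -> Sub d al a b e1 e2 (fun x t => z x (t + T)) (fun x t => f x (t + T)).
Proof.
  intros HT [Hc [zl [zr H]]]. split; [apply cont_strip_shift; auto|].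
  exists (fun x t => zl x (t + T)), (fun x t => zr x (t + T)). intros t Ht.
  destruct (H (t + T) ltac:(lra)) as [H1 [H2 [H3 [H4 [H5 H6]]]]].
  split; [|split; [|split; [|split; [|split]]]]; auto.
  intros x Hx E1 E2. destruct (H6 x Hx E1 E2) as [Hq [zxx [zt [A1 [A2 A3]]]]]. split; auto. exists zxx, zt. split; auto. split; auto.
  replace zt with (1 * zt) by ring.
  apply (is_derive_comp (fun s => z x s) (fun s => s + T) t zt 1); auto. auto_derive; auto.
Qed.

Definition Sol (d al a b e : R) (u f : R -> R -> R) : Prop :=
  cont_strip a b u /\ exists ux : R -> R -> R, forall t, 0 < t ->
    deriv_on a b (fun x => u x t) (fun x => ux x t) /\
    d * ux a t - al * u a t = 0 /\ ux b t = 0 /\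
    (forall x, a < x < b -> x <> e -> exists uxx ut,
       is_derive (fun y => ux y t) x uxx /\ is_derive (fun s => u x s) t ut /\
       ut = d * uxx - al * ux x t + f x t).

Lemma Sol_Sub (d al a b e e' c : R) (u f : R -> R -> R) : Sol d al a b e u f ->
  Sub d al a b e e' (fun x t => c * u x t) (fun x t => c * f x t).
Proof.
  intros [Hc [ux H]]. split.
  - apply (cont_strip_mult a b (fun _ _ => c) u); auto. apply cont_strip_time. intros; apply continuous_const.
  - exists (fun x t => c * ux x t), (fun x t => c * ux x t). intros t Ht.
    destruct (H t Ht) as [H1 [H2 [H3 H4]]].
    split; [|split; [|split; [|split; [|split]]]].
    + intros x Hx. apply (lslope_scale (fun y => u y t)). apply (deriv_on_lslope a b _ (fun x => ux x t)); auto.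
    + intros x Hx. apply (rslope_scale (fun y => u y t)). apply (deriv_on_rslope a b _ (fun x => ux x t)); auto.
    + intros; lra.
    + replace (d * (c * ux a t)) with (c * (d * ux a t)) by ring. replace (d * ux a t) with (al * u a t) by lra. lra.
    + rewrite H3. lra.
    + intros x Hx E1 E2. split; auto. destruct (H4 x Hx E1) as [uxx [ut [A1 [A2 A3]]]].
      exists (c * uxx), (c * ut). split; [|split].
      * apply (is_derive_scal (fun y => ux y t)); auto.
      * apply (is_derive_scal (fun s => u x s)); auto.
      * rewrite A3. lra.
Qed.

Lemma steady_Sol (d al a b e : R) (v v' f : R -> R) : deriv_on a b v v' ->
  d * v' a - al * v a = 0 -> v' b = 0 ->
  (forall x, a < x < b -> x <> e -> exists v'', is_derive v' x v'' /\ d * v'' - al * v' x + f x = 0) ->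
  Sol d al a b e (fun x _ => v x) (fun x _ => f x).
Proof.
  intros H1 H2 H3 H4. split.
  - apply (cont_strip_space a b v). apply (deriv_on_cont_on a b v v'); auto.
  - exists (fun x _ => v' x). intros t Ht. repeat (split; auto). intros x Hx He.
    destruct (H4 x Hx He) as [v'' [A B]]. exists v'', 0. split; auto. split; [apply (is_derive_const (v x))|lra].
Qed.

Lemma exp_decay (B K eta : R) : 0 < K -> 0 < eta -> 0 <= B ->
  exists tau, 0 <= tau /\ forall t, tau <= t -> B * exp (- K * t) <= eta.
Proof.
  intros HK He HB. exists (B / (eta * K)).
  assert (HeK : 0 < eta * K) by (apply Rmult_lt_0_compat; auto).
  split; [apply Rmult_le_pos; [auto|left; apply Rinv_0_lt_compat; auto]|].
  intros t Ht.
  assert (HBt : B <= eta * (K * t)).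
  { apply Rmult_le_compat_l with (r := eta * K) in Ht; [|lra].
    replace (eta * K * (B / (eta * K))) with B in Ht by (field; lra). lra. }
  pose proof (exp_ineq1_le (K * t)) as He1.
  replace (- K * t) with (- (K * t)) by ring. rewrite exp_Ropp.
  pose proof (exp_pos (K * t)) as Hp.
  apply Rmult_le_reg_r with (exp (K * t)); auto. rewrite Rmult_assoc, Rinv_l by lra.
  assert (eta * (K * t) <= eta * exp (K * t)) by (apply Rmult_le_compat_l; lra). lra.
Qed.

Lemma eventually_le (d al a b e1 e2 K eta T : R) (z f : R -> R -> R) :
  0 < d -> 0 <= al -> a < b -> 0 < K -> 0 < eta -> 0 <= T -> Sub d al a b e1 e2 z f ->
  (forall x t, a < x < b -> x <> e1 -> x <> e2 -> T < t -> 0 < z x t -> f x t <= K * (eta - z x t)) ->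
  exists T', T <= T' /\ forall x t, a <= x <= b -> T' <= t -> z x t <= 2 * eta.
Proof.
  intros Hd Hal Hab HK Heta HT HS Hf.
  destruct (cont_on_bounded a b (fun x => z x T) ltac:(lra)) as [B [HB HBz]].
  { apply cont_strip_cont_on; auto. apply HS. }
  set (g := fun t => eta + B * exp (- K * t)). set (g' := fun t => - K * (B * exp (- K * t))).
  assert (Hg : forall t, is_derive g t (g' t)).
  { intros t. unfold g, g'. auto_derive; auto. ring. }
  assert (Hgp : forall t, eta <= g t).
  { intros t. unfold g. pose proof (Rmult_lt_0_compat B _ HB (exp_pos (- K * t))). lra. }
  pose proof (Sub_plus _ _ _ _ _ _ _ _ _ _ (Sub_shift _ _ _ _ _ _ T _ _ HT HS)
    (Sub_neg_time d al a b e1 e2 g g' Hal Hg ltac:(intros t; specialize (Hgp t); lra))) as HZ.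
  assert (Hle : forall x t, a <= x <= b -> 0 <= t -> z x (t + T) + - g t <= 0).
  { intros x t Hx Ht.
    apply (max_principle d al a b e1 e2 t 0 _ _ Hd Hal Hab HZ); auto; try lra.
    - intros y Hy. simpl. rewrite Rplus_0_l. specialize (HBz y Hy). apply Rabs_le_iff in HBz.
      unfold g. rewrite Rmult_0_r, exp_0. lra.
    - intros y s Hy E1 E2 Hs Hpos. simpl in *. specialize (Hgp s).
      specialize (Hf y (s + T) Hy E1 E2 ltac:(lra) ltac:(lra)). rewrite Rmult_0_l.
      unfold g, g' in *. assert (0 < K * (z y (s + T) + - (eta + B * exp (- K * s)))) by (apply Rmult_lt_0_compat; auto).
      lra. }
  destruct (exp_decay B K eta HK Heta ltac:(lra)) as [tau [Htau Hexp]].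
  exists (T + tau). split; [lra|]. intros x t Hx Ht.
  specialize (Hle x (t - T) Hx ltac:(lra)). replace (t - T + T) with t in Hle by ring.
  specialize (Hexp (t - T) ltac:(lra)). unfold g in Hle. lra.
Qed.

Lemma steady_le (d al a b e1 e2 K : R) (z f : R -> R) :
  0 < d -> 0 <= al -> a < b -> 0 < K -> Sub d al a b e1 e2 (fun x _ => z x) (fun x _ => f x) ->
  (forall x, a < x < b -> x <> e1 -> x <> e2 -> 0 < z x -> f x <= - K * z x) ->
  forall x, a <= x <= b -> z x <= 0.
Proof.
  intros Hd Hal Hab HK HS Hf x Hx. apply Rnot_lt_le. intros Hpos.
  destruct (eventually_le d al a b e1 e2 K (z x / 4) 0 _ _ Hd Hal Hab HK ltac:(lra) ltac:(lra) HS) as [T [HT H]].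
  - intros y t Hy E1 E2 Ht Hz. simpl. specialize (Hf y Hy E1 E2 Hz).
    assert (0 < K * z x) by (apply Rmult_lt_0_compat; auto). lra.
  - specialize (H x T Hx ltac:(lra)). simpl in H. lra.
Qed.

(** * Linear boundary value problems *)

Definition glue (e : R) (g1 g2 : R -> R) (x : R) : R := if Rle_dec x e then g1 x else g2 x.

Definition prim (e : R) (g1 g2 : R -> R) (x : R) : R :=
  if Rle_dec x e then RInt g1 e x else RInt g2 e x.

Lemma is_derive_RInt_cont (e : R) (g : R -> R) (x : R) : (forall y, continuous g y) ->
  is_derive (fun y => RInt g e y) x (g x).
Proof.
  intros Hg. apply (is_derive_RInt g (fun y => RInt g e y) e x); auto.
  exists (mkposreal 1 Rlt_0_1). intros y _. apply (RInt_correct g).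
  apply (ex_RInt_continuous g). auto.
Qed.

Lemma prim_derive (e : R) (g1 g2 : R -> R) (x : R) :
  (forall y, continuous g1 y) -> (forall y, continuous g2 y) -> x <> e ->
  is_derive (prim e g1 g2) x (glue e g1 g2 x).
Proof.
  intros H1 H2 Hx. unfold glue. destruct (Rle_dec x e) as [Hle|Hgt].
  - apply (is_derive_local (fun y => RInt g1 e y) _ (x - 1) e); [lra| |apply is_derive_RInt_cont; auto].
    intros y Hy. unfold prim. destruct (Rle_dec y e); auto; lra.
  - apply (is_derive_local (fun y => RInt g2 e y) _ e (x + 1)); [lra| |apply is_derive_RInt_cont; auto].
    intros y Hy. unfold prim. destruct (Rle_dec y e); auto; lra.
Qed.

Lemma prim_cont (e : R) (g1 g2 : R -> R) (x : R) :
  (forall y, continuous g1 y) -> (forall y, continuous g2 y) -> continuous (prim e g1 g2) x.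
Proof.
  intros H1 H2. destruct (Req_dec x e) as [->|Hx].
  - apply continuous_eps. intros eps He.
    assert (C1 : continuous (fun y => RInt g1 e y) e) by apply (is_derive_cont _ _ _ (is_derive_RInt_cont e g1 e H1)).
    assert (C2 : continuous (fun y => RInt g2 e y) e) by apply (is_derive_cont _ _ _ (is_derive_RInt_cont e g2 e H2)).
    destruct (proj1 (continuous_eps _ _) C1 eps He) as [d1 [Hd1 D1]].
    destruct (proj1 (continuous_eps _ _) C2 eps He) as [d2 [Hd2 D2]].
    exists (Rmin d1 d2). split; [apply Rmin_pos; auto|]. intros y Hy. apply Rmin_Rgt in Hy.
    specialize (D1 y (proj1 Hy)). specialize (D2 y (proj2 Hy)).
    rewrite (RInt_point e g1) in D1. rewrite (RInt_point e g2) in D2.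
    unfold prim. destruct (Rle_dec e e); [|lra]. rewrite (RInt_point e g1). destruct (Rle_dec y e); auto.
  - apply (is_derive_cont _ _ _ (prim_derive e g1 g2 x H1 H2 Hx)).
Qed.

Lemma glue_mult (e : R) (f g1 g2 : R -> R) (x : R) :
  glue e (fun y => f y * g1 y) (fun y => f y * g2 y) x = f x * glue e g1 g2 x.
Proof. unfold glue. destruct (Rle_dec x e); auto. Qed.

Definition root_p (d al kap : R) : R := kap + al / d.

Definition shift_K (d al kap : R) : R := d * kap ^ 2 + al * kap.

(* Homogeneous solutions of d v'' - al v' - shift_K v = 0 (roots root_p and - kap);
   hom_l satisfies the condition at a, hom_r the condition at b. *)
Definition hom_l (d al a kap x : R) : R :=
  root_p d al kap * exp (root_p d al kap * (x - a)) + kap * exp (- kap * (x - a)).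

Definition hom_r (d al b kap x : R) : R :=
  kap * exp (root_p d al kap * (x - b)) + root_p d al kap * exp (- kap * (x - b)).

Definition hom_l' (d al a kap x : R) : R :=
  root_p d al kap ^ 2 * exp (root_p d al kap * (x - a)) - kap ^ 2 * exp (- kap * (x - a)).

Definition hom_r' (d al b kap x : R) : R :=
  kap * root_p d al kap * (exp (root_p d al kap * (x - b)) - exp (- kap * (x - b))).

(* Wronskian of hom_l and hom_r, up to the factor exp (al / d * x). *)
Definition wronskian (d al a b kap : R) : R :=
  (root_p d al kap + kap) * (root_p d al kap ^ 2 * exp (kap * b - root_p d al kap * a)
                             - kap ^ 2 * exp (kap * a - root_p d al kap * b)).

Lemma wronskian_spec (d al a b kap x : R) : d <> 0 ->
  (hom_l' d al a kap x * hom_r d al b kap x - hom_l d al a kap x * hom_r' d al b kap x)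
    * exp (- (al / d) * x) = wronskian d al a b kap.
Proof.
  intros Hd. unfold hom_l, hom_l', hom_r, hom_r', wronskian. set (l := root_p d al kap).
  assert (Hl : al / d = l - kap) by (unfold l, root_p; ring). rewrite Hl.
  assert (E1 : exp (kap * b - l * a) = exp (l * (x - a)) * exp (- kap * (x - b)) * exp (- (l - kap) * x)).
  { rewrite <- !exp_plus. f_equal. ring. }
  assert (E2 : exp (kap * a - l * b) = exp (- kap * (x - a)) * exp (l * (x - b)) * exp (- (l - kap) * x)).
  { rewrite <- !exp_plus. f_equal. ring. }
  rewrite E1, E2. ring.
Qed.

Lemma wronskian_pos (d al a b kap : R) : 0 < d -> 0 <= al -> a < b -> 0 < kap -> 0 < wronskian d al a b kap.
Proof.
  intros Hd Hal Hab Hk. unfold wronskian. set (l := root_p d al kap).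
  assert (Hl : kap <= l).
  { unfold l, root_p. assert (0 <= al / d) by (apply Rmult_le_pos; auto; left; apply Rinv_0_lt_compat; auto). lra. }
  apply Rmult_lt_0_compat; [lra|].
  assert (exp (kap * a - l * b) < exp (kap * b - l * a)) by (apply exp_increasing; nra).
  pose proof (exp_pos (kap * a - l * b)).
  assert (kap ^ 2 <= l ^ 2) by nra. assert (0 < kap ^ 2) by nra. nra.
Qed.

Definition bvp (d al a b kap e : R) (g1 g2 : R -> R) (x : R) : R :=
  let wt := fun y => exp (- (al / d) * y) in
  let Pl := prim e (fun y => hom_l d al a kap y * wt y * g1 y) (fun y => hom_l d al a kap y * wt y * g2 y) in
  let Pr := prim e (fun y => hom_r d al b kap y * wt y * g1 y) (fun y => hom_r d al b kap y * wt y * g2 y) in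
  (hom_r d al b kap x * (Pl x - Pl a) + hom_l d al a kap x * (Pr b - Pr x)) / (d * wronskian d al a b kap).

Lemma bvp_spec (d al a b kap e : R) (g1 g2 : R -> R) : 0 < d -> 0 <= al -> a < b -> 0 < kap ->
  (forall y, continuous g1 y) -> (forall y, continuous g2 y) ->
  exists v' : R -> R, (forall x : R, is_derive (bvp d al a b kap e g1 g2) x (v' x)) /\ (forall x, continuous v' x) /\
    d * v' a - al * bvp d al a b kap e g1 g2 a = 0 /\ v' b = 0 /\
    forall x, x <> e -> exists v'', is_derive v' x v'' /\
      d * v'' - al * v' x - shift_K d al kap * bvp d al a b kap e g1 g2 x + glue e g1 g2 x = 0.
Proof.
  intros Hd Hal Hab Hk H1 H2.
  set (W := wronskian d al a b kap). assert (HW : 0 < W) by (apply wronskian_pos; auto).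
  set (wt := fun y => exp (- (al / d) * y)).
  set (hl := hom_l d al a kap). set (hr := hom_r d al b kap).
  set (hl' := hom_l' d al a kap). set (hr' := hom_r' d al b kap).
  set (l := root_p d al kap).
  assert (Hl : al = d * (l - kap)) by (unfold l, root_p; field; lra).
  set (Pl := prim e (fun y => hl y * wt y * g1 y) (fun y => hl y * wt y * g2 y)).
  set (Pr := prim e (fun y => hr y * wt y * g1 y) (fun y => hr y * wt y * g2 y)).
  assert (Dl : forall x, is_derive hl x (hl' x)).
  { intros x. unfold hl, hl', hom_l, hom_l'. auto_derive; auto. unfold Rminus; ring. }
  assert (Dr : forall x, is_derive hr x (hr' x)).
  { intros x. unfold hr, hr', hom_r, hom_r'. auto_derive; auto. unfold Rminus; ring. }
  assert (Dl' : forall x, is_derive hl' x ((al * hl' x + shift_K d al kap * hl x) / d)).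
  { intros x. unfold hl, hl', hom_l, hom_l', shift_K. fold l. rewrite Hl. auto_derive; auto. unfold Rminus; field. lra. }
  assert (Dr' : forall x, is_derive hr' x ((al * hr' x + shift_K d al kap * hr x) / d)).
  { intros x. unfold hr, hr', hom_r, hom_r', shift_K. fold l. rewrite Hl. auto_derive; auto. unfold Rminus; field. lra. }
  assert (Cw : forall x, continuous wt x).
  { intros x. unfold wt. apply (ex_derive_continuous (fun y => exp (- (al / d) * y))). auto_derive; auto. }
  assert (Cl : forall x, continuous hl x) by (intros x; apply (is_derive_cont _ _ _ (Dl x))).
  assert (Cr : forall x, continuous hr x) by (intros x; apply (is_derive_cont _ _ _ (Dr x))).
  assert (C3 : forall p g, (forall x, continuous p x) -> (forall x, continuous g x) ->
     forall x : R, continuous (fun y => p y * wt y * g y) x).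
  { intros p g Hp Hg x. apply (continuous_mult (fun y => p y * wt y) g); auto.
    apply (continuous_mult p wt); auto. }
  assert (DPl : forall x, x <> e -> is_derive Pl x (hl x * wt x * glue e g1 g2 x)).
  { intros x Hx. rewrite <- glue_mult with (f := fun y => hl y * wt y). apply prim_derive; auto. }
  assert (DPr : forall x, x <> e -> is_derive Pr x (hr x * wt x * glue e g1 g2 x)).
  { intros x Hx. rewrite <- glue_mult with (f := fun y => hr y * wt y). apply prim_derive; auto. }
  assert (CPl : forall x, continuous Pl x) by (intros x; apply prim_cont; auto).
  assert (CPr : forall x, continuous Pr x) by (intros x; apply prim_cont; auto).
  set (v := fun x => (hr x * (Pl x - Pl a) + hl x * (Pr b - Pr x)) / (d * W)).
  set (v' := fun x => (hr' x * (Pl x - Pl a) + hl' x * (Pr b - Pr x)) / (d * W)).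
  assert (Cgen : forall p q, (forall x, continuous p x) -> (forall x, continuous q x) ->
     forall x : R, continuous (fun x => (p x * (Pl x - Pl a) + q x * (Pr b - Pr x)) / (d * W)) x).
  { intros p q Hp Hq x.
    apply (continuous_mult (fun x => p x * (Pl x - Pl a) + q x * (Pr b - Pr x)) (fun _ => / (d * W)));
      [|apply continuous_const].
    apply (continuous_plus (fun x => p x * (Pl x - Pl a)) (fun x => q x * (Pr b - Pr x))).
    - apply (continuous_mult p (fun x => Pl x - Pl a)); auto.
      apply (continuous_minus Pl (fun _ => Pl a)); auto. apply continuous_const.
    - apply (continuous_mult q (fun x => Pr b - Pr x)); auto.
      apply (continuous_minus (fun _ => Pr b) Pr); auto. apply continuous_const. }
  assert (Dgen : forall p q p' q' x, is_derive p x p' -> is_derive q x q' -> x <> e ->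
     is_derive (fun x => (p x * (Pl x - Pl a) + q x * (Pr b - Pr x)) / (d * W)) x
       ((p' * (Pl x - Pl a) + q' * (Pr b - Pr x) + (p x * hl x - q x * hr x) * (wt x * glue e g1 g2 x)) / (d * W))).
  { intros p q p' q' x Hp Hq Hx. specialize (DPl x Hx). specialize (DPr x Hx).
    assert (X1 : is_derive (fun y => Pl y - Pl a) x (hl x * wt x * glue e g1 g2 x)).
    { replace (hl x * wt x * glue e g1 g2 x) with (hl x * wt x * glue e g1 g2 x - 0) by ring.
      apply (is_derive_minus Pl (fun _ => Pl a)); auto. apply (is_derive_const (Pl a)). }
    assert (X2 : is_derive (fun y => Pr b - Pr y) x (- (hr x * wt x * glue e g1 g2 x))).
    { replace (- (hr x * wt x * glue e g1 g2 x)) with (0 - hr x * wt x * glue e g1 g2 x) by ring.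
      apply (is_derive_minus (fun _ => Pr b) Pr); auto. apply (is_derive_const (Pr b)). }
    pose proof (is_derive_mult p (fun y => Pl y - Pl a) x _ _ Hp X1 Rmult_comm) as Y1.
    pose proof (is_derive_mult q (fun y => Pr b - Pr y) x _ _ Hq X2 Rmult_comm) as Y2.
    pose proof (is_derive_plus _ _ x _ _ Y1 Y2) as Y3.
    pose proof (is_derive_scal _ x (/ (d * W)) _ Y3) as Y4.
    match goal with |- is_derive _ _ ?k => match type of Y4 with is_derive _ _ ?l => replace k with l end end.
    - eapply is_derive_ext; [|exact Y4].
      intros y. simpl. unfold plus, mult; simpl. unfold Rdiv. apply Rmult_comm.
    - unfold plus, mult, scal; simpl. unfold mult; simpl. unfold Rdiv.
      match goal with |- ?k = ?l => change (@eq R k l) end. ring. }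
  assert (Hvd : forall x, x <> e -> is_derive v x (v' x)).
  { intros x Hx. pose proof (Dgen hr hl (hr' x) (hl' x) x (Dr x) (Dl x) Hx) as Y.
    replace (v' x) with ((hr' x * (Pl x - Pl a) + hl' x * (Pr b - Pr x) + (hr x * hl x - hl x * hr x) * (wt x * glue e g1 g2 x)) / (d * W)); auto.
    unfold v'. replace (hr x * hl x - hl x * hr x) with 0 by ring. f_equal. ring. }
  assert (Cv : forall x, continuous v x) by (intros x; apply Cgen; auto).
  assert (Cv' : forall x, continuous v' x).
  { intros x; apply Cgen; auto; intros y; [apply (is_derive_cont _ _ _ (Dr' y))|apply (is_derive_cont _ _ _ (Dl' y))]. }
  change (bvp d al a b kap e g1 g2) with v.
  exists v'. split; [|split; [|split; [|split]]]; auto.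
  - intros x. destruct (Req_dec x e) as [->|Hx]; auto.
    apply (derive_at_puncture v v' e 1); auto; lra.
  - assert (Hb : d * hl' a - al * hl a = 0).
    { unfold hl', hl, hom_l', hom_l. fold l. replace (a - a) with 0 by ring. rewrite !Rmult_0_r, exp_0, Hl. ring. }
    unfold v', v. replace (Pl a - Pl a) with 0 by ring. rewrite !Rmult_0_r, !Rplus_0_l.
    replace (d * (hl' a * (Pr b - Pr a) / (d * W)) - al * (hl a * (Pr b - Pr a) / (d * W)))
      with ((d * hl' a - al * hl a) * ((Pr b - Pr a) / (d * W))) by (unfold Rdiv; ring).
    rewrite Hb. ring.
  - unfold v', hr', hom_r'. replace (b - b) with 0 by ring. replace (Pr b - Pr b) with 0 by ring.
    rewrite !Rmult_0_r, exp_0. unfold Rdiv. ring.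
  - intros x Hx. eexists. split; [apply (Dgen hr' hl' _ _ x (Dr' x) (Dl' x) Hx)|].
    assert (HWx : (hl' x * hr x - hl x * hr' x) * wt x = W) by (apply wronskian_spec; lra).
    replace ((hr' x * hl x - hl' x * hr x) * (wt x * glue e g1 g2 x)) with (- (((hl' x * hr x - hl x * hr' x) * wt x) * glue e g1 g2 x)) by ring.
    rewrite HWx. unfold v, v'. field. lra.
Qed.

Lemma Sub_ext (d al a b e1 e2 : R) (z z' f f' : R -> R -> R) :
  (forall x t, z x t = z' x t) -> (forall x t, f x t = f' x t) ->
  Sub d al a b e1 e2 z f -> Sub d al a b e1 e2 z' f'.
Proof.
  intros E1 E2 H.
  replace z' with z; [replace f' with f; auto|];
  apply functional_extensionality; intros x; apply functional_extensionality; intros t; auto.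
Qed.

Lemma shift_K_pos (d al kap : R) : 0 < d -> 0 <= al -> 0 < kap -> 0 < shift_K d al kap.
Proof. intros Hd Hal Hk. unfold shift_K. assert (0 < d * kap ^ 2) by (apply Rmult_lt_0_compat; nra). nra. Qed.

Lemma shift_K_large (d al C : R) : 0 < d -> 0 <= al -> 0 <= C -> exists kap, 0 < kap /\ C <= shift_K d al kap.
Proof.
  intros Hd Hal HC. exists (1 + C / d).
  assert (H : 0 <= C / d) by (apply Rmult_le_pos; auto; left; apply Rinv_0_lt_compat; auto).
  split; [lra|]. unfold shift_K.
  assert (0 <= al * (1 + C / d)) by (apply Rmult_le_pos; lra).
  assert (C <= d * (1 + C / d) ^ 2); [|lra].
  replace C with (d * (C / d)) at 1 by (field; lra). apply Rmult_le_compat_l; [lra|]. nra.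
Qed.

Lemma bvp_cont (d al a b kap e : R) (g1 g2 : R -> R) : 0 < d -> 0 <= al -> a < b -> 0 < kap ->
  (forall y, continuous g1 y) -> (forall y, continuous g2 y) ->
  forall x, continuous (bvp d al a b kap e g1 g2) x.
Proof.
  intros Hd Hal Hab Hk H1 H2 x.
  destruct (bvp_spec d al a b kap e g1 g2 Hd Hal Hab Hk H1 H2) as [v' [Hv _]].
  apply (is_derive_cont _ _ _ (Hv x)).
Qed.

Lemma bvp_Sol (d al a b kap e : R) (g1 g2 : R -> R) : 0 < d -> 0 <= al -> a < b -> 0 < kap ->
  (forall y, continuous g1 y) -> (forall y, continuous g2 y) ->
  Sol d al a b e (fun x _ => bvp d al a b kap e g1 g2 x)
    (fun x _ => glue e g1 g2 x - shift_K d al kap * bvp d al a b kap e g1 g2 x).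
Proof.
  intros Hd Hal Hab Hk H1 H2.
  destruct (bvp_spec d al a b kap e g1 g2 Hd Hal Hab Hk H1 H2) as [v' [Hv [_ [Ha [Hb Hode]]]]].
  apply (steady_Sol d al a b e _ v'); auto.
  - apply is_derive_deriv_on; auto.
  - intros x Hx He. destruct (Hode x He) as [v'' [A B]]. exists v''. split; auto. lra.
Qed.

Lemma bvp_compare (d al a b kap e eta : R) (g1 g2 k1 k2 : R -> R) :
  0 < d -> 0 <= al -> a < b -> 0 < kap -> 0 <= eta ->
  (forall y, continuous g1 y) -> (forall y, continuous g2 y) ->
  (forall y, continuous k1 y) -> (forall y, continuous k2 y) ->
  (forall x, a < x < b -> x <> e -> glue e g1 g2 x - glue e k1 k2 x <= shift_K d al kap * eta) ->
  forall x, a <= x <= b -> bvp d al a b kap e g1 g2 x <= bvp d al a b kap e k1 k2 x + eta.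
Proof.
  intros Hd Hal Hab Hk Heta G1 G2 K1 K2 Hle x Hx.
  pose proof (bvp_Sol d al a b kap e g1 g2 Hd Hal Hab Hk G1 G2) as S1.
  pose proof (bvp_Sol d al a b kap e k1 k2 Hd Hal Hab Hk K1 K2) as S2.
  apply (Sol_Sub _ _ _ _ _ e 1) in S1. apply (Sol_Sub _ _ _ _ _ e (-1)) in S2.
  pose proof (Sub_neg_time d al a b e e (fun _ => eta) (fun _ => 0) Hal
    (fun t => is_derive_const eta t) (fun _ => Heta)) as S3.
  pose proof (Sub_plus _ _ _ _ _ _ _ _ _ _ (Sub_plus _ _ _ _ _ _ _ _ _ _ S1 S2) S3) as S4.
  pose proof (shift_K_pos d al kap Hd Hal Hk) as HK.
  pose proof (steady_le d al a b e e (shift_K d al kap)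
   (fun x => 1 * bvp d al a b kap e g1 g2 x + -1 * bvp d al a b kap e k1 k2 x + - eta) _ Hd Hal Hab HK S4) as Hfin.
  simpl in Hfin.
  assert (1 * bvp d al a b kap e g1 g2 x + -1 * bvp d al a b kap e k1 k2 x + - eta <= 0); [|lra].
  apply Hfin; auto. intros y Hy He _ Hpos. specialize (Hle y Hy He). lra.
Qed.

Lemma bvp_lipschitz (d al a b kap e B : R) : 0 < d -> 0 <= al -> a < b -> 0 < kap -> 0 <= B ->
  exists Lam, 0 <= Lam /\ forall g1 g2 : R -> R,
  (forall y, continuous g1 y) -> (forall y, continuous g2 y) ->
  (forall x, a < x < b -> x <> e -> Rabs (glue e g1 g2 x) <= B) ->
  forall x y, a <= x <= b -> a <= y <= b ->
    Rabs (bvp d al a b kap e g1 g2 x - bvp d al a b kap e g1 g2 y) <= Lam * Rabs (x - y).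
Proof.
  intros Hd Hal Hab Hk HB. pose proof (shift_K_pos d al kap Hd Hal Hk) as HK.
  set (K := shift_K d al kap) in *.
  set (Q := 2 * B / d). assert (HQ : 0 <= Q) by (apply Rmult_le_pos; [lra|left; apply Rinv_0_lt_compat; auto]).
  assert (Had : 0 <= al / d) by (apply Rmult_le_pos; auto; left; apply Rinv_0_lt_compat; auto).
  exists (exp (al / d * (b - a)) * (Q * (b - a))).
  assert (HLam : 0 <= exp (al / d * (b - a)) * (Q * (b - a))).
  { apply Rmult_le_pos; [left; apply exp_pos|]. apply Rmult_le_pos; lra. }
  split; auto. intros g1 g2 G1 G2 Hg.
  destruct (bvp_spec d al a b kap e g1 g2 Hd Hal Hab Hk G1 G2) as [v' [Hv [Cv' [Ha [Hb Hode]]]]].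
  pose proof (bvp_Sol d al a b kap e g1 g2 Hd Hal Hab Hk G1 G2) as S1.
  set (v := bvp d al a b kap e g1 g2) in *. fold K in S1, Hode.
  assert (HBK : 0 <= B / K) by (apply Rmult_le_pos; auto; left; apply Rinv_0_lt_compat; auto).
  assert (Hbound : forall sg, (sg = 1 \/ sg = -1) -> forall x, a <= x <= b -> sg * v x <= B / K).
  { intros sg Hsg x Hx. pose proof (Sol_Sub _ _ _ _ _ e sg _ _ S1) as S2.
    pose proof (Sub_neg_time d al a b e e (fun _ => B / K) (fun _ => 0) Hal
      (fun t => is_derive_const (B / K) t) (fun _ => HBK)) as S3.
    pose proof (Sub_plus _ _ _ _ _ _ _ _ _ _ S2 S3) as S4.
    pose proof (steady_le d al a b e e K (fun x => sg * v x + - (B / K)) _ Hd Hal Hab HK S4) as Hfin.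
    simpl in Hfin. assert (sg * v x + - (B / K) <= 0); [|lra].
    apply Hfin; auto. intros y Hy He _ _. specialize (Hg y Hy He). apply Rabs_le_iff in Hg.
    replace (- K * (sg * v y + - (B / K))) with (B - sg * (K * v y)) by (field; lra).
    destruct Hsg as [-> | ->]; lra. }
  assert (HKv : forall x, a <= x <= b -> - B <= K * v x <= B).
  { intros x Hx. pose proof (Hbound 1 (or_introl eq_refl) x Hx) as B1.
    pose proof (Hbound (-1) (or_intror eq_refl) x Hx) as B2.
    apply Rmult_le_compat_l with (r := K) in B1; [|lra]. apply Rmult_le_compat_l with (r := K) in B2; [|lra].
    replace (K * (B / K)) with B in * by (field; lra). lra. }
  set (om := fun x => exp (- (al / d) * (x - a))).
  assert (Hom : forall x, is_derive om x (- (al / d) * om x)).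
  { intros x. unfold om. auto_derive; auto. unfold Rminus; ring. }
  assert (Hom1 : forall x, a <= x -> 0 < om x <= 1).
  { intros x Hx. unfold om. split; [apply exp_pos|]. rewrite <- exp_0.
    destruct (Rle_lt_or_eq_dec 0 (al / d * (x - a))) as [Hlt|Heq].
    - apply Rmult_le_pos; lra.
    - left. apply exp_increasing. lra.
    - right. f_equal. lra. }
  assert (Hqb : forall sg, (sg = 1 \/ sg = -1) -> forall x, a <= x <= b -> sg * (om x * v' x) <= Q * (b - a)).
  { intros sg Hsg x Hx.
    assert (Hmon : sg * (om x * v' x) + Q * x <= sg * (om b * v' b) + Q * b).
    { apply (nondecr_on_punctured a b e (fun x => sg * (om x * v' x) + Q * x)); try lra.
      - apply continuous_cont_on. intros y _.
        apply (continuous_plus (fun x => sg * (om x * v' x)) (fun x => Q * x)).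
        + apply (continuous_mult (fun _ => sg) (fun x => om x * v' x)); [apply continuous_const|].
          apply (continuous_mult om v'); auto. apply (is_derive_cont _ _ _ (Hom y)).
        + apply (continuous_mult (fun _ => Q) (fun x => x)); [apply continuous_const|apply continuous_id].
      - intros y Hy He. destruct (Hode y He) as [v'' [A E]].
        exists (sg * (- (al / d) * om y * v' y + om y * v'') + Q). split.
        + apply (is_derive_plus (fun x => sg * (om x * v' x)) (fun x => Q * x)).
          * apply (is_derive_scal (fun x => om x * v' x)).
            apply (is_derive_mult om v'); auto. intros; apply Rmult_comm.
          * auto_derive; auto. ring.
        + replace (- (al / d) * om y * v' y + om y * v'') with (om y * ((K * v y - glue e g1 g2 y) / d)).
          2:{ replace v'' with ((al * v' y + K * v y - glue e g1 g2 y) / d) by (field_simplify_eq; lra). field. lra. }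
          specialize (Hg y Hy He). apply Rabs_le_iff in Hg. specialize (HKv y ltac:(lra)).
          destruct (Hom1 y ltac:(lra)) as [O1 O2].
          assert (Hr : Rabs ((K * v y - glue e g1 g2 y) / d) <= Q).
          { unfold Rdiv. rewrite Rabs_mult, (Rabs_right (/ d)) by (apply Rle_ge; left; apply Rinv_0_lt_compat; auto).
            unfold Q, Rdiv. apply Rmult_le_compat_r; [left; apply Rinv_0_lt_compat; auto|].
            apply Rabs_le_iff. lra. }
          apply Rabs_le_iff in Hr. destruct Hsg as [-> | ->]; nra. }
    rewrite Hb, !Rmult_0_r in Hmon. assert (0 <= Q * (x - a)) by (apply Rmult_le_pos; lra). lra. }
  assert (Hv'b : forall x, a <= x <= b -> Rabs (v' x) <= exp (al / d * (b - a)) * (Q * (b - a))).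
  { intros x Hx. destruct (Hom1 x ltac:(lra)) as [O1 _].
    assert (Hq : Rabs (om x * v' x) <= Q * (b - a)).
    { pose proof (Hqb 1 (or_introl eq_refl) x Hx). pose proof (Hqb (-1) (or_intror eq_refl) x Hx).
      apply Rabs_le_iff. lra. }
    rewrite Rabs_mult, (Rabs_right (om x)) in Hq by lra.
    assert (Hinv : 1 <= exp (al / d * (b - a)) * om x).
    { unfold om. rewrite <- exp_plus, <- exp_0.
      replace (al / d * (b - a) + - (al / d) * (x - a)) with (al / d * (b - x)) by ring.
      destruct (Rle_lt_or_eq_dec 0 (al / d * (b - x))) as [Hlt|Heq].
      - apply Rmult_le_pos; lra.
      - left. apply exp_increasing. lra.
      - right. f_equal. lra. }
    apply Rle_trans with (exp (al / d * (b - a)) * (om x * Rabs (v' x))).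
    - rewrite <- Rmult_assoc. pose proof (Rabs_pos (v' x)). nra.
    - apply Rmult_le_compat_l; auto. left; apply exp_pos. }
  assert (Hord : forall x y, a <= x -> x < y -> y <= b -> Rabs (v x - v y) <= exp (al / d * (b - a)) * (Q * (b - a)) * Rabs (x - y)).
  { intros x y Hx Hxy Hy.
    destruct (mean_value_sign x y v (fun l => Rabs l <= exp (al / d * (b - a)) * (Q * (b - a)))) as [l [Hl E]]; auto.
    - apply continuous_cont_on. intros s _. apply (is_derive_cont _ _ _ (Hv s)).
    - exists 0. rewrite Rabs_R0. auto.
    - intros s Hs. exists (v' s). split; auto. apply Hv'b. lra.
    - rewrite Rabs_minus_sym, E, Rabs_mult, (Rabs_minus_sym y x). apply Rmult_le_compat_r; auto. apply Rabs_pos. }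
  intros x y Hx Hy. destruct (Rtotal_order x y) as [H|[->|H]].
  - apply Hord; lra.
  - rewrite !Rminus_diag, Rabs_R0. lra.
  - rewrite Rabs_minus_sym, (Rabs_minus_sym x y). apply Hord; lra.
Qed.

Lemma equilipschitz_uniform_aux (Lam eps : R) (v : nat -> R -> R) (V : R -> R) (k : nat) :
  0 <= Lam -> 0 < eps -> forall a b, a <= b -> b <= a + INR k * (eps / (3 * (Lam + 1))) ->
  (forall n x y, a <= x <= b -> a <= y <= b -> Rabs (v n x - v n y) <= Lam * Rabs (x - y)) ->
  (forall x y, a <= x <= b -> a <= y <= b -> Rabs (V x - V y) <= Lam * Rabs (x - y)) ->
  (forall x, a <= x <= b -> is_lim_seq (fun n => v n x) (V x)) ->
  exists N, forall n x, (N <= n)%nat -> a <= x <= b -> Rabs (v n x - V x) <= eps.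
Proof.
  intros HL He. set (de := eps / (3 * (Lam + 1))).
  assert (Hde : 0 < de) by (apply Rdiv_lt_0_compat; lra).
  assert (HLd : Lam * de <= eps / 3).
  { apply Rle_trans with ((Lam + 1) * de); [apply Rmult_le_compat_r; lra|]. right. unfold de. field. lra. }
  assert (Hshort : forall a b, a <= b -> b <= a + de ->
    (forall n x y, a <= x <= b -> a <= y <= b -> Rabs (v n x - v n y) <= Lam * Rabs (x - y)) ->
    (forall x y, a <= x <= b -> a <= y <= b -> Rabs (V x - V y) <= Lam * Rabs (x - y)) ->
    (forall x, a <= x <= b -> is_lim_seq (fun n => v n x) (V x)) ->
    exists N, forall n x, (N <= n)%nat -> a <= x <= b -> Rabs (v n x - V x) <= eps).
  { intros a b Hab Hb H1 H2 H3.
    destruct (proj2 (is_lim_seq_spec _ _) (H3 a ltac:(lra)) (mkposreal (eps / 3) ltac:(lra))) as [N HN].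
    exists N. intros n x Hn Hx. specialize (HN n Hn). simpl in HN.
    specialize (H1 n x a Hx ltac:(lra)). specialize (H2 x a Hx ltac:(lra)).
    rewrite (Rabs_right (x - a)) in * by lra.
    assert (Lam * (x - a) <= Lam * de) by (apply Rmult_le_compat_l; lra).
    apply Rabs_le_iff in H1. apply Rabs_le_iff in H2. apply Rabs_lt_iff in HN. apply Rabs_le_iff. lra. }
  induction k as [|k IH]; intros a b Hab Hb H1 H2 H3.
  - simpl in Hb. apply Hshort; auto. lra.
  - destruct (Rle_dec b (a + de)) as [Hs|Hs]; [apply Hshort; auto|].
    rewrite S_INR in Hb.
    destruct (Hshort a (a + de)) as [N1 HN1]; try lra.
    + intros; apply H1; lra.
    + intros; apply H2; lra.
    + intros; apply H3; lra.
    + destruct (IH (a + de) b) as [N2 HN2]; try lra.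
      * intros; apply H1; lra.
      * intros; apply H2; lra.
      * intros; apply H3; lra.
      * exists (Nat.max N1 N2). intros n x Hn Hx.
        destruct (Rle_dec x (a + de)); [apply HN1 | apply HN2]; try lra; lia.
Qed.

Lemma equilipschitz_limit (a b Lam : R) (v : nat -> R -> R) : a <= b -> 0 <= Lam ->
  (forall n x y, a <= x <= b -> a <= y <= b -> Rabs (v n x - v n y) <= Lam * Rabs (x - y)) ->
  (forall x, a <= x <= b -> ex_finite_lim_seq (fun n => v n x)) ->
  exists V : R -> R, (forall x, continuous V x) /\
    (forall x, a <= x <= b -> is_lim_seq (fun n => v n x) (V x)) /\
    forall eps, 0 < eps -> exists N, forall n x, (N <= n)%nat -> a <= x <= b -> Rabs (v n x - V x) <= eps.
Proof.
  intros Hab HL H1 H2.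
  set (V := fun x => real (Lim_seq (fun n => v n (clamp a b x)))).
  assert (HV : forall x, a <= x <= b -> is_lim_seq (fun n => v n x) (V x)).
  { intros x Hx. unfold V. rewrite clamp_id by auto. apply Lim_seq_correct'. auto. }
  assert (HVL : forall x y, a <= x <= b -> a <= y <= b -> Rabs (V x - V y) <= Lam * Rabs (x - y)).
  { intros x y Hx Hy.
    assert (HD : is_lim_seq (fun n => Rabs (v n x - v n y)) (Rabs (V x - V y))).
    { apply (is_lim_seq_abs (fun n => v n x - v n y) (V x - V y)). apply is_lim_seq_minus'; auto. }
    apply (is_lim_seq_le (fun n => Rabs (v n x - v n y)) (fun _ => Lam * Rabs (x - y)) (Rabs (V x - V y)) (Lam * Rabs (x - y))); auto.
    apply is_lim_seq_const. }
  exists V. split; [|split; auto].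
  - intros x. assert (HVc : V = fun y => V (clamp a b y)).
    { apply functional_extensionality. intros y. unfold V.
      rewrite (clamp_id a b (clamp a b y)); auto. apply clamp_in; auto. }
    rewrite HVc. apply (cont_on_clamp a b V); auto.
    apply cont_on_eps. intros y Hy eps He. exists (eps / (Lam + 1)).
    split; [apply Rdiv_lt_0_compat; lra|]. intros s Hs Hsy. specialize (HVL s y Hs Hy).
    apply Rle_lt_trans with (1 := HVL).
    apply Rle_lt_trans with ((Lam + 1) * Rabs (s - y)).
    + apply Rmult_le_compat_r; [apply Rabs_pos|lra].
    + apply Rmult_lt_compat_l with (r := Lam + 1) in Hsy; [|lra].
      replace ((Lam + 1) * (eps / (Lam + 1))) with eps in Hsy by (field; lra). auto.
  - intros eps He.
    assert (Hde : 0 < eps / (3 * (Lam + 1))) by (apply Rdiv_lt_0_compat; lra).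
    destruct (INR_unbounded ((b - a) / (eps / (3 * (Lam + 1))))) as [k Hk].
    apply (equilipschitz_uniform_aux Lam eps v V k); auto.
    apply Rgt_lt in Hk. apply Rmult_lt_compat_r with (r := eps / (3 * (Lam + 1))) in Hk; auto.
    replace ((b - a) / (eps / (3 * (Lam + 1))) * (eps / (3 * (Lam + 1)))) with (b - a) in Hk by (field; lra). lra.
Qed.

(** * Uniqueness of ordered coexistence states *)

Lemma flux_derive (d al C x f1 f2 z1 z2 : R) (y1 y2 y1' y2' : R -> R) : d <> 0 -> y1 x <> 0 -> y2 x <> 0 ->
  is_derive y1 x (y1' x) -> is_derive y2 x (y2' x) -> is_derive y1' x z1 -> is_derive y2' x z2 ->
  d * z1 - al * y1' x + f1 = 0 -> d * z2 - al * y2' x + f2 = 0 ->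
  is_derive (fun x => C * exp (- (al / d) * x) * d * (y2' x * y1 x - y2 x * y1' x) * (y2 x / y1 x + y1 x / y2 x - 2)) x
    (C * exp (- (al / d) * x) * ((y2 x * f1 - y1 x * f2) * (y2 x / y1 x + y1 x / y2 x - 2)
        + d * (y2' x * y1 x - y2 x * y1' x) ^ 2 * (/ y1 x ^ 2 - / y2 x ^ 2))).
Proof.
  intros Hd N1 N2 D1 D2 D3 D4 E1 E2. auto_derive.
  - repeat split; auto; eexists; eauto.
  - replace (Derive (fun x0 => y1 x0) x) with (y1' x) by (symmetry; apply is_derive_unique; auto).
    replace (Derive (fun x0 => y2 x0) x) with (y2' x) by (symmetry; apply is_derive_unique; auto).
    replace (Derive (fun x0 => y1' x0) x) with z1 by (symmetry; apply is_derive_unique; auto).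
    replace (Derive (fun x0 => y2' x0) x) with z2 by (symmetry; apply is_derive_unique; auto).
    replace f1 with (al * y1' x - d * z1) by lra. replace f2 with (al * y2' x - d * z2) by lra.
    field. auto.
Qed.

Lemma ratio_derive (x : R) (y1 y2 y1' y2' : R -> R) : y1 x <> 0 -> y2 x <> 0 ->
  is_derive y1 x (y1' x) -> is_derive y2 x (y2' x) ->
  is_derive (fun x => y2 x / y1 x + y1 x / y2 x - 2) x
    ((y2' x * y1 x - y2 x * y1' x) * (/ y1 x ^ 2 - / y2 x ^ 2)).
Proof.
  intros N1 N2 D1 D2. auto_derive.
  - repeat split; auto; eexists; eauto.
  - replace (Derive (fun x0 => y1 x0) x) with (y1' x) by (symmetry; apply is_derive_unique; auto).
    replace (Derive (fun x0 => y2 x0) x) with (y2' x) by (symmetry; apply is_derive_unique; auto).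
    field. auto.
Qed.

Lemma flux_cont (a b d al C : R) (y1 y2 y1' y2' : R -> R) :
  cont_on a b y1 -> cont_on a b y2 -> cont_on a b y1' -> cont_on a b y2' ->
  (forall x, a <= x <= b -> 0 < y1 x) -> (forall x, a <= x <= b -> 0 < y2 x) ->
  cont_on a b (fun x => C * exp (- (al / d) * x) * d * (y2' x * y1 x - y2 x * y1' x) * (y2 x / y1 x + y1 x / y2 x - 2)).
Proof.
  intros C1 C2 C3 C4 P1 P2.
  apply (cont_on_mult a b (fun x => C * exp (- (al / d) * x) * d * (y2' x * y1 x - y2 x * y1' x))).
  - apply (cont_on_mult a b (fun x => C * exp (- (al / d) * x) * d)).
    + apply continuous_cont_on. intros x _.
      apply (ex_derive_continuous (fun x => C * exp (- (al / d) * x) * d)). auto_derive; auto.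
    + apply cont_on_minus; apply cont_on_mult; auto.
  - apply cont_on_minus; [|apply cont_on_const].
    apply cont_on_plus; apply cont_on_div; auto; intros x Hx.
    + specialize (P1 x Hx). lra.
    + specialize (P2 x Hx). lra.
Qed.

Lemma derive_zero_on (a b x l : R) (f : R -> R) : a < x < b ->
  (forall y, a < y < b -> f y = 0) -> is_derive f x l -> l = 0.
Proof.
  intros Hx H0 Hd. assert (H1 : is_derive (fun _ : R => 0) x l) by (apply (is_derive_local f _ a b); auto).
  apply is_derive_unique in H1. rewrite Derive_const in H1. auto.
Qed.

Lemma const_on (a b : R) (f : R -> R) : cont_on a b f ->
  (forall x, a < x < b -> is_derive f x 0) -> forall x y, a <= x <= b -> a <= y <= b -> f x = f y.
Proof.
  intros Hc Hd. assert (H : forall x y, a <= x -> x <= y -> y <= b -> f x = f y).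
  { intros x y Hx Hxy Hy. apply Rle_antisym.
    - apply (nondecr_on a b f); auto. intros s Hs. exists 0. split; auto; lra.
    - assert (- f x <= - f y); [|lra]. apply (nondecr_on a b (fun s => - f s)); auto.
      + apply cont_on_opp; auto.
      + intros s Hs. exists (- 0). split; [apply (is_derive_opp f); auto|lra]. }
  intros x y Hx Hy. destruct (Rle_dec x y); [apply H|symmetry; apply H]; lra.
Qed.

Lemma zero_on_closure (a b : R) (f : R -> R) : a < b -> cont_on a b f ->
  (forall x, a < x < b -> f x = 0) -> forall x, a <= x <= b -> f x = 0.
Proof.
  intros Hab Hc H0 x Hx. rewrite (const_on a b f Hc) with (y := (a + b) / 2); try lra.
  - apply H0. lra.
  - intros y Hy. apply (is_derive_local (fun _ => 0) f a b); auto.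
    + intros s Hs. symmetry; auto.
    + apply (is_derive_const 0).
Qed.

Lemma ratio_excess (y1 y2 : R) : 0 < y1 -> 0 < y2 ->
  y2 / y1 + y1 / y2 - 2 = (y2 - y1) ^ 2 / (y1 * y2).
Proof. intros. field. lra. Qed.

Lemma inv_sq_le (y1 y2 : R) : 0 < y1 -> y1 <= y2 -> 0 <= / y1 ^ 2 - / y2 ^ 2.
Proof.
  intros H1 H2. assert (/ y2 ^ 2 <= / y1 ^ 2); [|lra]. apply Rinv_le_contravar; nra.
Qed.

(* With xi = s U and eta = t W the form is (xi - eta)^2 (xi + eta) plus two nonnegative terms. *)
Lemma cubic_form (m p s t U W : R) : 0 < s -> 0 < t -> 0 <= U -> 0 <= W -> m * s <= t -> p * t <= s ->
  0 <= s ^ 3 * (U ^ 3 - m * U ^ 2 * W) + t ^ 3 * (W ^ 3 - p * U * W ^ 2) /\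
  (m * s < t -> s ^ 3 * (U ^ 3 - m * U ^ 2 * W) + t ^ 3 * (W ^ 3 - p * U * W ^ 2) = 0 -> U = 0 /\ W = 0).
Proof.
  intros Hs Ht HU HW H1 H2.
  set (xi := s * U). set (eta := t * W).
  assert (Hxi : 0 <= xi) by (apply Rmult_le_pos; lra). assert (Heta : 0 <= eta) by (apply Rmult_le_pos; lra).
  assert (E : s ^ 3 * (U ^ 3 - m * U ^ 2 * W) + t ^ 3 * (W ^ 3 - p * U * W ^ 2)
     = (xi - eta) ^ 2 * (xi + eta) + (t - m * s) * (xi ^ 2 * W) + (s - p * t) * (U * eta ^ 2)).
  { unfold xi, eta. ring. }
  assert (T1 : 0 <= (xi - eta) ^ 2 * (xi + eta)) by (apply Rmult_le_pos; [apply pow2_ge_0|lra]).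
  assert (Q2 : 0 <= xi ^ 2 * W) by (apply Rmult_le_pos; [apply pow2_ge_0|lra]).
  assert (Q3 : 0 <= U * eta ^ 2) by (apply Rmult_le_pos; [lra|apply pow2_ge_0]).
  assert (T2 : 0 <= (t - m * s) * (xi ^ 2 * W)) by (apply Rmult_le_pos; lra).
  assert (T3 : 0 <= (s - p * t) * (U * eta ^ 2)) by (apply Rmult_le_pos; lra).
  rewrite E. split; [lra|]. intros Hlt H0.
  assert (Z1 : (xi - eta) ^ 2 * (xi + eta) = 0) by lra.
  assert (Z2 : (t - m * s) * (xi ^ 2 * W) = 0) by lra.
  assert (Z2' : xi ^ 2 * W = 0) by (apply Rmult_integral in Z2; destruct Z2; lra).
  assert (HUW : xi = 0 /\ eta = 0).
  { apply Rmult_integral in Z2'. destruct Z2' as [Z|Z].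
    - assert (X : xi = 0) by nra. rewrite X in Z1. split; auto. assert (eta ^ 3 = 0) by nra. 
      destruct (Rle_lt_or_eq_dec 0 eta Heta) as [Hp|]; auto. pose proof (pow_lt eta 3 Hp). lra.
    - assert (X : eta = 0) by (unfold eta; rewrite Z; ring). rewrite X in Z1. split; auto. assert (xi ^ 3 = 0) by nra. 
      destruct (Rle_lt_or_eq_dec 0 xi Hxi) as [Hp|]; auto. pose proof (pow_lt xi 3 Hp). lra. }
  destruct HUW as [A B]. unfold xi in A. unfold eta in B.
  apply Rmult_integral in A. apply Rmult_integral in B. split; [destruct A|destruct B]; lra.
Qed.

Lemma exp_le (x y : R) : x <= y -> exp x <= exp y.
Proof. intros [H| ->]; [left; apply exp_increasing; auto|lra]. Qed.

(* The flux of each ratio, multiplied by an increasing function of the ratio, vanishes at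
   the ends; under the smallness of m p the sum of the two is monotone, hence constant. *)
Lemma ordered_coexistence_unique (d1 d2 r m p q h L a1 a2 x1 : R) (u1 w1 u2 w2 : R -> R) :
  0 < d1 -> 0 < d2 -> 0 < m -> 0 < p -> 0 < h -> 0 <= x1 < L ->
  coexistence_ss d1 d2 r m p q h L a1 a2 x1 u1 w1 ->
  coexistence_ss d1 d2 r m p q h L a1 a2 x1 u2 w2 ->
  (forall x, 0 <= x <= L -> u1 x <= u2 x) -> (forall x, x1 <= x <= L -> w2 x <= w1 x) ->
  (forall x, x1 <= x <= L -> w1 x * w2 x <= h) ->
  m * p <= exp (- Rabs (a1 / d1 - a2 / d2) * L) ->
  (0 < x1 \/ m * p < exp (- Rabs (a1 / d1 - a2 / d2) * L)) ->
  (forall x, 0 <= x <= L -> u1 x = u2 x) /\ (forall x, x1 <= x <= L -> w1 x = w2 x).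
Proof.
  intros Hd1 Hd2 Hm Hp Hh Hx1 S1 S2 Hu Hw Hww Hmp Hcase.
  destruct S1 as [u1' [w1' [A1 [A2 [A3 [A4 [A5 [A6 [A7 [A8 [A9 [A10 [A11 A12]]]]]]]]]]]]].
  destruct S2 as [u2' [w2' [B1 [B2 [B3 [B4 [B5 [B6 [B7 [B8 [B9 [B10 [B11 B12]]]]]]]]]]]]].
  set (al := a1 / d1) in *. set (be := a2 / d2) in *. set (G := Rabs (al - be)) in *.
  set (C1 := (p * exp (G * L / 3)) ^ 3).
  set (sa := fun x => p * exp (G * L / 3) * exp (- al * x / 3)).
  set (sb := fun x => exp (- be * x / 3)).
  assert (Hsa : forall x, 0 < sa x) by (intros; unfold sa; repeat apply Rmult_lt_0_compat; auto; apply exp_pos).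
  assert (Hsb : forall x, 0 < sb x) by (intros; apply exp_pos).
  assert (Hexp3 : forall y, exp y = exp (y / 3) ^ 3).
  { intros y. simpl. rewrite Rmult_1_r, <- !exp_plus. f_equal. field. }
  assert (Hsa3 : forall x, C1 * exp (- al * x) = sa x ^ 3).
  { intros x. unfold C1, sa. rewrite (Hexp3 (- al * x)). ring. }
  assert (Hsb3 : forall x, 1 * exp (- be * x) = sb x ^ 3).
  { intros x. unfold sb. rewrite (Hexp3 (- be * x)). ring. }
  assert (HG : 0 <= G) by apply Rabs_pos.
  assert (Hgx : forall x, 0 <= x <= L -> - (G * L) <= (al - be) * x <= G * L).
  { intros x Hx. pose proof (Rle_abs (al - be)) as Q1. pose proof (Rle_abs (- (al - be))) as Q2.
    rewrite Rabs_Ropp in Q2. fold G in Q1, Q2. split; nra. }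
  assert (Hps : forall x, 0 <= x <= L -> p * sb x <= sa x).
  { intros x Hx. unfold sa, sb. rewrite Rmult_assoc, <- exp_plus. apply Rmult_le_compat_l; [lra|].
    apply exp_le. specialize (Hgx x Hx). lra. }
  assert (Hgl : 0 <= G * L) by (apply Rmult_le_pos; lra).
  assert (Hmse : forall x, 0 <= x <= L -> exp (- G * L) * (exp (G * L / 3) * exp (- al * x / 3)) <= sb x).
  { intros x Hx. unfold sb. rewrite <- !exp_plus. apply exp_le. specialize (Hgx x Hx). lra. }
  assert (Hee : forall x, 0 < exp (G * L / 3) * exp (- al * x / 3)) by (intros; apply Rmult_lt_0_compat; apply exp_pos).
  assert (Hms : forall x, 0 <= x <= L -> m * sa x <= sb x).
  { intros x Hx. apply Rle_trans with (2 := Hmse x Hx). unfold sa.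
    replace (m * (p * exp (G * L / 3) * exp (- al * x / 3))) with (m * p * (exp (G * L / 3) * exp (- al * x / 3))) by ring.
    apply Rmult_le_compat_r; [left; apply Hee|auto]. }
  assert (Hms' : m * p < exp (- G * L) -> forall x, 0 <= x <= L -> m * sa x < sb x).
  { intros Hst x Hx. apply Rlt_le_trans with (2 := Hmse x Hx). unfold sa.
    replace (m * (p * exp (G * L / 3) * exp (- al * x / 3))) with (m * p * (exp (G * L / 3) * exp (- al * x / 3))) by ring.
    apply Rmult_lt_compat_r; auto. }
  set (P1 := fun x => C1 * exp (- (a1 / d1) * x) * d1 * (u2' x * u1 x - u2 x * u1' x) * (u2 x / u1 x + u1 x / u2 x - 2)).
  set (P2 := fun x => 1 * exp (- (a2 / d2) * x) * d2 * (w1' x * w2 x - w1 x * w2' x) * (w1 x / w2 x + w2 x / w1 x - 2)).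
  set (U := fun x => u2 x - u1 x). set (W := fun x => w1 x - w2 x).
  set (R1 := fun x => sa x ^ 3 * (d1 * (u2' x * u1 x - u2 x * u1' x) ^ 2 * (/ u1 x ^ 2 - / u2 x ^ 2))).
  set (R2 := fun x => sb x ^ 3 * (d2 * (w1' x * w2 x - w1 x * w2' x) ^ 2 * (/ w2 x ^ 2 - / w1 x ^ 2))).
  assert (HR1 : forall x, 0 <= x <= L -> 0 <= R1 x).
  { intros x Hx. unfold R1. apply Rmult_le_pos; [left; apply pow_lt; auto|]. apply Rmult_le_pos.
    - apply Rmult_le_pos; [lra|apply pow2_ge_0].
    - apply inv_sq_le; auto. }
  assert (HR2 : forall x, x1 <= x <= L -> 0 <= R2 x).
  { intros x Hx. unfold R2. apply Rmult_le_pos; [left; apply pow_lt; auto|]. apply Rmult_le_pos.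
    - apply Rmult_le_pos; [lra|apply pow2_ge_0].
    - apply inv_sq_le; auto. }
  assert (HU : forall x, 0 <= x <= L -> 0 <= U x) by (intros x Hx; unfold U; specialize (Hu x Hx); lra).
  assert (HW : forall x, x1 <= x <= L -> 0 <= W x) by (intros x Hx; unfold W; specialize (Hw x Hx); lra).
  assert (DP1 : forall x, 0 < x < L -> x <> x1 ->
     is_derive P1 x (sa x ^ 3 * (U x ^ 3 - m * chi x1 x * U x ^ 2 * W x) + R1 x)).
  { intros x Hx Hne. destruct (A9 x Hx Hne) as [z1 [Z1 E1]]. destruct (B9 x Hx Hne) as [z2 [Z2 E2]].
    pose proof (A11 x ltac:(lra)) as Q1. pose proof (B11 x ltac:(lra)) as Q2.
    pose proof (flux_derive d1 a1 C1 x _ _ z1 z2 u1 u2 u1' u2' ltac:(lra) ltac:(lra) ltac:(lra)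
      (deriv_on_is_derive 0 L _ _ x A1 Hx) (deriv_on_is_derive 0 L _ _ x B1 Hx) Z1 Z2 E1 E2) as D.
    fold P1 in D. eapply eq_ind; [exact D|]. fold al. rewrite Hsa3. unfold R1, U, W.
    match goal with |- ?k = ?l => change (@eq R k l) end.
    rewrite (ratio_excess (u1 x) (u2 x)) by auto. field. lra. }
  assert (DP2 : forall x, x1 < x < L ->
     is_derive P2 x (sb x ^ 3 * (h / (w1 x * w2 x) * W x ^ 3 - p * U x * W x ^ 2) + R2 x)).
  { intros x Hx. destruct (A10 x Hx) as [z1 [Z1 E1]]. destruct (B10 x Hx) as [z2 [Z2 E2]].
    pose proof (A12 x ltac:(lra)) as Q1. pose proof (B12 x ltac:(lra)) as Q2.
    pose proof (flux_derive d2 a2 1 x (h - q * w2 x - p * u2 x * w2 x) (h - q * w1 x - p * u1 x * w1 x)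
      z2 z1 w2 w1 w2' w1' ltac:(lra) ltac:(lra) ltac:(lra)
      (deriv_on_is_derive x1 L _ _ x B3 Hx) (deriv_on_is_derive x1 L _ _ x A3 Hx) Z2 Z1 ltac:(lra) ltac:(lra)) as D.
    fold P2 in D. eapply eq_ind; [exact D|]. fold be. rewrite Hsb3. unfold R2, U, W.
    match goal with |- ?k = ?l => change (@eq R k l) end.
    rewrite (ratio_excess (w2 x) (w1 x)) by auto. field. lra. }
  assert (CP1 : cont_on 0 L P1).
  { apply flux_cont; auto; eapply deriv_on_cont_on; eauto. }
  assert (CP2 : cont_on x1 L P2).
  { apply flux_cont; auto; eapply deriv_on_cont_on; eauto. }
  assert (V1 : P1 0 = 0).
  { unfold P1. replace (C1 * exp (- (a1 / d1) * 0) * d1 * (u2' 0 * u1 0 - u2 0 * u1' 0) * (u2 0 / u1 0 + u1 0 / u2 0 - 2))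
      with (C1 * exp (- (a1 / d1) * 0) * ((d1 * u2' 0) * u1 0 - u2 0 * (d1 * u1' 0)) * (u2 0 / u1 0 + u1 0 / u2 0 - 2)) by ring.
    replace (d1 * u2' 0) with (a1 * u2 0) by lra. replace (d1 * u1' 0) with (a1 * u1 0) by lra. ring. }
  assert (V2 : P2 x1 = 0).
  { unfold P2. replace (1 * exp (- (a2 / d2) * x1) * d2 * (w1' x1 * w2 x1 - w1 x1 * w2' x1) * (w1 x1 / w2 x1 + w2 x1 / w1 x1 - 2))
      with (exp (- (a2 / d2) * x1) * ((d2 * w1' x1) * w2 x1 - w1 x1 * (d2 * w2' x1)) * (w1 x1 / w2 x1 + w2 x1 / w1 x1 - 2)) by ring.
    replace (d2 * w1' x1) with (a2 * w1 x1) by lra. replace (d2 * w2' x1) with (a2 * w2 x1) by lra. ring. }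
  assert (V3 : P1 L + P2 L = 0).
  { unfold P1, P2. rewrite A6, B6, A8, B8. ring. }
  assert (Hleft : forall x, 0 < x < x1 -> chi x1 x = 0).
  { intros x Hx. unfold chi. destruct (Rle_dec x x1); lra. }
  assert (Hright : forall x, x1 < x -> chi x1 x = 1).
  { intros x Hx. unfold chi. destruct (Rle_dec x x1); lra. }
  assert (HU3 : forall x, 0 <= x <= L -> 0 <= sa x ^ 3 * U x ^ 3).
  { intros x Hx. apply Rmult_le_pos; [left; apply pow_lt; auto|apply pow_le; auto]. }
  assert (M1 : forall x y, 0 <= x -> x <= y -> y <= x1 -> P1 x <= P1 y).
  { apply nondecr_on; [apply (cont_on_sub 0 L); auto; lra|]. intros x Hx.
    eexists; split; [apply DP1; lra|]. rewrite Hleft by auto.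
    pose proof (HR1 x ltac:(lra)). pose proof (HU3 x ltac:(lra)).
    replace (sa x ^ 3 * (U x ^ 3 - m * 0 * U x ^ 2 * W x)) with (sa x ^ 3 * U x ^ 3) by ring. lra. }
  assert (Hge : forall x, x1 < x < L -> sb x ^ 3 * (W x ^ 3 - p * U x * W x ^ 2) <= sb x ^ 3 * (h / (w1 x * w2 x) * W x ^ 3 - p * U x * W x ^ 2)).
  { intros x Hx. apply Rmult_le_compat_l; [left; apply pow_lt; auto|].
    pose proof (A12 x ltac:(lra)) as Q1. pose proof (B12 x ltac:(lra)) as Q2.
    assert (Hpw : 0 < w1 x * w2 x) by (apply Rmult_lt_0_compat; auto).
    assert (1 <= h / (w1 x * w2 x)).
    { apply Rmult_le_reg_r with (w1 x * w2 x); auto. replace (h / (w1 x * w2 x) * (w1 x * w2 x)) with h by (field; lra).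
      rewrite Rmult_1_l. apply Hww. lra. }
    pose proof (pow_le (W x) 3 (HW x ltac:(lra))). nra. }
  assert (Hcub : forall x, x1 < x < L -> 0 <= sa x ^ 3 * (U x ^ 3 - m * U x ^ 2 * W x) + sb x ^ 3 * (W x ^ 3 - p * U x * W x ^ 2)).
  { intros x Hx. apply cubic_form; auto; try (apply Hms || apply Hps || apply HU || apply HW); lra. }
  assert (M2 : forall x y, x1 <= x -> x <= y -> y <= L -> P1 x + P2 x <= P1 y + P2 y).
  { apply (nondecr_on x1 L (fun x => P1 x + P2 x)).
    - apply cont_on_plus; auto. apply (cont_on_sub 0 L); auto; lra.
    - intros x Hx. eexists; split; [apply (is_derive_plus P1 P2); [apply DP1|apply DP2]; lra|].
      unfold plus; simpl. rewrite (Hright x) by lra. specialize (Hge x Hx). specialize (Hcub x Hx).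
      pose proof (HR1 x ltac:(lra)). pose proof (HR2 x ltac:(lra)). rewrite Rmult_1_r. lra. }
  assert (Hx1P : P1 x1 = 0).
  { pose proof (M1 0 x1 ltac:(lra) ltac:(lra) ltac:(lra)). pose proof (M2 x1 L ltac:(lra) ltac:(lra) ltac:(lra)). lra. }
  assert (Z1 : forall x, 0 < x < x1 -> P1 x = 0).
  { intros x Hx. pose proof (M1 0 x ltac:(lra) ltac:(lra) ltac:(lra)). pose proof (M1 x x1 ltac:(lra) ltac:(lra) ltac:(lra)). lra. }
  assert (Z2 : forall x, x1 < x < L -> P1 x + P2 x = 0).
  { intros x Hx. pose proof (M2 x1 x ltac:(lra) ltac:(lra) ltac:(lra)). pose proof (M2 x L ltac:(lra) ltac:(lra) ltac:(lra)). lra. }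
  assert (UL : forall x, 0 < x < x1 -> U x = 0).
  { intros x Hx. pose proof (derive_zero_on 0 x1 x _ P1 Hx Z1 (DP1 x ltac:(lra) ltac:(lra))) as E.
    rewrite Hleft in E by auto. pose proof (HR1 x ltac:(lra)). pose proof (HU3 x ltac:(lra)).
    replace (sa x ^ 3 * (U x ^ 3 - m * 0 * U x ^ 2 * W x)) with (sa x ^ 3 * U x ^ 3) in E by ring.
    destruct (Rle_lt_or_eq_dec 0 (U x) (HU x ltac:(lra))) as [Hlt|]; auto.
    pose proof (Rmult_lt_0_compat _ _ (pow_lt _ 3 (Hsa x)) (pow_lt _ 3 Hlt)). lra. }
  assert (E2 : forall x, x1 < x < L ->
     sa x ^ 3 * (U x ^ 3 - m * U x ^ 2 * W x) + sb x ^ 3 * (h / (w1 x * w2 x) * W x ^ 3 - p * U x * W x ^ 2) = 0 /\ R1 x = 0 /\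
     sa x ^ 3 * (U x ^ 3 - m * U x ^ 2 * W x) + sb x ^ 3 * (W x ^ 3 - p * U x * W x ^ 2) = 0).
  { intros x Hx.
    pose proof (derive_zero_on x1 L x _ (fun x => P1 x + P2 x) Hx Z2
      (is_derive_plus P1 P2 x _ _ (DP1 x ltac:(lra) ltac:(lra)) (DP2 x Hx))) as E.
    unfold plus in E; simpl in E. rewrite (Hright x) in E by lra. rewrite Rmult_1_r in E.
    pose proof (HR1 x ltac:(lra)). pose proof (HR2 x ltac:(lra)). specialize (Hge x Hx). specialize (Hcub x Hx). lra. }
  assert (CU : cont_on 0 L U) by (apply cont_on_minus; eapply deriv_on_cont_on; eauto).
  assert (CW : cont_on x1 L W) by (apply cont_on_minus; eapply deriv_on_cont_on; eauto).
  assert (UL' : 0 < x1 -> forall x, 0 <= x <= x1 -> U x = 0).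
  { intros Hpos. apply zero_on_closure; auto. apply (cont_on_sub 0 L); auto; lra. }
  assert (UR : forall x, x1 <= x <= L -> U x = 0).
  { destruct Hcase as [Hpos|Hst].
    - intros x Hx. pose proof (UL' Hpos x1 ltac:(lra)) as H0.
      assert (Hrat : u2 x / u1 x + u1 x / u2 x - 2 = u2 x1 / u1 x1 + u1 x1 / u2 x1 - 2).
      { apply (const_on x1 L (fun x => u2 x / u1 x + u1 x / u2 x - 2)); try lra.
        - apply cont_on_minus; [|apply cont_on_const].
          apply cont_on_plus; apply cont_on_div; try (apply (cont_on_sub 0 L); [lra|lra|eapply deriv_on_cont_on; eauto]); intros y Hy.
          + specialize (A11 y ltac:(lra)). lra.
          + specialize (B11 y ltac:(lra)). lra.
        - intros y Hy. destruct (E2 y Hy) as [_ [E _]]. unfold R1 in E.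
          pose proof (A11 y ltac:(lra)) as Q1. pose proof (B11 y ltac:(lra)) as Q2.
          pose proof (ratio_derive y u1 u2 u1' u2' ltac:(lra) ltac:(lra)
            (deriv_on_is_derive 0 L _ _ y A1 ltac:(lra)) (deriv_on_is_derive 0 L _ _ y B1 ltac:(lra))) as D.
          eapply eq_ind; [exact D|]. match goal with |- ?k = ?l => change (@eq R k l) end.
          pose proof (pow_lt _ 3 (Hsa y)).
          apply Rmult_integral in E. destruct E as [E|E]; [lra|].
          apply Rmult_integral in E. destruct E as [E|E]; [|rewrite E; ring].
          apply Rmult_integral in E. destruct E as [E|E]; [lra|].
          assert (E' : u2' y * u1 y - u2 y * u1' y = 0) by nra. rewrite E'. ring. }
      pose proof (A11 x ltac:(lra)) as Q1. pose proof (B11 x ltac:(lra)) as Q2.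
      pose proof (A11 x1 ltac:(lra)) as Q3. pose proof (B11 x1 ltac:(lra)) as Q4.
      rewrite !ratio_excess in Hrat by auto. fold (U x) in Hrat. fold (U x1) in Hrat. rewrite H0 in Hrat.
      assert (Hz : U x ^ 2 / (u1 x * u2 x) = 0) by (rewrite Hrat; unfold Rdiv; ring).
      assert (0 < u1 x * u2 x) by (apply Rmult_lt_0_compat; auto).
      apply Rmult_integral in Hz. destruct Hz as [Hz|Hz]; [nra|].
      assert (0 < / (u1 x * u2 x)) by (apply Rinv_0_lt_compat; auto). lra.
    - apply zero_on_closure; [lra|apply (cont_on_sub 0 L); auto; lra|].
      intros x Hx. destruct (E2 x Hx) as [_ [_ E]].
      apply (cubic_form m p (sa x) (sb x) (U x) (W x)); auto; try (apply Hms' || apply Hms || apply Hps || apply HU || apply HW); auto; lra. }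
  assert (WR : forall x, x1 <= x <= L -> W x = 0).
  { apply zero_on_closure; auto; [lra|]. intros x Hx. destruct (E2 x Hx) as [_ [_ E]].
    rewrite (UR x ltac:(lra)) in E. destruct (Rle_lt_or_eq_dec 0 (W x) (HW x ltac:(lra))) as [Hlt|]; auto.
    pose proof (Rmult_lt_0_compat _ _ (pow_lt _ 3 (Hsb x)) (pow_lt _ 3 Hlt)). lra. }
  split.
  - intros x Hx. assert (U x = 0); [|unfold U in *; lra].
    destruct (Rle_dec x1 x); [apply UR; lra|]. apply UL'; lra.
  - intros x Hx. specialize (WR x Hx). unfold W in WR. lra.
Qed.

(** * The monotone iteration *)

Lemma chi_left (x1 x : R) : x <= x1 -> chi x1 x = 0.
Proof. intros H. unfold chi. destruct (Rle_dec x x1); lra. Qed.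

Lemma chi_right (x1 x : R) : x1 < x -> chi x1 x = 1.
Proof. intros H. unfold chi. destruct (Rle_dec x x1); lra. Qed.

(* w' satisfies a linear equation without source term, so it has no negative interior minimum. *)
Lemma tilde_w_le_end (d2 a2 h q x1 L : R) (wt : R -> R) : 0 < d2 -> 0 <= a2 -> 0 < q -> x1 < L ->
  tilde_w d2 a2 h q x1 L wt -> forall x, x1 <= x <= L -> wt x <= wt L.
Proof.
  intros Hd Ha Hq HL [w' [H1 [H2 [H3 [H4 [H5 H6]]]]]].
  assert (Hpos : forall x, x1 <= x <= L -> 0 <= w' x).
  { destruct (cont_on_min x1 L w' ltac:(lra) H2) as [x0 [Hx0 Hmin]].
    assert (H0 : 0 <= w' x0).
    { apply Rnot_lt_le. intros Hneg.
      assert (x0 <> x1).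
      { intros ->. specialize (H3 x1 ltac:(lra)). assert (0 <= a2 * wt x1) by (apply Rmult_le_pos; lra). nra. }
      assert (x0 <> L) by (intros ->; lra).
      assert (Hi : x1 < x0 < L) by lra.
      set (w2 := fun x => (a2 * w' x - h + q * wt x) / d2).
      assert (D : forall x, x1 < x < L -> is_derive w' x (w2 x)).
      { intros x Hx. destruct (H6 x Hx) as [w'' [A B]]. 
        assert (Ew : w2 x = w'').
        { unfold w2. replace (a2 * w' x - h + q * wt x) with (d2 * w'') by lra. field. lra. }
        rewrite Ew. auto. }
      destruct (second_derivative_test (fun x => - w' x) (fun x => - w2 x) x0 (Rmin (x0 - x1) (L - x0))
        (- ((a2 * w2 x0 + q * w' x0) / d2))) as [Q1 Q2].
      - apply Rmin_pos; lra.
      - intros y Hy. apply (is_derive_opp w'). apply D.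
        apply Rmin_Rgt in Hy. destruct Hy as [Y1 Y2]. apply Rgt_lt, Rabs_lt_iff in Y1. apply Rgt_lt, Rabs_lt_iff in Y2. lra.
      - intros y Hy. apply Ropp_le_contravar. apply Hmin.
        apply Rmin_Rgt in Hy. destruct Hy as [Y1 Y2]. apply Rgt_lt, Rabs_lt_iff in Y1. apply Rgt_lt, Rabs_lt_iff in Y2. lra.
      - apply (is_derive_opp w2). unfold w2.
        pose proof (D x0 Hi) as D1. pose proof (deriv_on_is_derive x1 L _ _ x0 H1 Hi) as D2.
        auto_derive.
        + repeat split; auto; eexists; eauto.
        + replace (Derive (fun x => w' x) x0) with (w2 x0) by (symmetry; apply is_derive_unique; auto).
          replace (Derive (fun x => wt x) x0) with (w' x0) by (symmetry; apply is_derive_unique; auto).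
          unfold w2. field. lra.
      - replace (w2 x0) with 0 in Q2 by lra.
        assert (Hq2 : 0 < - (q * w' x0) / d2) by (apply Rdiv_lt_0_compat; nra).
        replace (- ((a2 * 0 + q * w' x0) / d2)) with (- (q * w' x0) / d2) in Q2 by (field; lra). lra. }
    intros x Hx. specialize (Hmin x Hx). lra. }
  intros x Hx. apply (nondecr_on x1 L wt); try lra.
  - eapply deriv_on_cont_on; eauto.
  - intros y Hy. exists (w' y). split; [apply (deriv_on_is_derive x1 L); auto|apply Hpos; lra].
Qed.

Section Scheme.

Context (d1 d2 r m p q h L a1 a2 x1 M Wm kap1 kap2 : R).
Context (Hd1 : 0 < d1) (Hd2 : 0 < d2) (Hr : 0 < r) (Hm : 0 < m) (Hp : 0 < p)
  (Hq : 0 < q) (Hh : 0 < h) (Ha1 : 0 <= a1) (Ha2 : 0 <= a2) (Hx1 : 0 <= x1 < L)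
  (HM : 0 < M) (HWm : 0 < Wm) (Hk1 : 0 < kap1) (Hk2 : 0 < kap2)
  (HK1 : 2 * M + m * Wm <= shift_K d1 a1 kap1) (HK2 : q + p * M <= shift_K d2 a2 kap2).

Definition reactU (c u w : R) : R := u * (r - u - m * c * w) + shift_K d1 a1 kap1 * u.
Definition reactW (u w : R) : R := h - q * w - p * u * w + shift_K d2 a2 kap2 * w.

Definition stepU (u w : R -> R) : R -> R :=
  bvp d1 a1 0 L kap1 x1 (fun y => reactU 0 (u y) 0) (fun y => reactU 1 (u y) (w y)).
Definition stepW (u w : R -> R) : R -> R :=
  bvp d2 a2 x1 L kap2 x1 (fun y => reactW (u y) (w y)) (fun y => reactW (u y) (w y)).

Definition step (P : (R -> R) * (R -> R)) : (R -> R) * (R -> R) :=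
  (stepU (fst P) (snd P), stepW (fst P) (snd P)).

(* The competitive order, relaxed by eta. *)
Definition ordc (eta : R) (P Q : (R -> R) * (R -> R)) : Prop :=
  (forall x, 0 <= x <= L -> fst P x <= fst Q x + eta) /\
  (forall x, x1 <= x <= L -> snd Q x <= snd P x + eta).

Definition boxed (P : (R -> R) * (R -> R)) : Prop :=
  (forall x, 0 <= x <= L -> 0 <= fst P x <= M) /\ (forall x, x1 <= x <= L -> 0 <= snd P x <= Wm).

Definition inbox (P : (R -> R) * (R -> R)) : Prop :=
  (forall x, continuous (fst P) x) /\ (forall x, continuous (snd P) x) /\ boxed P.

Definition rateU : R := r + shift_K d1 a1 kap1 + m * M.
Definition rateW : R := shift_K d2 a2 kap2 + p * Wm.

Let HL0 : 0 < L := Rle_lt_trans _ _ _ (proj1 Hx1) (proj2 Hx1).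
Let K1p : 0 < shift_K d1 a1 kap1 := shift_K_pos d1 a1 kap1 Hd1 Ha1 Hk1.
Let K2p : 0 < shift_K d2 a2 kap2 := shift_K_pos d2 a2 kap2 Hd2 Ha2 Hk2.

Lemma reactU_compare (eta c a b a' b' : R) : 0 <= c <= 1 -> 0 <= eta -> 0 <= a <= M -> 0 <= a' <= M ->
  0 <= b <= Wm -> 0 <= b' <= Wm -> a <= a' + eta -> b' <= b + eta ->
  reactU c a b - reactU c a' b' <= rateU * eta.
Proof.
  intros Hc He A A' B B' H1 H2. unfold reactU, rateU. set (K := shift_K d1 a1 kap1) in *.
  replace (a * (r - a - m * c * b) + K * a - (a' * (r - a' - m * c * b') + K * a'))
    with ((a - a') * (r + K - a - a' - m * c * b) + a' * (m * c * (b' - b))) by ring.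
  assert (Hcb : 0 <= m * c * b <= m * Wm).
  { assert (0 <= c * b <= Wm) by nra. split; [rewrite Rmult_assoc; apply Rmult_le_pos; lra|].
    rewrite Rmult_assoc; apply Rmult_le_compat_l; lra. }
  assert (T1 : (a - a') * (r + K - a - a' - m * c * b) <= eta * (r + K)).
  { destruct (Rle_dec a a') as [Hle|Hgt]; [nra|].
    apply Rle_trans with ((a - a') * (r + K)); [apply Rmult_le_compat_l; lra|apply Rmult_le_compat_r; lra]. }
  assert (T2 : a' * (m * c * (b' - b)) <= m * M * eta).
  { assert (Hcb2 : c * (b' - b) <= eta) by nra.
    assert (m * c * (b' - b) <= m * eta) by (rewrite Rmult_assoc; apply Rmult_le_compat_l; lra).
    apply Rle_trans with (a' * (m * eta)); [apply Rmult_le_compat_l; lra|].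
    rewrite (Rmult_comm m M), Rmult_assoc. apply Rmult_le_compat_r; [apply Rmult_le_pos; lra|lra]. }
  lra.
Qed.

Lemma reactW_compare (eta a b a' b' : R) : 0 <= eta -> 0 <= a <= M -> 0 <= a' <= M ->
  0 <= b <= Wm -> 0 <= b' <= Wm -> a <= a' + eta -> b' <= b + eta ->
  reactW a' b' - reactW a b <= rateW * eta.
Proof.
  intros He A A' B B' H1 H2. unfold reactW, rateW. set (K := shift_K d2 a2 kap2) in *.
  replace (h - q * b' - p * a' * b' + K * b' - (h - q * b - p * a * b + K * b))
    with ((b' - b) * (K - q - p * a') + p * (b * (a - a'))) by ring.
  assert (Hpa : 0 <= p * a' <= p * M) by (split; [apply Rmult_le_pos|apply Rmult_le_compat_l]; lra).
  assert (T1 : (b' - b) * (K - q - p * a') <= eta * K).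
  { destruct (Rle_dec b' b) as [Hle|Hgt]; [nra|].
    apply Rle_trans with ((b' - b) * K); [apply Rmult_le_compat_l; lra|apply Rmult_le_compat_r; lra]. }
  assert (T2 : b * (a - a') <= Wm * eta) by nra.
  assert (p * (b * (a - a')) <= p * (Wm * eta)) by (apply Rmult_le_compat_l; lra). lra.
Qed.

Lemma glue_reactU (u w : R -> R) (x : R) :
  glue x1 (fun y => reactU 0 (u y) 0) (fun y => reactU 1 (u y) (w y)) x = reactU (chi x1 x) (u x) (w x).
Proof. unfold glue, chi, reactU. destruct (Rle_dec x x1); ring. Qed.

Lemma glue_reactW (u w : R -> R) (x : R) :
  glue x1 (fun y => reactW (u y) (w y)) (fun y => reactW (u y) (w y)) x = reactW (u x) (w x).
Proof. unfold glue. destruct (Rle_dec x x1); auto. Qed.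

Lemma continuous_reactU (c : R) (u w : R -> R) (x : R) : continuous u x -> continuous w x ->
  continuous (fun y => reactU c (u y) (w y)) x.
Proof.
  intros Hu Hw. unfold reactU.
  apply (continuous_plus (fun y => u y * (r - u y - m * c * w y)) (fun y => shift_K d1 a1 kap1 * u y)).
  - apply (continuous_mult u (fun y => r - u y - m * c * w y)); auto.
    apply (continuous_minus (fun y => r - u y) (fun y => m * c * w y)).
    + apply (continuous_minus (fun _ => r) u); auto. apply continuous_const.
    + apply (continuous_mult (fun _ => m * c) w); auto. apply continuous_const.
  - apply (continuous_mult (fun _ => shift_K d1 a1 kap1) u); auto. apply continuous_const.
Qed.

Lemma continuous_reactW (u w : R -> R) (x : R) : continuous u x -> continuous w x ->
  continuous (fun y => reactW (u y) (w y)) x.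
Proof.
  intros Hu Hw. unfold reactW.
  apply (continuous_plus (fun y => h - q * w y - p * u y * w y) (fun y => shift_K d2 a2 kap2 * w y)).
  - apply (continuous_minus (fun y => h - q * w y) (fun y => p * u y * w y)).
    + apply (continuous_minus (fun _ => h) (fun y => q * w y)); [apply continuous_const|].
      apply (continuous_mult (fun _ => q) w); auto. apply continuous_const.
    + apply (continuous_mult (fun y => p * u y) w); auto.
      apply (continuous_mult (fun _ => p) u); auto. apply continuous_const.
  - apply (continuous_mult (fun _ => shift_K d2 a2 kap2) w); auto. apply continuous_const.
Qed.

Lemma sourceU0_cont (u : R -> R) : (forall x, continuous u x) ->
  forall x : R, continuous (fun y : R => reactU 0 (u y) 0) x.
Proof. intros Hu x. exact (continuous_reactU 0 u (fun _ => 0) x (Hu x) (continuous_const 0 x)). Qed.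

Lemma sourceU1_cont (u w : R -> R) : (forall x, continuous u x) -> (forall x, continuous w x) ->
  forall x : R, continuous (fun y : R => reactU 1 (u y) (w y)) x.
Proof. intros Hu Hw x. exact (continuous_reactU 1 u w x (Hu x) (Hw x)). Qed.

Lemma sourceW_cont (u w : R -> R) : (forall x, continuous u x) -> (forall x, continuous w x) ->
  forall x : R, continuous (fun y : R => reactW (u y) (w y)) x.
Proof. intros Hu Hw x. exact (continuous_reactW u w x (Hu x) (Hw x)). Qed.

Lemma step_cont (P : (R -> R) * (R -> R)) :
  (forall x, continuous (fst P) x) -> (forall x, continuous (snd P) x) ->
  (forall x, continuous (fst (step P)) x) /\ (forall x, continuous (snd (step P)) x).
Proof.
  intros H1 H2. split.
  - exact (bvp_cont d1 a1 0 L kap1 x1 _ _ Hd1 Ha1 HL0 Hk1 (sourceU0_cont _ H1) (sourceU1_cont _ _ H1 H2)).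
  - exact (bvp_cont d2 a2 x1 L kap2 x1 _ _ Hd2 Ha2 (proj2 Hx1) Hk2 (sourceW_cont _ _ H1 H2) (sourceW_cont _ _ H1 H2)).
Qed.

Lemma reactU_pair (eta x : R) (P Q : (R -> R) * (R -> R)) : 0 <= eta -> boxed P -> boxed Q -> ordc eta P Q ->
  0 <= x <= L -> reactU (chi x1 x) (fst P x) (snd P x) - reactU (chi x1 x) (fst Q x) (snd Q x) <= rateU * eta.
Proof.
  intros He [P1 P2] [Q1 Q2] [O1 O2] Hx.
  destruct (Rle_dec x x1) as [Hle|Hgt].
  - rewrite chi_left by auto.
    replace (reactU 0 (fst P x) (snd P x)) with (reactU 0 (fst P x) 0) by (unfold reactU; ring).
    replace (reactU 0 (fst Q x) (snd Q x)) with (reactU 0 (fst Q x) 0) by (unfold reactU; ring).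
    apply reactU_compare; auto; lra.
  - rewrite chi_right by lra. apply reactU_compare; auto; try lra.
    + apply P2; lra.
    + apply Q2; lra.
    + apply O2; lra.
Qed.

Lemma reactW_pair (eta x : R) (P Q : (R -> R) * (R -> R)) : 0 <= eta -> boxed P -> boxed Q -> ordc eta P Q ->
  x1 <= x <= L -> reactW (fst Q x) (snd Q x) - reactW (fst P x) (snd P x) <= rateW * eta.
Proof.
  intros He [P1 P2] [Q1 Q2] [O1 O2] Hx.
  apply reactW_compare; auto; [apply P1|apply Q1|apply O1]; lra.
Qed.

Definition gain : R := rateU / shift_K d1 a1 kap1 + rateW / shift_K d2 a2 kap2.

Lemma gain_facts : 0 <= gain /\ rateU <= shift_K d1 a1 kap1 * gain /\ rateW <= shift_K d2 a2 kap2 * gain.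
Proof.
  assert (HU : 0 < rateU) by (unfold rateU; pose proof (Rmult_lt_0_compat m M Hm HM); lra).
  assert (HW : 0 < rateW) by (unfold rateW; pose proof (Rmult_lt_0_compat p Wm Hp HWm); lra).
  assert (0 < rateU / shift_K d1 a1 kap1) by (apply Rdiv_lt_0_compat; auto).
  assert (0 < rateW / shift_K d2 a2 kap2) by (apply Rdiv_lt_0_compat; auto).
  unfold gain. repeat split; try lra.
  - replace rateU with (shift_K d1 a1 kap1 * (rateU / shift_K d1 a1 kap1)) at 1 by (field; lra).
    apply Rmult_le_compat_l; lra.
  - replace rateW with (shift_K d2 a2 kap2 * (rateW / shift_K d2 a2 kap2)) at 1 by (field; lra).
    apply Rmult_le_compat_l; lra.
Qed.

Lemma step_compare (eta : R) (P Q : (R -> R) * (R -> R)) : 0 <= eta -> inbox P -> inbox Q -> ordc eta P Q ->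
  ordc (gain * eta) (step P) (step Q).
Proof.
  intros He HP HQ HO. destruct gain_facts as [G0 [GU GW]].
  assert (HPc : forall x, continuous (fst P) x) by apply HP. assert (HPd : forall x, continuous (snd P) x) by apply HP.
  assert (HQc : forall x, continuous (fst Q) x) by apply HQ. assert (HQd : forall x, continuous (snd Q) x) by apply HQ.
  assert (Hge : 0 <= gain * eta) by (apply Rmult_le_pos; auto).
  split; simpl.
  - apply (bvp_compare d1 a1 0 L kap1 x1 (gain * eta) _ _ _ _ Hd1 Ha1 HL0 Hk1 Hge
      (sourceU0_cont _ HPc) (sourceU1_cont _ _ HPc HPd) (sourceU0_cont _ HQc) (sourceU1_cont _ _ HQc HQd)).
    intros x Hx Hne. rewrite !glue_reactU. pose proof (reactU_pair eta x P Q He (proj2 (proj2 HP)) (proj2 (proj2 HQ)) HO ltac:(lra)).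
    apply Rle_trans with (rateU * eta); auto. rewrite <- Rmult_assoc. apply Rmult_le_compat_r; auto.
  - apply (bvp_compare d2 a2 x1 L kap2 x1 (gain * eta) _ _ _ _ Hd2 Ha2 (proj2 Hx1) Hk2 Hge
      (sourceW_cont _ _ HQc HQd) (sourceW_cont _ _ HQc HQd) (sourceW_cont _ _ HPc HPd) (sourceW_cont _ _ HPc HPd)).
    intros x Hx Hne. rewrite !glue_reactW. pose proof (reactW_pair eta x P Q He (proj2 (proj2 HP)) (proj2 (proj2 HQ)) HO ltac:(lra)).
    apply Rle_trans with (rateW * eta); auto. rewrite <- Rmult_assoc. apply Rmult_le_compat_r; auto.
Qed.

Lemma step_mono (P Q : (R -> R) * (R -> R)) : inbox P -> inbox Q -> ordc 0 P Q -> ordc 0 (step P) (step Q).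
Proof.
  intros HP HQ HO. pose proof (step_compare 0 P Q ltac:(lra) HP HQ HO) as H. rewrite Rmult_0_r in H. auto.
Qed.

Lemma ordc_trans (P Q S : (R -> R) * (R -> R)) : ordc 0 P Q -> ordc 0 Q S -> ordc 0 P S.
Proof.
  intros [A B] [C D]. split; intros x Hx.
  - specialize (A x Hx). specialize (C x Hx). lra.
  - specialize (B x Hx). specialize (D x Hx). lra.
Qed.

Lemma ordc_refl (P : (R -> R) * (R -> R)) : ordc 0 P P.
Proof. split; intros; lra. Qed.

Lemma inbox_between (X P Y : (R -> R) * (R -> R)) : inbox X -> inbox Y -> ordc 0 X P -> ordc 0 P Y ->
  (forall x, continuous (fst P) x) -> (forall x, continuous (snd P) x) -> inbox P.
Proof.
  intros [_ [_ [X1 X2]]] [_ [_ [Y1 Y2]]] [A B] [C D] H1 H2. repeat split; auto.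
  - specialize (X1 x H). specialize (A x H). lra.
  - specialize (Y1 x H). specialize (C x H). lra.
  - specialize (Y2 x H). specialize (D x H). lra.
  - specialize (X2 x H). specialize (B x H). lra.
Qed.

Definition iter (n : nat) (P : (R -> R) * (R -> R)) := Nat.iter n step P.

Lemma iter_props (X Y : (R -> R) * (R -> R)) : inbox X -> inbox Y -> ordc 0 X Y ->
  ordc 0 X (step X) -> ordc 0 (step Y) Y -> forall n,
  inbox (iter n X) /\ inbox (iter n Y) /\ ordc 0 X (iter n X) /\ ordc 0 (iter n X) (iter n Y) /\
  ordc 0 (iter n Y) Y /\ ordc 0 (iter n X) (iter (S n) X) /\ ordc 0 (iter (S n) Y) (iter n Y).
Proof.
  intros HX HY HXY HX1 HY1. induction n as [|n [IX [IY [I1 [I2 [I3 [I4 I5]]]]]]].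
  - split; [|split; [|split; [|split; [|split; [|split]]]]]; auto; apply ordc_refl.
  - assert (J2 : ordc 0 (iter (S n) X) (iter (S n) Y)) by (apply step_mono; auto).
    assert (J1 : ordc 0 X (iter (S n) X)) by (eapply ordc_trans; eauto).
    assert (J3 : ordc 0 (iter (S n) Y) Y) by (eapply ordc_trans; eauto).
    destruct (step_cont (iter n X) (proj1 IX) (proj1 (proj2 IX))) as [CX1 CX2].
    destruct (step_cont (iter n Y) (proj1 IY) (proj1 (proj2 IY))) as [CY1 CY2].
    assert (BX : inbox (iter (S n) X)).
    { apply (inbox_between X _ Y); auto. eapply ordc_trans; eauto. }
    assert (BY : inbox (iter (S n) Y)).
    { apply (inbox_between X _ Y); auto. eapply ordc_trans; eauto. }
    split; [|split; [|split; [|split; [|split; [|split]]]]]; auto; apply step_mono; auto.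
Qed.

Lemma step_lipschitz : exists Lam, 0 <= Lam /\ forall P, inbox P ->
  (forall x y, 0 <= x <= L -> 0 <= y <= L -> Rabs (fst (step P) x - fst (step P) y) <= Lam * Rabs (x - y)) /\
  (forall x y, x1 <= x <= L -> x1 <= y <= L -> Rabs (snd (step P) x - snd (step P) y) <= Lam * Rabs (x - y)).
Proof.
  set (B1 := M * (r + shift_K d1 a1 kap1 + M + m * Wm)). set (B2 := h + rateW * Wm + (q + p * M) * Wm).
  assert (mM : 0 < m * M) by (apply Rmult_lt_0_compat; auto). assert (mW : 0 < m * Wm) by (apply Rmult_lt_0_compat; auto).
  assert (pM : 0 < p * M) by (apply Rmult_lt_0_compat; auto). assert (pW : 0 < p * Wm) by (apply Rmult_lt_0_compat; auto).
  assert (HU : 0 < rateU) by (unfold rateU; lra).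
  assert (HW : 0 < rateW) by (unfold rateW; lra).
  assert (HB1 : 0 <= B1) by (unfold B1; apply Rmult_le_pos; lra). assert (HB2 : 0 <= B2) by (unfold B2; nra).
  destruct (bvp_lipschitz d1 a1 0 L kap1 x1 B1 Hd1 Ha1 ltac:(lra) Hk1 HB1) as [L1 [HL1 Lip1]].
  destruct (bvp_lipschitz d2 a2 x1 L kap2 x1 B2 Hd2 Ha2 ltac:(lra) Hk2 HB2) as [L2 [HL2 Lip2]].
  exists (L1 + L2). split; [lra|]. intros P [C1 [C2 [P1 P2]]]. split; intros x y Hx Hy.
  - apply Rle_trans with (L1 * Rabs (x - y)); [|apply Rmult_le_compat_r; [apply Rabs_pos|lra]].
    apply (Lip1 _ _ (sourceU0_cont _ C1) (sourceU1_cont _ _ C1 C2)); [|exact Hx|exact Hy].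
    intros s Hs Hne. rewrite glue_reactU. specialize (P1 s ltac:(lra)).
      assert (Hcw : 0 <= m * chi x1 s * snd P s <= m * Wm).
      { destruct (Rle_dec s x1); [rewrite chi_left by auto; lra|rewrite chi_right by lra].
        specialize (P2 s ltac:(lra)). rewrite Rmult_1_r. split; [apply Rmult_le_pos|apply Rmult_le_compat_l]; lra. }
      replace (reactU (chi x1 s) (fst P s) (snd P s))
        with (fst P s * (r + shift_K d1 a1 kap1 - fst P s - m * chi x1 s * snd P s)) by (unfold reactU; ring).
      rewrite Rabs_mult, (Rabs_right (fst P s)) by lra. unfold B1.
      apply Rmult_le_compat; try apply Rabs_pos; try lra. apply Rabs_le_iff. lra.
  - apply Rle_trans with (L2 * Rabs (x - y)); [|apply Rmult_le_compat_r; [apply Rabs_pos|lra]].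
    apply (Lip2 _ _ (sourceW_cont _ _ C1 C2) (sourceW_cont _ _ C1 C2)); [|exact Hx|exact Hy].
    intros s Hs Hne. rewrite glue_reactW. specialize (P1 s ltac:(lra)). specialize (P2 s ltac:(lra)).
      assert (Huw : 0 <= p * fst P s * snd P s <= p * M * Wm).
      { assert (0 <= p * fst P s <= p * M) by (split; [apply Rmult_le_pos|apply Rmult_le_compat_l]; lra).
        split; [apply Rmult_le_pos; lra|apply Rmult_le_compat; lra]. }
      unfold reactW, B2, rateW. apply Rabs_le_iff. split; nra.
Qed.

Definition steady_eqs (U W : R -> R) : Prop :=
  exists U' W' : R -> R,
    deriv_on 0 L U U' /\ cont_on 0 L U' /\
    deriv_on x1 L W W' /\ cont_on x1 L W' /\
    d1 * U' 0 - a1 * U 0 = 0 /\ U' L = 0 /\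
    d2 * W' x1 - a2 * W x1 = 0 /\ W' L = 0 /\
    (forall x, 0 < x < L -> x <> x1 -> exists U'', is_derive U' x U'' /\
        d1 * U'' - a1 * U' x + U x * (r - U x - m * chi x1 x * W x) = 0) /\
    (forall x, x1 < x < L -> exists W'', is_derive W' x W'' /\
        d2 * W'' - a2 * W' x + h - q * W x - p * U x * W x = 0).

Lemma deriv_on_ext (a b : R) (f g f' : R -> R) : (forall x, a <= x <= b -> f x = g x) ->
  deriv_on a b f f' -> deriv_on a b g f'.
Proof.
  intros E H. apply deriv_on_eps. intros x Hx eps He.
  destruct (proj1 (deriv_on_eps a b f f') H x Hx eps He) as [de [Hd D]].
  exists de; split; auto. intros y Hy Hyx. rewrite <- !E by auto. auto.
Qed.

Lemma fixed_point_steady (P : (R -> R) * (R -> R)) :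
  (forall x, continuous (fst P) x) -> (forall x, continuous (snd P) x) ->
  (forall x, 0 <= x <= L -> fst (step P) x = fst P x) ->
  (forall x, x1 <= x <= L -> snd (step P) x = snd P x) ->
  steady_eqs (fst P) (snd P).
Proof.
  intros C1 C2 E1 E2.
  destruct (bvp_spec d1 a1 0 L kap1 x1 _ _ Hd1 Ha1 HL0 Hk1 (sourceU0_cont _ C1) (sourceU1_cont _ _ C1 C2))
    as [U' [U1 [U2 [U3 [U4 U5]]]]].
  destruct (bvp_spec d2 a2 x1 L kap2 x1 _ _ Hd2 Ha2 (proj2 Hx1) Hk2 (sourceW_cont _ _ C1 C2) (sourceW_cont _ _ C1 C2))
    as [W' [W1 [W2 [W3 [W4 W5]]]]].
  exists U', W'. split; [|split; [|split; [|split; [|split; [|split; [|split; [|split; [|split]]]]]]]]; auto.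
  - apply (deriv_on_ext 0 L (fst (step P))); auto. apply is_derive_deriv_on; auto.
  - apply continuous_cont_on; auto.
  - apply (deriv_on_ext x1 L (snd (step P))); auto. apply is_derive_deriv_on; auto.
  - apply continuous_cont_on; auto.
  - rewrite <- E1 by lra. auto.
  - rewrite <- E2 by lra. auto.
  - intros x Hx Hne. destruct (U5 x Hne) as [z [A B]]. exists z. split; auto.
    rewrite glue_reactU in B.
    specialize (E1 x ltac:(lra)). simpl in E1. 
    assert (B' : d1 * z - a1 * U' x - shift_K d1 a1 kap1 * stepU (fst P) (snd P) x
       + reactU (chi x1 x) (fst P x) (snd P x) = 0) by exact B.
    rewrite E1 in B'. unfold reactU in B'. lra.
  - intros x Hx. destruct (W5 x ltac:(lra)) as [z [A B]]. exists z. split; auto.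
    rewrite glue_reactW in B.
    specialize (E2 x ltac:(lra)). simpl in E2. 
    assert (B' : d2 * z - a2 * W' x - shift_K d2 a2 kap2 * stepW (fst P) (snd P) x
       + reactW (fst P x) (snd P x) = 0) by exact B.
    rewrite E2 in B'. unfold reactW in B'. lra.
Qed.

Lemma iter_limit (P : (R -> R) * (R -> R)) : (forall n, inbox (iter n P)) ->
  (forall x, 0 <= x <= L -> ex_finite_lim_seq (fun n => fst (iter n P) x)) ->
  (forall x, x1 <= x <= L -> ex_finite_lim_seq (fun n => snd (iter n P) x)) ->
  exists U W : R -> R, steady_eqs U W /\
   (forall x, 0 <= x <= L -> is_lim_seq (fun n => fst (iter n P) x) (U x)) /\
   (forall x, x1 <= x <= L -> is_lim_seq (fun n => snd (iter n P) x) (W x)) /\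
   forall eps, 0 < eps -> exists n,
     (forall x, 0 <= x <= L -> Rabs (fst (iter n P) x - U x) <= eps) /\
     (forall x, x1 <= x <= L -> Rabs (snd (iter n P) x - W x) <= eps).
Proof.
  intros Hbox Hlu Hlw. destruct step_lipschitz as [Lam [HL Hlip]]. destruct gain_facts as [G0 _].
  destruct (equilipschitz_limit 0 L Lam (fun n => fst (iter (S n) P))) as [U [CU [LU UU]]]; auto; try lra.
  { intros n x y. apply (Hlip (iter n P)); auto. }
  { intros x Hx. destruct (Hlu x Hx) as [l Hl]. exists l. apply (is_lim_seq_incr_1 (fun n => fst (iter n P) x)). auto. }
  destruct (equilipschitz_limit x1 L Lam (fun n => snd (iter (S n) P))) as [W [CW [LW UW]]]; auto; try lra.
  { intros n x y. apply (Hlip (iter n P)); auto. }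
  { intros x Hx. destruct (Hlw x Hx) as [l Hl]. exists l. apply (is_lim_seq_incr_1 (fun n => snd (iter n P) x)). auto. }
  set (Q := (U, W)).
  assert (HQ : inbox Q).
  { repeat split; simpl; auto.
    - apply (is_lim_seq_le (fun _ => 0) (fun n => fst (iter (S n) P) x) 0 (U x)); auto; [|apply is_lim_seq_const].
      intros n. apply (Hbox (S n)); auto.
    - apply (is_lim_seq_le (fun n => fst (iter (S n) P) x) (fun _ => M) (U x) M); auto; [|apply is_lim_seq_const].
      intros n. apply (Hbox (S n)); auto.
    - apply (is_lim_seq_le (fun _ => 0) (fun n => snd (iter (S n) P) x) 0 (W x)); auto; [|apply is_lim_seq_const].
      intros n. apply (Hbox (S n)); auto.
    - apply (is_lim_seq_le (fun n => snd (iter (S n) P) x) (fun _ => Wm) (W x) Wm); auto; [|apply is_lim_seq_const].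
      intros n. apply (Hbox (S n)); auto. }
  assert (Huni : forall eps, 0 < eps -> exists N, forall n, (N <= n)%nat ->
     (forall x, 0 <= x <= L -> Rabs (fst (iter (S n) P) x - U x) <= eps) /\
     (forall x, x1 <= x <= L -> Rabs (snd (iter (S n) P) x - W x) <= eps)).
  { intros eps He. destruct (UU eps He) as [N1 H1]. destruct (UW eps He) as [N2 H2].
    exists (Nat.max N1 N2). intros n Hn. split; intros x Hx; [apply H1|apply H2]; auto; lia. }
  assert (Hfix : forall eps, 0 < eps ->
     (forall x, 0 <= x <= L -> Rabs (fst (step Q) x - U x) <= (gain + 1) * eps) /\
     (forall x, x1 <= x <= L -> Rabs (snd (step Q) x - W x) <= (gain + 1) * eps)).
  { intros eps He. destruct (Huni eps He) as [N HN].
    destruct (HN N ltac:(lia)) as [A1 A2]. destruct (HN (S N) ltac:(lia)) as [B1 B2].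
    assert (O1 : ordc eps (iter (S N) P) Q).
    { split; intros x Hx; [change (fst Q x) with (U x); specialize (A1 x Hx); apply Rabs_le_iff in A1
        |change (snd Q x) with (W x); specialize (A2 x Hx); apply Rabs_le_iff in A2]; lra. }
    assert (O2 : ordc eps Q (iter (S N) P)).
    { split; intros x Hx; [change (fst Q x) with (U x); specialize (A1 x Hx); apply Rabs_le_iff in A1
        |change (snd Q x) with (W x); specialize (A2 x Hx); apply Rabs_le_iff in A2]; lra. }
    apply step_compare in O1; auto; [|lra]. apply step_compare in O2; auto; [|lra].
    change (step (iter (S N) P)) with (iter (S (S N)) P) in *.
    destruct O1 as [O11 O12]. destruct O2 as [O21 O22]. split; intros x Hx; apply Rabs_le_iff.
    - specialize (B1 x Hx). apply Rabs_le_iff in B1. specialize (O11 x Hx). specialize (O21 x Hx). lra.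
    - specialize (B2 x Hx). apply Rabs_le_iff in B2. specialize (O12 x Hx). specialize (O22 x Hx). lra. }
  assert (Hsmall : forall y, (forall eps, 0 < eps -> Rabs y <= (gain + 1) * eps) -> y = 0).
  { intros y Hy. destruct (Req_dec y 0) as [|Hn]; auto. exfalso.
    assert (Hyp : 0 < Rabs y) by (apply Rabs_pos_lt; auto).
    specialize (Hy (Rabs y / (2 * (gain + 1))) ltac:(apply Rdiv_lt_0_compat; lra)).
    replace ((gain + 1) * (Rabs y / (2 * (gain + 1)))) with (Rabs y / 2) in Hy by (field; lra). lra. }
  exists U, W. split; [|split; [|split]].
  - apply (fixed_point_steady Q); auto; simpl.
    + intros x Hx. apply Rminus_diag_uniq. apply Hsmall. intros eps He. apply (proj1 (Hfix eps He) x Hx).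
    + intros x Hx. apply Rminus_diag_uniq. apply Hsmall. intros eps He. apply (proj2 (Hfix eps He) x Hx).
  - intros x Hx. apply is_lim_seq_incr_1. apply LU; auto.
  - intros x Hx. apply is_lim_seq_incr_1. apply LW; auto.
  - intros eps He. destruct (Huni eps He) as [N HN]. exists (S N). apply HN. lia.
Qed.

Lemma monotone_limits (X Y : (R -> R) * (R -> R)) : inbox X -> inbox Y -> ordc 0 X Y ->
  ordc 0 X (step X) -> ordc 0 (step Y) Y ->
  exists UX WX UY WY : R -> R, steady_eqs UX WX /\ steady_eqs UY WY /\
    ordc 0 X (UX, WX) /\ ordc 0 (UX, WX) (UY, WY) /\ ordc 0 (UY, WY) Y /\
    forall eps, 0 < eps -> exists n k, ordc eps (UX, WX) (iter n X) /\ ordc eps (iter k Y) (UY, WY).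
Proof.
  intros HX HY HXY HX1 HY1. pose proof (iter_props X Y HX HY HXY HX1 HY1) as Hit.
  destruct (iter_limit X) as [UX [WX [SX [LX1 [LX2 NX]]]]].
  { intros n; exact (proj1 (Hit n)). }
  { intros x Hx. apply ex_finite_lim_seq_incr with M.
    - intros n. destruct (Hit n) as [_ [_ [_ [_ [_ [[I _] _]]]]]]. specialize (I x Hx). lra.
    - intros n. destruct (Hit n) as [[_ [_ [I _]]] _]. apply (I x Hx). }
  { intros x Hx. apply ex_finite_lim_seq_decr with 0.
    - intros n. destruct (Hit n) as [_ [_ [_ [_ [_ [[_ I] _]]]]]]. specialize (I x Hx). lra.
    - intros n. destruct (Hit n) as [[_ [_ [_ I]]] _]. apply (I x Hx). }
  destruct (iter_limit Y) as [UY [WY [SY [LY1 [LY2 NY]]]]].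
  { intros n; exact (proj1 (proj2 (Hit n))). }
  { intros x Hx. apply ex_finite_lim_seq_decr with 0.
    - intros n. destruct (Hit n) as [_ [_ [_ [_ [_ [_ [I _]]]]]]]. specialize (I x Hx). lra.
    - intros n. destruct (Hit n) as [_ [[_ [_ [I _]]] _]]. apply (I x Hx). }
  { intros x Hx. apply ex_finite_lim_seq_incr with Wm.
    - intros n. destruct (Hit n) as [_ [_ [_ [_ [_ [_ [_ I]]]]]]]. specialize (I x Hx). lra.
    - intros n. destruct (Hit n) as [_ [[_ [_ [_ I]]] _]]. apply (I x Hx). }
  assert (Hlim : forall (s s' : nat -> R) (l l' : R), (forall n, s n <= s' n + 0) -> is_lim_seq s l -> is_lim_seq s' l' -> l <= l' + 0).
  { intros s s' l l' Hs H1 H2. rewrite Rplus_0_r. apply (is_lim_seq_le s s' l l'); auto. intros n. specialize (Hs n). lra. }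
  exists UX, WX, UY, WY. split; auto. split; auto. split; [|split; [|split]].
  - split; simpl; intros x Hx.
    + apply (Hlim (fun _ => fst X x) (fun n => fst (iter n X) x)); auto; [|apply is_lim_seq_const].
      intros n. apply (Hit n); auto.
    + apply (Hlim (fun n => snd (iter n X) x) (fun _ => snd X x)); auto; [|apply is_lim_seq_const].
      intros n. apply (Hit n); auto.
  - split; simpl; intros x Hx.
    + apply (Hlim (fun n => fst (iter n X) x) (fun n => fst (iter n Y) x)); auto. intros n. apply (Hit n); auto.
    + apply (Hlim (fun n => snd (iter n Y) x) (fun n => snd (iter n X) x)); auto. intros n. apply (Hit n); auto.
  - split; simpl; intros x Hx.
    + apply (Hlim (fun n => fst (iter n Y) x) (fun _ => fst Y x)); auto; [|apply is_lim_seq_const].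
      intros n. apply (Hit n); auto.
    + apply (Hlim (fun _ => snd Y x) (fun n => snd (iter n Y) x)); auto; [|apply is_lim_seq_const].
      intros n. apply (Hit n); auto.
  - intros eps He. destruct (NX eps He) as [n [A1 A2]]. destruct (NY eps He) as [k [B1 B2]].
    exists n, k. split; split; simpl; intros x Hx.
    + specialize (A1 x Hx). apply Rabs_le_iff in A1. lra.
    + specialize (A2 x Hx). apply Rabs_le_iff in A2. lra.
    + specialize (B1 x Hx). apply Rabs_le_iff in B1. lra.
    + specialize (B2 x Hx). apply Rabs_le_iff in B2. lra.
Qed.

Definition at_time (u w : R -> R -> R) (t : R) : (R -> R) * (R -> R) := (fun x => u x t, fun x => w x t).

Lemma dynamicU (c eta T : R) (P : (R -> R) * (R -> R)) (u w : R -> R -> R) :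
  0 < eta -> 0 <= T ->
  (forall x, continuous (fst P) x) -> (forall x, continuous (snd P) x) ->
  Sol d1 a1 0 L x1 u (fun x t => u x t * (r - u x t - m * chi x1 x * w x t)) ->
  (forall x t, 0 <= x <= L -> T < t ->
     c * (reactU (chi x1 x) (fst P x) (snd P x) - reactU (chi x1 x) (u x t) (w x t)) <= shift_K d1 a1 kap1 * eta) ->
  exists T', T <= T' /\ forall x t, 0 <= x <= L -> T' <= t -> c * (fst (step P) x - u x t) <= 2 * eta.
Proof.
  intros He HT C1 C2 HS Hf.
  pose proof (bvp_Sol d1 a1 0 L kap1 x1 _ _ Hd1 Ha1 HL0 Hk1 (sourceU0_cont _ C1) (sourceU1_cont _ _ C1 C2)) as S1.
  pose proof (Sub_plus _ _ _ _ _ _ _ _ _ _ (Sol_Sub _ _ _ _ _ x1 c _ _ S1) (Sol_Sub _ _ _ _ _ x1 (- c) _ _ HS)) as S2.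
  destruct (eventually_le d1 a1 0 L x1 x1 (shift_K d1 a1 kap1) eta T _ _ Hd1 Ha1 HL0 K1p He HT S2) as [T' [HT' H]].
  - intros x t Hx Hne _ Ht _. simpl. rewrite glue_reactU. specialize (Hf x t ltac:(lra) Ht).
    unfold reactU at 2 in Hf. lra.
  - exists T'. split; auto. intros x t Hx Ht. specialize (H x t Hx Ht). simpl in H.
    change (fst (step P) x) with (stepU (fst P) (snd P) x). unfold stepU. lra.
Qed.

Lemma dynamicW (c eta T : R) (P : (R -> R) * (R -> R)) (u w : R -> R -> R) :
  0 < eta -> 0 <= T ->
  (forall x, continuous (fst P) x) -> (forall x, continuous (snd P) x) ->
  Sol d2 a2 x1 L x1 w (fun x t => h - q * w x t - p * u x t * w x t) ->
  (forall x t, x1 <= x <= L -> T < t ->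
     c * (reactW (fst P x) (snd P x) - reactW (u x t) (w x t)) <= shift_K d2 a2 kap2 * eta) ->
  exists T', T <= T' /\ forall x t, x1 <= x <= L -> T' <= t -> c * (snd (step P) x - w x t) <= 2 * eta.
Proof.
  intros He HT C1 C2 HS Hf.
  pose proof (bvp_Sol d2 a2 x1 L kap2 x1 _ _ Hd2 Ha2 (proj2 Hx1) Hk2 (sourceW_cont _ _ C1 C2) (sourceW_cont _ _ C1 C2)) as S1.
  pose proof (Sub_plus _ _ _ _ _ _ _ _ _ _ (Sol_Sub _ _ _ _ _ x1 c _ _ S1) (Sol_Sub _ _ _ _ _ x1 (- c) _ _ HS)) as S2.
  destruct (eventually_le d2 a2 x1 L x1 x1 (shift_K d2 a2 kap2) eta T _ _ Hd2 Ha2 (proj2 Hx1) K2p He HT S2) as [T' [HT' H]].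
  - intros x t Hx Hne _ Ht _. simpl. rewrite glue_reactW. specialize (Hf x t ltac:(lra) Ht).
    unfold reactW at 2 in Hf. lra.
  - exists T'. split; auto. intros x t Hx Ht. specialize (H x t Hx Ht). simpl in H.
    change (snd (step P) x) with (stepW (fst P) (snd P) x). unfold stepW. lra.
Qed.

Definition eventually_ord (u w : R -> R -> R) (T : R) (rel : R -> (R -> R) * (R -> R) -> Prop) : Prop :=
  forall eps, 0 < eps -> exists T', T <= T' /\ forall t, T' <= t -> rel eps (at_time u w t).

Lemma dynamic_step (T : R) (P : (R -> R) * (R -> R)) (u w : R -> R -> R) : 0 <= T -> inbox P ->
  Sol d1 a1 0 L x1 u (fun x t => u x t * (r - u x t - m * chi x1 x * w x t)) ->
  Sol d2 a2 x1 L x1 w (fun x t => h - q * w x t - p * u x t * w x t) ->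
  (forall t, T <= t -> boxed (at_time u w t)) ->
  (eventually_ord u w T (fun eps Q => ordc eps P Q) -> eventually_ord u w T (fun eps Q => ordc eps (step P) Q)) /\
  (eventually_ord u w T (fun eps Q => ordc eps Q P) -> eventually_ord u w T (fun eps Q => ordc eps Q (step P))).
Proof.
  intros HT HP SU SW Hbox. destruct gain_facts as [G0 [GU GW]].
  assert (HPb : boxed P) by apply HP. assert (C1 := proj1 HP). assert (C2 := proj1 (proj2 HP)).
  assert (Hsc : forall rate K eta, 0 < K -> 0 < eta -> rate <= K * gain -> rate * (eta / (gain + 1)) <= K * eta).
  { intros rate K eta HK He Hle.
    assert (He' : 0 < eta / (gain + 1)) by (apply Rdiv_lt_0_compat; lra).
    apply Rle_trans with (K * (gain + 1) * (eta / (gain + 1))); [|right; field; lra].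
    apply Rmult_le_compat_r; [lra|]. lra. }
  split; intros Hev eps He.
  - set (eta := eps / 2). assert (Heta : 0 < eta) by (unfold eta; lra).
    assert (He' : 0 < eta / (gain + 1)) by (apply Rdiv_lt_0_compat; lra).
    destruct (Hev _ He') as [T0 [HT0 H0]].
    destruct (dynamicU 1 eta T0 P u w Heta ltac:(lra) C1 C2 SU) as [T1 [HT1 H1]].
    { intros x t Hx Ht. rewrite Rmult_1_l.
      apply Rle_trans with (2 := Hsc _ _ _ K1p Heta GU).
      apply (reactU_pair (eta / (gain + 1)) x P (at_time u w t)); auto; try lra; [apply Hbox|apply H0]; lra. }
    destruct (dynamicW (-1) eta T0 P u w Heta ltac:(lra) C1 C2 SW) as [T2 [HT2 H2]].
    { intros x t Hx Ht.
      replace (-1 * (reactW (fst P x) (snd P x) - reactW (u x t) (w x t)))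
        with (reactW (u x t) (w x t) - reactW (fst P x) (snd P x)) by ring.
      apply Rle_trans with (2 := Hsc _ _ _ K2p Heta GW).
      apply (reactW_pair (eta / (gain + 1)) x P (at_time u w t)); auto; try lra; [apply Hbox|apply H0]; lra. }
    pose proof (Rmax_l T1 T2). pose proof (Rmax_r T1 T2).
    exists (Rmax T1 T2). split; [lra|]. intros t Ht. split; intros x Hx.
    + specialize (H1 x t Hx ltac:(lra)). change (fst (at_time u w t) x) with (u x t). unfold eta in H1. lra.
    + specialize (H2 x t Hx ltac:(lra)). change (snd (at_time u w t) x) with (w x t). unfold eta in H2. lra.
  - set (eta := eps / 2). assert (Heta : 0 < eta) by (unfold eta; lra).
    assert (He' : 0 < eta / (gain + 1)) by (apply Rdiv_lt_0_compat; lra).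
    destruct (Hev _ He') as [T0 [HT0 H0]].
    destruct (dynamicU (-1) eta T0 P u w Heta ltac:(lra) C1 C2 SU) as [T1 [HT1 H1]].
    { intros x t Hx Ht.
      replace (-1 * (reactU (chi x1 x) (fst P x) (snd P x) - reactU (chi x1 x) (u x t) (w x t)))
        with (reactU (chi x1 x) (u x t) (w x t) - reactU (chi x1 x) (fst P x) (snd P x)) by ring.
      apply Rle_trans with (2 := Hsc _ _ _ K1p Heta GU).
      apply (reactU_pair (eta / (gain + 1)) x (at_time u w t) P); auto; try lra; [apply Hbox|apply H0]; lra. }
    destruct (dynamicW 1 eta T0 P u w Heta ltac:(lra) C1 C2 SW) as [T2 [HT2 H2]].
    { intros x t Hx Ht. rewrite Rmult_1_l.
      apply Rle_trans with (2 := Hsc _ _ _ K2p Heta GW).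
      apply (reactW_pair (eta / (gain + 1)) x (at_time u w t) P); auto; try lra; [apply Hbox|apply H0]; lra. }
    pose proof (Rmax_l T1 T2). pose proof (Rmax_r T1 T2).
    exists (Rmax T1 T2). split; [lra|]. intros t Ht. split; intros x Hx.
    + specialize (H1 x t Hx ltac:(lra)). change (fst (at_time u w t) x) with (u x t). unfold eta in H1. lra.
    + specialize (H2 x t Hx ltac:(lra)). change (snd (at_time u w t) x) with (w x t). unfold eta in H2. lra.
Qed.

Lemma ordc_weaken (e e' : R) (P Q : (R -> R) * (R -> R)) : e <= e' -> ordc e P Q -> ordc e' P Q.
Proof.
  intros H [A B]. split; intros x Hx; [specialize (A x Hx)|specialize (B x Hx)]; lra.
Qed.

Lemma ordc_trans_eps (e e' : R) (P Q S : (R -> R) * (R -> R)) : ordc e P Q -> ordc e' Q S -> ordc (e + e') P S.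
Proof.
  intros [A B] [C D]. split; intros x Hx.
  - specialize (A x Hx). specialize (C x Hx). lra.
  - specialize (B x Hx). specialize (D x Hx). lra.
Qed.

Lemma trapping (X Y : (R -> R) * (R -> R)) : inbox X -> inbox Y -> ordc 0 X Y ->
  ordc 0 X (step X) -> ordc 0 (step Y) Y ->
  exists UX WX UY WY : R -> R, steady_eqs UX WX /\ steady_eqs UY WY /\
    ordc 0 X (UX, WX) /\ ordc 0 (UX, WX) (UY, WY) /\ ordc 0 (UY, WY) Y /\
    forall (u w : R -> R -> R) (T : R), 0 <= T ->
      Sol d1 a1 0 L x1 u (fun x t => u x t * (r - u x t - m * chi x1 x * w x t)) ->
      Sol d2 a2 x1 L x1 w (fun x t => h - q * w x t - p * u x t * w x t) ->
      (forall t, T <= t -> ordc 0 X (at_time u w t) /\ ordc 0 (at_time u w t) Y) ->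
      forall eps, 0 < eps -> exists T', forall t, T' <= t ->
        ordc eps (UX, WX) (at_time u w t) /\ ordc eps (at_time u w t) (UY, WY).
Proof.
  intros HX HY HXY HX1 HY1.
  destruct (monotone_limits X Y HX HY HXY HX1 HY1) as [UX [WX [UY [WY [SX [SY [O1 [O2 [O3 HN]]]]]]]]].
  exists UX, WX, UY, WY. do 5 (split; [assumption|]).
  intros u w T HT SU SW Hbet eps He.
  pose proof (iter_props X Y HX HY HXY HX1 HY1) as Hit.
  assert (Hbox : forall t, T <= t -> boxed (at_time u w t)).
  { intros t Ht. destruct (Hbet t Ht) as [[A B] [C D]].
    destruct HX as [_ [_ [X1 X2]]]. destruct HY as [_ [_ [Y1 Y2]]]. split; intros x Hx.
    - specialize (A x Hx). specialize (C x Hx). specialize (X1 x Hx). specialize (Y1 x Hx). lra.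
    - specialize (B x Hx). specialize (D x Hx). specialize (X2 x Hx). specialize (Y2 x Hx). lra. }
  assert (EX : forall n, eventually_ord u w T (fun e Q => ordc e (iter n X) Q)).
  { induction n as [|n IH].
    - intros e Hee. exists T. split; [lra|]. intros t Ht. apply (ordc_weaken 0); [lra|]. apply (Hbet t Ht).
    - exact (proj1 (dynamic_step T (iter n X) u w HT (proj1 (Hit n)) SU SW Hbox) IH). }
  assert (EY : forall n, eventually_ord u w T (fun e Q => ordc e Q (iter n Y))).
  { induction n as [|n IH].
    - intros e Hee. exists T. split; [lra|]. intros t Ht. apply (ordc_weaken 0); [lra|]. apply (Hbet t Ht).
    - exact (proj2 (dynamic_step T (iter n Y) u w HT (proj1 (proj2 (Hit n))) SU SW Hbox) IH). }
  destruct (HN (eps / 2) ltac:(lra)) as [n [k [N1 N2]]].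
  destruct (EX n (eps / 2) ltac:(lra)) as [T1 [_ H1]]. destruct (EY k (eps / 2) ltac:(lra)) as [T2 [_ H2]].
  pose proof (Rmax_l T1 T2). pose proof (Rmax_r T1 T2).
  exists (Rmax T1 T2). intros t Ht. split; apply (ordc_weaken (eps / 2 + eps / 2)); try lra.
  - apply (ordc_trans_eps _ _ _ (iter n X)); auto. apply H1. lra.
  - apply (ordc_trans_eps _ _ _ (iter k Y)); auto. apply H2. lra.
Qed.

Lemma step_barrierU (c e : R) (P : (R -> R) * (R -> R)) (f : R -> R) :
  (forall x, continuous (fst P) x) -> (forall x, continuous (snd P) x) ->
  Sub d1 a1 0 L x1 e (fun x _ => c * fst P x) (fun x _ => f x) ->
  (forall x, 0 < x < L -> x <> x1 -> x <> e -> f x <= c * (fst P x * (r - fst P x - m * chi x1 x * snd P x))) ->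
  forall x, 0 <= x <= L -> c * fst P x <= c * fst (step P) x.
Proof.
  intros C1 C2 HS Hf x Hx.
  pose proof (bvp_Sol d1 a1 0 L kap1 x1 _ _ Hd1 Ha1 HL0 Hk1 (sourceU0_cont _ C1) (sourceU1_cont _ _ C1 C2)) as S1.
  pose proof (Sub_plus _ _ _ _ _ _ _ _ _ _ HS (Sol_Sub _ _ _ _ _ e (- c) _ _ S1)) as S2.
  pose proof (steady_le d1 a1 0 L x1 e (shift_K d1 a1 kap1) (fun x => c * fst P x + - c * stepU (fst P) (snd P) x) _ Hd1 Ha1 HL0 K1p S2) as H.
  change (fst (step P) x) with (stepU (fst P) (snd P) x).
  assert (c * fst P x + - c * stepU (fst P) (snd P) x <= 0); [|lra].
  apply H; auto. intros y Hy N1 N2 _. rewrite glue_reactU. specialize (Hf y Hy N1 N2).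
  unfold stepU, reactU. lra.
Qed.

Lemma step_barrierW (c e : R) (P : (R -> R) * (R -> R)) (f : R -> R) :
  (forall x, continuous (fst P) x) -> (forall x, continuous (snd P) x) ->
  Sub d2 a2 x1 L x1 e (fun x _ => c * snd P x) (fun x _ => f x) ->
  (forall x, x1 < x < L -> x <> e -> f x <= c * (h - q * snd P x - p * fst P x * snd P x)) ->
  forall x, x1 <= x <= L -> c * snd P x <= c * snd (step P) x.
Proof.
  intros C1 C2 HS Hf x Hx.
  pose proof (bvp_Sol d2 a2 x1 L kap2 x1 _ _ Hd2 Ha2 (proj2 Hx1) Hk2 (sourceW_cont _ _ C1 C2) (sourceW_cont _ _ C1 C2)) as S1.
  pose proof (Sub_plus _ _ _ _ _ _ _ _ _ _ HS (Sol_Sub _ _ _ _ _ e (- c) _ _ S1)) as S2.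
  pose proof (steady_le d2 a2 x1 L x1 e (shift_K d2 a2 kap2) (fun x => c * snd P x + - c * stepW (fst P) (snd P) x) _ Hd2 Ha2 (proj2 Hx1) K2p S2) as H.
  change (snd (step P) x) with (stepW (fst P) (snd P) x).
  assert (c * snd P x + - c * stepW (fst P) (snd P) x <= 0); [|lra].
  apply H; auto. intros y Hy N1 N2 _. rewrite glue_reactW. specialize (Hf y Hy N2).
  unfold stepW, reactW. lra.
Qed.

End Scheme.

(** * A priori bounds for orbits *)

Lemma filterlim_cont_strip (a b : R) (z : R -> R -> R) :
  (forall x t, a <= x <= b -> 0 <= t ->
     filterlim (fun y : R * R => z (fst y) (snd y))
       (within (fun y : R * R => a <= fst y <= b /\ 0 <= snd y) (locally (x, t)))
       (locally (z x t))) <-> cont_strip a b z.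
Proof.
  split.
  - intros H x t Hx Ht eps He.
    destruct (proj1 (filterlim_locally _ (z x t)) (H x t Hx Ht) (mkposreal eps He)) as [de Hde].
    exists de. split; [apply cond_pos|]. intros y s Hy Hs H1 H2. apply (Hde (y, s)); simpl; auto.
    split; auto.
  - intros H x t Hx Ht. apply filterlim_locally. intros eps.
    destruct (H x t Hx Ht eps (cond_pos eps)) as [de [Hd D]].
    exists (mkposreal de Hd). intros [y s] [B1 B2] [H1 H2]. simpl in *. apply D; auto.
Qed.

Lemma solution_SolU (d1 d2 r m p q h L a1 a2 x1 : R) (u0 w0 : R -> R) (u w : R -> R -> R) :
  solution d1 d2 r m p q h L a1 a2 x1 u0 w0 u w ->
  Sol d1 a1 0 L x1 u (fun x t => u x t * (r - u x t - m * chi x1 x * w x t)).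
Proof.
  intros [C1 [C2 [I1 [I2 [ux [wx H]]]]]]. split; [apply filterlim_cont_strip; auto|].
  exists ux. intros t Ht. destruct (H t Ht) as [H1 [H2 [H3 [H4 [H5 [H6 [H7 [H8 [H9 H10]]]]]]]]].
  split; [|split; [|split]]; auto.
Qed.

Lemma solution_SolW (d1 d2 r m p q h L a1 a2 x1 : R) (u0 w0 : R -> R) (u w : R -> R -> R) :
  solution d1 d2 r m p q h L a1 a2 x1 u0 w0 u w ->
  Sol d2 a2 x1 L x1 w (fun x t => h - q * w x t - p * u x t * w x t).
Proof.
  intros [C1 [C2 [I1 [I2 [ux [wx H]]]]]]. split; [apply filterlim_cont_strip; auto|].
  exists wx. intros t Ht. destruct (H t Ht) as [H1 [H2 [H3 [H4 [H5 [H6 [H7 [H8 [H9 H10]]]]]]]]].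
  split; [|split; [|split]]; auto. intros x Hx _. destruct (H10 x Hx) as [wxx [wt [A [B C]]]].
  exists wxx, wt. split; auto. split; auto. lra.
Qed.

Lemma coexistence_solution (d1 d2 r m p q h L a1 a2 x1 : R) (U W : R -> R) : 0 <= x1 < L ->
  coexistence_ss d1 d2 r m p q h L a1 a2 x1 U W ->
  init_data x1 L U W /\ solution d1 d2 r m p q h L a1 a2 x1 U W (fun x _ => U x) (fun x _ => W x).
Proof.
  intros Hx1 [U' [W' [A1 [A2 [A3 [A4 [A5 [A6 [A7 [A8 [A9 [A10 [A11 A12]]]]]]]]]]]]].
  assert (CU : cont_on 0 L U) by (eapply deriv_on_cont_on; eauto).
  assert (CW : cont_on x1 L W) by (eapply deriv_on_cont_on; eauto).
  split.
  - repeat split; auto.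
    + intros x Hx. left. auto.
    + intros x Hx. left. auto.
    + exists L. split; [lra|]. specialize (A11 L ltac:(lra)). lra.
    + exists L. split; [lra|]. specialize (A12 L ltac:(lra)). lra.
  - split; [apply filterlim_cont_strip, cont_strip_space; auto|].
    split; [apply filterlim_cont_strip, cont_strip_space; auto|].
    split; auto. split; auto. exists (fun x _ => U' x), (fun x _ => W' x). intros t Ht.
    repeat (split; [assumption|]). split.
    + intros x Hx Hne. destruct (A9 x Hx Hne) as [z [Z1 Z2]]. exists z, 0. split; auto.
      split; [apply (is_derive_const (U x))|lra].
    + intros x Hx. destruct (A10 x Hx) as [z [Z1 Z2]]. exists z, 0. split; auto.
      split; [apply (is_derive_const (W x))|lra].
Qed.

Lemma steady_Sub (d al a b e e' : R) (v v' f : R -> R) : deriv_on a b v v' ->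
  al * v a <= d * v' a -> v' b <= 0 ->
  (forall x, a < x < b -> x <> e -> exists v'', is_derive v' x v'' /\ 0 <= d * v'' - al * v' x + f x) ->
  Sub d al a b e e' (fun x _ => v x) (fun x _ => f x).
Proof.
  intros H1 H2 H3 H4. split.
  - apply (cont_strip_space a b v). apply (deriv_on_cont_on a b v v'); auto.
  - exists (fun x _ => v' x), (fun x _ => v' x). intros t Ht.
    split; [|split; [|split; [|split; [|split]]]]; auto.
    + intros x Hx. apply (deriv_on_lslope a b); auto.
    + intros x Hx. apply (deriv_on_rslope a b); auto.
    + intros; lra.
    + intros x Hx E1 E2. split; auto. destruct (H4 x Hx E1) as [v'' [A B]].
      exists v'', 0. split; auto. split; [apply (is_derive_const (v x))|auto].
Qed.

Lemma steady_Sub_kink (d al a b e l : R) (v v1 v2 f : R -> R) : a < l < b ->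
  deriv_on a l v v1 -> deriv_on l b v v2 -> v1 l <= v2 l ->
  al * v a <= d * v1 a -> v2 b <= 0 ->
  (forall x, a < x < l -> x <> e -> exists v'', is_derive v1 x v'' /\ 0 <= d * v'' - al * v1 x + f x) ->
  (forall x, l < x < b -> x <> e -> exists v'', is_derive v2 x v'' /\ 0 <= d * v'' - al * v2 x + f x) ->
  Sub d al a b e l (fun x _ => v x) (fun x _ => f x).
Proof.
  intros Hl D1 D2 Hk Ba Bb O1 O2. split.
  - apply (cont_strip_space a b v). apply cont_on_eps. intros x Hx eps He.
    pose proof (deriv_on_cont_on _ _ _ _ D1) as C1. pose proof (deriv_on_cont_on _ _ _ _ D2) as C2.
    destruct (Rtotal_order x l) as [Hlt|[->|Hgt]].
    + destruct (proj1 (cont_on_eps a l v) C1 x ltac:(lra) eps He) as [de [Hd D]].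
      exists (Rmin de (l - x)). split; [apply Rmin_pos; lra|]. intros y Hy Hyx.
      apply Rmin_Rgt in Hyx. destruct Hyx as [Y1 Y2]. apply D; auto. apply Rgt_lt, Rabs_lt_iff in Y2. lra.
    + destruct (proj1 (cont_on_eps a l v) C1 l ltac:(lra) eps He) as [de [Hd D]].
      destruct (proj1 (cont_on_eps l b v) C2 l ltac:(lra) eps He) as [de' [Hd' D']].
      exists (Rmin de de'). split; [apply Rmin_pos; lra|]. intros y Hy Hyx.
      apply Rmin_Rgt in Hyx. destruct Hyx as [Y1 Y2].
      destruct (Rle_dec y l); [apply D|apply D']; auto; lra.
    + destruct (proj1 (cont_on_eps l b v) C2 x ltac:(lra) eps He) as [de [Hd D]].
      exists (Rmin de (x - l)). split; [apply Rmin_pos; lra|]. intros y Hy Hyx.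
      apply Rmin_Rgt in Hyx. destruct Hyx as [Y1 Y2]. apply D; auto. apply Rgt_lt, Rabs_lt_iff in Y2. lra.
  - exists (fun x _ => if Rle_dec x l then v1 x else v2 x), (fun x _ => if Rlt_dec x l then v1 x else v2 x).
    intros t Ht. split; [|split; [|split; [|split; [|split]]]].
    + intros x Hx. destruct (Rle_dec x l); [apply (deriv_on_lslope a l)|apply (deriv_on_lslope l b)]; auto; lra.
    + intros x Hx. destruct (Rlt_dec x l); [apply (deriv_on_rslope a l)|apply (deriv_on_rslope l b)]; auto; lra.
    + intros x Hx. destruct (Rle_dec x l); destruct (Rlt_dec x l); try lra.
      assert (x = l) as -> by lra. auto.
    + destruct (Rlt_dec a l); lra.
    + destruct (Rle_dec b l); lra.
    + intros x Hx E1 E2. destruct (Rtotal_order x l) as [Hlt|[->|Hgt]]; [|lra|].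
      * destruct (Rle_dec x l); [|lra]. destruct (Rlt_dec x l); [|lra]. split; auto.
        destruct (O1 x ltac:(lra) E1) as [v'' [A B]]. exists v'', 0. split; [|split; [apply (is_derive_const (v x))|auto]].
        apply (is_derive_local v1 _ a l); auto; [lra|]. intros y Hy. destruct (Rlt_dec y l); lra.
      * destruct (Rle_dec x l); [lra|]. destruct (Rlt_dec x l); [lra|]. split; auto.
        destruct (O2 x ltac:(lra) E1) as [v'' [A B]]. exists v'', 0. split; [|split; [apply (is_derive_const (v x))|auto]].
        apply (is_derive_local v2 _ l b); auto; [lra|]. intros y Hy. destruct (Rlt_dec y l); lra.
Qed.

Section Orbit.

Context (d1 d2 r m p q h L a1 a2 x1 : R).
Context (Hd1 : 0 < d1) (Hd2 : 0 < d2) (Hr : 0 < r) (Hm : 0 < m) (Hp : 0 < p)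
  (Hq : 0 < q) (Hh : 0 < h) (Ha1 : 0 <= a1) (Ha2 : 0 <= a2) (Hx1 : 0 <= x1 < L).
Context (u w : R -> R -> R)
  (SU : Sol d1 a1 0 L x1 u (fun x t => u x t * (r - u x t - m * chi x1 x * w x t)))
  (SW : Sol d2 a2 x1 L x1 w (fun x t => h - q * w x t - p * u x t * w x t)).

Let HL0 : 0 < L := Rle_lt_trans _ _ _ (proj1 Hx1) (proj2 Hx1).

Lemma chi_term_nonneg (x v : R) : (x1 < x -> 0 <= v) -> 0 <= m * chi x1 x * v.
Proof.
  intros H. destruct (Rle_dec x x1); [rewrite chi_left by auto; lra|].
  rewrite chi_right by lra. rewrite Rmult_1_r. apply Rmult_le_pos; [lra|apply H; lra].
Qed.

Lemma orbit_u_nonneg : (forall x, 0 <= x <= L -> 0 <= u x 0) ->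
  forall x t, 0 <= x <= L -> 0 <= t -> 0 <= u x t.
Proof.
  intros H0 x t Hx Ht.
  destruct (cont_rect_bounded 0 L 0 t u (cont_strip_rect _ _ _ _ (proj1 SU))) as [Bu [HBu Bu2]].
  destruct (cont_rect_bounded x1 L 0 t w (cont_strip_rect _ _ _ _ (proj1 SW))) as [Bw [HBw Bw2]].
  pose proof (Sol_Sub _ _ _ _ _ x1 (-1) _ _ SU) as S.
  assert (-1 * u x t <= 0); [|lra].
  apply (max_principle d1 a1 0 L x1 x1 t (r + Bu + m * Bw) _ _ Hd1 Ha1 HL0 S); auto; try lra.
  - intros y Hy. specialize (H0 y Hy). lra.
  - intros y s Hy Hne _ Hs Hz.
    replace (-1 * (u y s * (r - u y s - m * chi x1 y * w y s))) with ((r - u y s - m * chi x1 y * w y s) * (-1 * u y s)) by ring.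
    apply Rmult_le_compat_r; [lra|]. specialize (Bu2 y s ltac:(lra) ltac:(lra)). apply Rabs_le_iff in Bu2.
    assert (Hc : - (m * Bw) <= m * chi x1 y * w y s).
    { assert (0 < m * Bw) by (apply Rmult_lt_0_compat; auto).
      destruct (Rle_dec y x1); [rewrite chi_left by auto; lra|]. rewrite chi_right by lra.
      specialize (Bw2 y s ltac:(lra) ltac:(lra)). apply Rabs_le_iff in Bw2. rewrite Rmult_1_r. nra. }
    lra.
Qed.

Lemma orbit_w_nonneg : (forall x t, 0 <= x <= L -> 0 <= t -> 0 <= u x t) ->
  (forall x, x1 <= x <= L -> 0 <= w x 0) ->
  forall x t, x1 <= x <= L -> 0 <= t -> 0 <= w x t.
Proof.
  intros Hu H0 x t Hx Ht. pose proof (Sol_Sub _ _ _ _ _ x1 (-1) _ _ SW) as S.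
  assert (-1 * w x t <= 0); [|lra].
  apply (max_principle d2 a2 x1 L x1 x1 t 0 _ _ Hd2 Ha2 (proj2 Hx1) S); auto; try lra.
  - intros y Hy. specialize (H0 y Hy). lra.
  - intros y s Hy Hne _ Hs Hz. specialize (Hu y s ltac:(lra) ltac:(lra)).
    assert (0 <= p * u y s * (- w y s)) by (apply Rmult_le_pos; [apply Rmult_le_pos|]; lra).
    assert (0 <= q * (- w y s)) by (apply Rmult_le_pos; lra). lra.
Qed.

Lemma orbit_u_le (M : R) : r <= M -> (forall x t, x1 <= x <= L -> 0 <= t -> 0 <= w x t) ->
  (forall x, 0 <= x <= L -> u x 0 <= M) -> forall x t, 0 <= x <= L -> 0 <= t -> u x t <= M.
Proof.
  intros HM Hw H0 x t Hx Ht.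
  pose proof (Sub_plus _ _ _ _ _ _ _ _ _ _ (Sol_Sub _ _ _ _ _ x1 1 _ _ SU)
    (Sub_neg_time d1 a1 0 L x1 x1 (fun _ => M) (fun _ => 0) Ha1 (fun t => is_derive_const M t) ltac:(intros; lra))) as S.
  assert (1 * u x t + - M <= 0); [|lra].
  apply (max_principle d1 a1 0 L x1 x1 t 0 _ _ Hd1 Ha1 HL0 S); auto; try lra.
  - intros y Hy. specialize (H0 y Hy). lra.
  - intros y s Hy Hne _ Hs Hz. simpl in *.
    pose proof (chi_term_nonneg y (w y s) ltac:(intros; apply Hw; lra)).
    assert (0 <= u y s * (- (r - u y s - m * chi x1 y * w y s))) by (apply Rmult_le_pos; lra). lra.
Qed.

Lemma orbit_w_le (wt : R -> R) : tilde_w d2 a2 h q x1 L wt ->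
  (forall x t, 0 <= x <= L -> 0 <= t -> 0 <= u x t) ->
  (forall x t, x1 <= x <= L -> 0 <= t -> 0 <= w x t) ->
  exists C, 0 <= C /\ forall x t, x1 <= x <= L -> 0 <= t -> w x t <= wt x + C * exp (- q * t).
Proof.
  intros [wt' [T1 [T2 [T3 [T4 [T5 T6]]]]]] Hu Hw.
  destruct (cont_on_bounded x1 L (fun x => w x 0) ltac:(lra)) as [C [HC HCw]].
  { apply cont_strip_cont_on; [lra|apply SW]. }
  exists C. split; [lra|]. intros x t Hx Ht.
  assert (ST : Sol d2 a2 x1 L x1 (fun x _ => wt x) (fun x _ => h - q * wt x)).
  { apply (steady_Sol d2 a2 x1 L x1 wt wt'); auto. intros y Hy _. destruct (T6 y Hy) as [z [A B]]. exists z. split; auto. lra. }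
  pose proof (Sub_neg_time d2 a2 x1 L x1 x1 (fun t => C * exp (- q * t)) (fun t => - q * (C * exp (- q * t))) Ha2
     ltac:(intros s; auto_derive; auto; ring) ltac:(intros s; apply Rmult_le_pos; [lra|left; apply exp_pos])) as SE.
  pose proof (Sub_plus _ _ _ _ _ _ _ _ _ _ (Sub_plus _ _ _ _ _ _ _ _ _ _ (Sol_Sub _ _ _ _ _ x1 1 _ _ SW) (Sol_Sub _ _ _ _ _ x1 (-1) _ _ ST)) SE) as S.
  assert (1 * w x t + -1 * wt x + - (C * exp (- q * t)) <= 0); [|lra].
  apply (max_principle d2 a2 x1 L x1 x1 t 0 _ _ Hd2 Ha2 (proj2 Hx1) S); auto; try lra.
  - intros y Hy. rewrite Rmult_0_r, exp_0. specialize (HCw y Hy). apply Rabs_le_iff in HCw. specialize (T3 y Hy). lra.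
  - intros y s Hy Hne _ Hs Hz. specialize (Hu y s ltac:(lra) ltac:(lra)). specialize (Hw y s ltac:(lra) ltac:(lra)).
    assert (0 <= p * u y s * w y s) by (apply Rmult_le_pos; [apply Rmult_le_pos|]; lra).
    assert (0 < q * (1 * w y s + -1 * wt y + - (C * exp (- q * s)))) by (apply Rmult_lt_0_compat; auto). lra.
Qed.

(* The barrier ep (exp (- k ((x - x0)^2 - c t)) - exp (- k rho^2)) is a subsolution where
   |x - x0| >= rho, is nonpositive there at t = 0 and positive on all of [0, L] at t = tau. *)
Lemma orbit_u_pos (M Wm : R) : 0 <= M -> 0 <= Wm ->
  (forall x t, 0 <= x <= L -> 0 <= t -> 0 <= u x t <= M) ->
  (forall x t, x1 <= x <= L -> 0 <= t -> 0 <= w x t <= Wm) ->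
  (exists x, 0 <= x <= L /\ u x 0 <> 0) ->
  exists tau, 0 < tau /\ forall x, 0 <= x <= L -> 0 < u x tau.
Proof.
  intros HM HWm Hu Hw [xs [Hxs Hne]].
  assert (Hus : 0 < u xs 0) by (specialize (Hu xs 0 Hxs ltac:(lra)); lra).
  assert (Hx0 : exists x0, 0 < x0 < L /\ 0 < u x0 0).
  { destruct (proj1 SU xs 0 Hxs ltac:(lra) (u xs 0) Hus) as [de [Hde D]].
    set (s := Rmin (de / 2) (L / 4)).
    assert (Hs : 0 < s) by (apply Rmin_pos; lra). assert (s <= de / 2) by apply Rmin_l. assert (s <= L / 4) by apply Rmin_r.
    destruct (Rle_dec xs (L / 2)).
    - exists (xs + s). split; [lra|]. specialize (D (xs + s) 0 ltac:(lra) ltac:(lra)).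
      replace (xs + s - xs) with s in D by ring. rewrite Rminus_diag, Rabs_R0, (Rabs_right s) in D by lra.
      specialize (D ltac:(lra) Hde). apply Rabs_lt_iff in D. lra.
    - exists (xs - s). split; [lra|]. specialize (D (xs - s) 0 ltac:(lra) ltac:(lra)).
      replace (xs - s - xs) with (- s) in D by ring. rewrite Rminus_diag, Rabs_R0, Rabs_Ropp, (Rabs_right s) in D by lra.
      specialize (D ltac:(lra) Hde). apply Rabs_lt_iff in D. lra. }
  destruct Hx0 as [x0 [Hx0 Hu0]]. set (eta := u x0 0) in *.
  destruct (proj1 SU x0 0 ltac:(lra) ltac:(lra) (eta / 2) ltac:(lra)) as [de [Hde D]].
  set (rho := de / 2). assert (Hrho : 0 < rho) by (unfold rho; lra).
  assert (Hnear : forall x t, 0 <= x <= L -> Rabs (x - x0) <= rho -> 0 <= t <= rho -> eta / 2 < u x t).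
  { intros x t Hx Hxx Ht. specialize (D x t Hx ltac:(lra) ltac:(unfold rho in *; lra)).
    rewrite Rminus_0_r, (Rabs_right t) in D by lra. specialize (D ltac:(unfold rho in *; lra)).
    apply Rabs_lt_iff in D. fold eta in D. lra. }
  set (C := M + m * Wm). assert (HC : 0 <= C) by (unfold C; pose proof (Rmult_le_pos m Wm ltac:(lra) HWm); lra).
  assert (Hr2 : 0 < rho ^ 2) by (apply pow_lt; auto).
  assert (Hk : exists k, 1 <= k /\ a1 <= 2 * d1 * k * x0 /\ 2 * d1 + 2 * a1 * L + C <= 2 * d1 * k * rho ^ 2 /\ L ^ 2 <= 2 * d1 * k * rho ^ 2 * rho).
  { set (k1 := a1 / (2 * d1 * x0)). set (k2 := (2 * d1 + 2 * a1 * L + C) / (2 * d1 * rho ^ 2)). set (k3 := L ^ 2 / (2 * d1 * rho ^ 2 * rho)).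
    assert (P1 : 0 < 2 * d1 * x0) by (apply Rmult_lt_0_compat; lra).
    assert (P2 : 0 < 2 * d1 * rho ^ 2) by (apply Rmult_lt_0_compat; lra).
    assert (P3 : 0 < 2 * d1 * rho ^ 2 * rho) by (apply Rmult_lt_0_compat; lra).
    assert (Haa : 0 <= 2 * a1 * L) by (apply Rmult_le_pos; lra).
    assert (K1 : 0 <= k1) by (apply Rmult_le_pos; [lra|left; apply Rinv_0_lt_compat; auto]).
    assert (K2 : 0 <= k2) by (apply Rmult_le_pos; [lra|left; apply Rinv_0_lt_compat; auto]).
    assert (K3 : 0 <= k3) by (apply Rmult_le_pos; [apply pow2_ge_0|left; apply Rinv_0_lt_compat; auto]).
    exists (1 + k1 + k2 + k3). split; [lra|]. split; [|split].
    - replace a1 with (2 * d1 * x0 * k1) by (unfold k1; field; lra).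
      replace (2 * d1 * (1 + k1 + k2 + k3) * x0) with (2 * d1 * x0 * (1 + k1 + k2 + k3)) by ring.
      apply Rmult_le_compat_l; lra.
    - replace (2 * d1 + 2 * a1 * L + C) with (2 * d1 * rho ^ 2 * k2) by (unfold k2; field; lra).
      replace (2 * d1 * (1 + k1 + k2 + k3) * rho ^ 2) with (2 * d1 * rho ^ 2 * (1 + k1 + k2 + k3)) by ring.
      apply Rmult_le_compat_l; lra.
    - replace (L ^ 2) with (2 * d1 * rho ^ 2 * rho * k3) by (unfold k3; field; lra).
      replace (2 * d1 * (1 + k1 + k2 + k3) * rho ^ 2 * rho) with (2 * d1 * rho ^ 2 * rho * (1 + k1 + k2 + k3)) by ring.
      apply Rmult_le_compat_l; lra. }
  destruct Hk as [k [Hk1 [Hk2 [Hk3 Hk4]]]].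
  set (c := 2 * d1 * k * rho ^ 2) in *. assert (Hc : 0 < c) by (unfold c; repeat apply Rmult_lt_0_compat; lra).
  set (ep := eta / 2 * exp (- (k * c * rho))). assert (Hep : 0 < ep) by (apply Rmult_lt_0_compat; [lra|apply exp_pos]).
  set (E := fun x => exp (- k * (x - x0) ^ 2)).
  set (E' := fun x => - 2 * k * (x - x0) * E x).
  set (E'' := fun x => (4 * k ^ 2 * (x - x0) ^ 2 - 2 * k) * E x).
  assert (DE : forall x, is_derive E x (E' x)).
  { intros x. unfold E', E. auto_derive; auto. unfold Rminus. simpl. ring. }
  assert (DE' : forall x, is_derive E' x (E'' x)).
  { intros x. unfold E'', E', E. auto_derive; auto. unfold Rminus. simpl. ring. }
  assert (HE : forall x, 0 < E x) by (intros; apply exp_pos).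
  set (fE := fun x => - (d1 * E'' x - a1 * E' x)).
  assert (S1 : Sub d1 a1 0 L x1 x1 (fun x _ => E x) (fun x _ => fE x)).
  { apply (steady_Sub d1 a1 0 L x1 x1 E E').
    - apply is_derive_deriv_on; auto.
    - unfold E'. replace (d1 * (- 2 * k * (0 - x0) * E 0)) with ((2 * d1 * k * x0) * E 0) by ring.
      apply Rmult_le_compat_r; auto. left; auto.
    - unfold E'. specialize (HE L). assert (0 <= k * (L - x0)) by (apply Rmult_le_pos; lra). nra.
    - intros x Hx _. exists (E'' x). split; auto. unfold fE. lra. }
  set (g := fun t => ep * exp (k * c * t)).
  assert (Hg : forall t, is_derive g t (k * c * g t)) by (intros t; unfold g; auto_derive; auto; ring).
  assert (Hgp : forall t, 0 < g t) by (intros; unfold g; apply Rmult_lt_0_compat; auto; apply exp_pos).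
  pose proof (Sub_mult_time _ _ _ _ _ _ _ _ g (fun t => k * c * g t) Hg (fun t => Rlt_le _ _ (Hgp t)) S1) as S2.
  set (low := ep * exp (- k * rho ^ 2)).
  assert (Hlow : 0 <= low) by (unfold low; apply Rmult_le_pos; [lra|left; apply exp_pos]).
  pose proof (Sub_plus _ _ _ _ _ _ _ _ _ _ (Sub_plus _ _ _ _ _ _ _ _ _ _ S2
    (Sub_neg_time d1 a1 0 L x1 x1 (fun _ => low) (fun _ => 0) Ha1 (fun t => is_derive_const low t) (fun _ => Hlow)))
    (Sol_Sub _ _ _ _ _ x1 (-1) _ _ SU)) as S3.
  assert (Hle : forall x, 0 <= x <= L -> g rho * E x + - low + -1 * u x rho <= 0).
  { intros x Hx.
    assert (HE1 : forall y, E y <= 1).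
    { intros y. unfold E. rewrite <- exp_0. apply exp_le. assert (0 <= k * (y - x0) ^ 2) by (apply Rmult_le_pos; [lra|apply pow2_ge_0]). lra. }
    assert (Hgle : forall s, 0 <= s <= rho -> g s <= eta / 2).
    { intros s Hs. unfold g, ep. rewrite Rmult_assoc, <- exp_plus.
      assert (k * c * s <= k * c * rho) by (apply Rmult_le_compat_l; [apply Rmult_le_pos; lra|lra]).
      assert (exp (- (k * c * rho) + k * c * s) <= 1) by (rewrite <- exp_0; apply exp_le; lra).
      rewrite <- (Rmult_1_r (eta / 2)) at 2. apply Rmult_le_compat_l; lra. }
    assert (Hfar : forall y s, 0 <= y <= L -> 0 <= s <= rho -> u y s < g s * E y -> rho < Rabs (y - x0)).
    { intros y s Hy Hs Hlt. apply Rnot_le_lt. intros Hcl. specialize (Hnear y s Hy Hcl Hs). specialize (HE1 y). specialize (Hgle s Hs).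
      pose proof (Hgp s). specialize (HE y). assert (g s * E y <= g s * 1) by (apply Rmult_le_compat_l; lra). lra. }
    apply (max_principle d1 a1 0 L x1 x1 rho 0 _ _ Hd1 Ha1 HL0 S3); auto; try lra.
    - intros y Hy. destruct (Rle_lt_dec (g 0 * E y) (u y 0)) as [|Hlt]; [lra|].
      pose proof (Hfar y 0 Hy ltac:(lra) Hlt) as Hf.
      assert (Hsq : rho ^ 2 <= (y - x0) ^ 2).
      { rewrite <- (pow2_abs (y - x0)). apply pow_incr. lra. }
      assert (E y <= exp (- k * rho ^ 2)).
      { unfold E. apply exp_le. assert (k * rho ^ 2 <= k * (y - x0) ^ 2) by (apply Rmult_le_compat_l; lra). lra. }
      unfold low. unfold g. rewrite Rmult_0_r, exp_0, Rmult_1_r.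
      assert (ep * E y <= ep * exp (- k * rho ^ 2)) by (apply Rmult_le_compat_l; lra).
      specialize (Hu y 0 Hy ltac:(lra)). lra.
    - intros y s Hy Hne1 _ Hs Hz. simpl in *.
      pose proof (Hu y s ltac:(lra) ltac:(lra)) as Huy.
      pose proof (Hfar y s ltac:(lra) ltac:(lra) ltac:(lra)) as Hf.
      assert (Hsq : rho ^ 2 <= (y - x0) ^ 2).
      { rewrite <- (pow2_abs (y - x0)). apply pow_incr. lra. }
      pose proof (HE y) as HEy. pose proof (Hgp s) as Hgs.
      assert (HLE : (k * c + C) * E y <= - fE y).
      { assert (EfE : - fE y = (4 * d1 * k ^ 2 * (y - x0) ^ 2 - 2 * d1 * k + 2 * a1 * k * (y - x0)) * E y)
          by (unfold fE, E'', E'; ring).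
        rewrite EfE.
        apply Rmult_le_compat_r; [lra|].
        assert (Q1 : 4 * d1 * k ^ 2 * rho ^ 2 <= 4 * d1 * k ^ 2 * (y - x0) ^ 2).
        { apply Rmult_le_compat_l; [apply Rmult_le_pos; [lra|apply pow2_ge_0]|lra]. }
        assert (Q2 : - (2 * a1 * k * L) <= 2 * a1 * k * (y - x0)).
        { replace (- (2 * a1 * k * L)) with (2 * a1 * k * - L) by ring.
          apply Rmult_le_compat_l; [apply Rmult_le_pos; lra|lra]. }
        assert (Q3 : k * (2 * d1 + 2 * a1 * L + C) <= k * c) by (apply Rmult_le_compat_l; lra).
        assert (Q4 : 1 * C <= k * C) by (apply Rmult_le_compat_r; lra).
        assert (Q5 : 4 * d1 * k ^ 2 * rho ^ 2 = 2 * (k * c)) by (unfold c; ring). lra. }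
      assert (HLE2 : g s * ((k * c + C) * E y) <= g s * - fE y) by (apply Rmult_le_compat_l; lra).
      assert (Hreac : - (C * u y s) <= u y s * (r - u y s - m * chi x1 y * w y s)).
      { assert (m * chi x1 y * w y s <= m * Wm).
        { assert (0 <= m * Wm) by (apply Rmult_le_pos; lra).
          destruct (Rle_dec y x1); [rewrite chi_left by auto; lra|]. rewrite chi_right by lra. rewrite Rmult_1_r.
          apply Rmult_le_compat_l; [lra|]. apply Hw; lra. }
        replace (- (C * u y s)) with (u y s * - C) by ring. apply Rmult_le_compat_l; [lra|]. unfold C. lra. }
      assert (HCz : 0 <= C * (g s * E y + - low + -1 * u y s)) by (apply Rmult_le_pos; lra).
      assert (0 <= C * low) by (apply Rmult_le_pos; lra). lra. }
  exists rho. split; auto. intros x Hx. specialize (Hle x Hx).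
  assert (low < g rho * E x); [|lra].
  unfold low, g, E. rewrite Rmult_assoc. apply Rmult_lt_compat_l; auto. rewrite <- exp_plus. apply exp_increasing.
  assert (Hsq : (x - x0) ^ 2 <= L ^ 2).
  { rewrite <- (pow2_abs (x - x0)). apply pow_incr. split; [apply Rabs_pos|]. apply Rabs_le_iff. lra. }
  assert (k * (x - x0) ^ 2 <= k * (c * rho)) by (apply Rmult_le_compat_l; lra).
  assert (0 < k * rho ^ 2) by (apply Rmult_lt_0_compat; lra). lra.
Qed.

Lemma orbit_u_barrier (c0 del Lam T l : R) (phi w0 : R -> R) : 0 <= T -> 0 <= c0 -> 0 <= del -> 0 <= Lam ->
  (forall x, 0 <= x <= L -> 0 <= phi x) -> (forall x, x1 <= x <= L -> 0 <= w0 x) ->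
  Sub d1 a1 0 L x1 l (fun x _ => phi x) (fun x _ => (r - m * chi x1 x * w0 x - del) * phi x) ->
  (forall x t, 0 <= x <= L -> 0 <= t -> 0 <= u x t) ->
  (forall x, 0 <= x <= L -> c0 * phi x <= u x T) ->
  (forall x t, 0 <= x <= L -> T <= t -> c0 * phi x + m * chi x1 x * (w x t - w0 x) <= del + Lam) ->
  forall x t, 0 <= x <= L -> T <= t -> c0 * exp (- Lam * (t - T)) * phi x <= u x t.
Proof.
  intros HT Hc0 Hdel HLam Hphi Hw0 Sphi Hu HuT Hbd x t Hx Ht.
  set (g := fun t => c0 * exp (- Lam * t)).
  assert (Hg : forall t, is_derive g t (- Lam * g t)) by (intros s; unfold g; auto_derive; auto; ring).
  assert (Hgp : forall t, 0 <= g t) by (intros; unfold g; apply Rmult_le_pos; auto; left; apply exp_pos).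
  pose proof (Sub_plus _ _ _ _ _ _ _ _ _ _
    (Sub_mult_time _ _ _ _ _ _ _ _ g (fun t => - Lam * g t) Hg Hgp Sphi)
    (Sub_shift _ _ _ _ _ _ T _ _ HT (Sol_Sub _ _ _ _ _ l (-1) _ _ SU))) as S.
  assert (Hfin : g (t - T) * phi x + -1 * u x (t - T + T) <= 0).
  { apply (max_principle d1 a1 0 L x1 l (t - T) r _ _ Hd1 Ha1 HL0 S); auto; try lra.
    - intros y Hy. specialize (HuT y Hy). unfold g. rewrite Rmult_0_r, exp_0, Rplus_0_l. lra.
    - intros y s Hy N1 N2 Hs Hz. simpl in *.
      pose proof (Hu y (s + T) ltac:(lra) ltac:(lra)) as Huy. specialize (Hbd y (s + T) ltac:(lra) ltac:(lra)).
      set (v := g s * phi y) in *. set (uu := u y (s + T)) in *.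
      pose proof (Hphi y ltac:(lra)) as Hph.
      assert (Hv : v <= c0 * phi y).
      { unfold v, g. apply Rmult_le_compat_r; auto. rewrite <- (Rmult_1_r c0) at 2. apply Rmult_le_compat_l; auto.
        rewrite <- exp_0. apply exp_le. assert (0 <= Lam * s) by (apply Rmult_le_pos; lra). lra. }
      pose proof (chi_term_nonneg y (w0 y) ltac:(intros; apply Hw0; lra)) as Hcw.
      replace (g s * ((r - m * chi x1 y * w0 y - del) * phi y) + - Lam * g s * phi y +
               -1 * (uu * (r - uu - m * chi x1 y * w y (s + T))))
        with ((v - uu) * (r - m * chi x1 y * w0 y - del - Lam)
              - uu * (del + Lam - uu - m * chi x1 y * (w y (s + T) - w0 y))) by (unfold v; ring).
      assert (0 <= uu * (del + Lam - uu - m * chi x1 y * (w y (s + T) - w0 y))) by (apply Rmult_le_pos; lra).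
      assert ((v - uu) * (r - m * chi x1 y * w0 y - del - Lam) <= (v - uu) * r) by (apply Rmult_le_compat_l; lra).
      lra. }
  replace (t - T + T) with t in Hfin by ring. unfold g in Hfin. lra.
Qed.

End Orbit.

(** * Growth profiles *)

(* A positive strict subsolution of the linearisation of the u-equation at (0, w0). *)
Definition growth_profile (d1 r m L a1 x1 : R) (w0 : R -> R) : Prop :=
  exists (phi : R -> R) (del l : R), 0 < del /\ (forall x, continuous phi x) /\
    (forall x, 0 <= x <= L -> 0 < phi x) /\
    Sub d1 a1 0 L x1 l (fun x _ => phi x) (fun x _ => (r - m * chi x1 x * w0 x - del) * phi x).

Lemma glue_cont (e : R) (g1 g2 : R -> R) (x : R) : (forall y, continuous g1 y) -> (forall y, continuous g2 y) ->
  g1 e = g2 e -> continuous (glue e g1 g2) x.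
Proof.
  intros H1 H2 E. apply continuous_eps. intros eps He.
  destruct (proj1 (continuous_eps _ _) (H1 x) eps He) as [r1 [Hr1 D1]].
  destruct (proj1 (continuous_eps _ _) (H2 x) eps He) as [r2 [Hr2 D2]].
  destruct (Rtotal_order x e) as [Hlt|[->|Hgt]].
  - exists (Rmin r1 (e - x)). split; [apply Rmin_pos; lra|]. intros y Hy. apply Rmin_Rgt in Hy. destruct Hy as [Y1 Y2].
    apply Rgt_lt, Rabs_lt_iff in Y2. unfold glue. destruct (Rle_dec y e); [|lra]. destruct (Rle_dec x e); [|lra]. auto.
  - exists (Rmin r1 r2). split; [apply Rmin_pos; lra|]. intros y Hy. apply Rmin_Rgt in Hy. destruct Hy as [Y1 Y2].
    unfold glue. destruct (Rle_dec e e); [|lra]. destruct (Rle_dec y e); auto. rewrite E. auto.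
  - exists (Rmin r2 (x - e)). split; [apply Rmin_pos; lra|]. intros y Hy. apply Rmin_Rgt in Hy. destruct Hy as [Y1 Y2].
    apply Rgt_lt, Rabs_lt_iff in Y2. unfold glue. destruct (Rle_dec y e); [lra|]. destruct (Rle_dec x e); [lra|]. auto.
Qed.

Lemma growth_profile_large_zone (d1 r m L a1 x1 B : R) (w0 : R -> R) :
  0 < d1 -> 0 < r -> 0 < m -> 0 < a1 -> x1 < L -> a1 < sqrt (4 * d1 * r) -> Lstar d1 a1 r <= x1 ->
  (forall x, x1 <= x <= L -> w0 x <= B) -> 0 <= B ->
  growth_profile d1 r m L a1 x1 w0.
Proof.
  intros Hd Hr Hm Ha Hx1 Hsq HLs Hw0 HB.
  assert (Hdr : 0 < d1 * r) by (apply Rmult_lt_0_compat; auto).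
  assert (Ha2 : a1 ^ 2 < 4 * d1 * r).
  { replace (4 * d1 * r) with (sqrt (4 * d1 * r) ^ 2) by (apply pow2_sqrt; lra). simpl. rewrite !Rmult_1_r. apply Rmult_le_0_lt_compat; lra. }
  set (s := sqrt (4 * d1 * r - a1 ^ 2)). assert (Hs : 0 < s) by (apply sqrt_lt_R0; lra).
  assert (Hs2 : s ^ 2 = 4 * d1 * r - a1 ^ 2) by (unfold s; apply pow2_sqrt; lra).
  set (ga := atan (s / a1)). set (om := s / (2 * d1)).
  assert (Hom : 0 < om) by (apply Rdiv_lt_0_compat; lra).
  assert (Hga : 0 < ga < PI / 2).
  { split; [rewrite <- atan_0; apply atan_increasing; apply Rdiv_lt_0_compat; auto|apply atan_bound]. }
  set (l := Lstar d1 a1 r).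
  assert (Hl : om * l = PI - ga) by (unfold l, Lstar, om; fold s; fold ga; field; lra).
  pose proof PI_RGT_0 as Hpi.
  assert (Hl0 : 0 < l) by (apply Rmult_lt_reg_l with om; lra).
  assert (HlL : 0 < l < L) by (unfold l in *; lra).
  assert (Hbal : s * cos ga = a1 * sin ga).
  { assert (Ht : tan ga = s / a1) by (unfold ga; apply tan_atan). unfold tan in Ht.
    assert (Hcg : 0 < cos ga) by (apply cos_gt_0; lra).
    replace (sin ga) with (sin ga / cos ga * cos ga) by (field; lra). rewrite Ht. field. lra. }
  set (k := 1 + m * B / d1).
  assert (HmB : 0 <= m * B) by (apply Rmult_le_pos; lra).
  assert (HmBd : 0 <= m * B / d1) by (apply Rmult_le_pos; auto; left; apply Rinv_0_lt_compat; auto).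
  assert (Hk : 1 <= k) by (unfold k; lra).
  assert (Hk2 : m * B <= d1 * k ^ 2).
  { replace (m * B) with (d1 * (m * B / d1)) by (field; lra). apply Rmult_le_compat_l; [lra|]. unfold k. nra. }
  set (psi := fun x => exp (k * (L - x)) + exp (- k * (L - x))).
  set (psi' := fun x => - k * (exp (k * (L - x)) - exp (- k * (L - x)))).
  set (Bd := a1 / d1 * psi l - psi' l).
  assert (Hps : forall x, 0 < psi x) by (intros x; unfold psi; pose proof (exp_pos (k * (L - x))); pose proof (exp_pos (- k * (L - x))); lra).
  assert (Hps' : forall x, x <= L -> psi' x <= 0).
  { intros x Hx. unfold psi'. assert (exp (- k * (L - x)) <= exp (k * (L - x))) by (apply exp_le; nra). nra. }
  assert (Had : 0 < a1 / d1) by (apply Rdiv_lt_0_compat; auto).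
  assert (HBd : 0 < Bd).
  { unfold Bd. pose proof (Rmult_lt_0_compat _ _ Had (Hps l)). specialize (Hps' l ltac:(lra)). lra. }
  set (eta := om / Bd). assert (Heta : 0 < eta) by (apply Rdiv_lt_0_compat; auto).
  set (c := psi l * exp (- (a1 / d1) * l)). assert (Hc : 0 < c) by (apply Rmult_lt_0_compat; auto; apply exp_pos).
  set (g := fun x => c * exp (a1 / d1 * x)).
  set (f0 := fun x => exp (a1 / (2 * d1) * x) * sin (ga + om * x)).
  set (f0' := fun x => exp (a1 / (2 * d1) * x) * (a1 / (2 * d1) * sin (ga + om * x) + om * cos (ga + om * x))).
  set (g1 := fun x => f0 x + eta * g x). set (g2 := fun x => eta * psi x).
  set (v1 := fun x => f0' x + eta * (a1 / d1 * g x)). set (v2 := fun x => eta * psi' x).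
  assert (D1 : forall x, is_derive g1 x (v1 x)).
  { intros x. unfold g1, v1, f0, f0', g. auto_derive; auto. field. lra. }
  assert (D2 : forall x, is_derive g2 x (v2 x)).
  { intros x. unfold g2, v2, psi, psi'. auto_derive; auto. unfold Rminus. ring. }
  assert (Hgl : g l = psi l).
  { unfold g, c. rewrite Rmult_assoc, <- exp_plus. replace (- (a1 / d1) * l + a1 / d1 * l) with 0 by ring. rewrite exp_0. ring. }
  assert (Hf0l : sin (ga + om * l) = 0) by (rewrite Hl; replace (ga + (PI - ga)) with PI by ring; apply sin_PI).
  assert (Hcl : cos (ga + om * l) = -1) by (rewrite Hl; replace (ga + (PI - ga)) with PI by ring; apply cos_PI).
  assert (Heq : g1 l = g2 l) by (unfold g1, g2, f0; rewrite Hf0l, Hgl; ring).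
  set (phi := glue l g1 g2).
  assert (E1 : forall x, 0 <= x <= l -> g1 x = phi x) by (intros x Hx; unfold phi, glue; destruct (Rle_dec x l); lra).
  assert (E2 : forall x, l <= x <= L -> g2 x = phi x).
  { intros x Hx. unfold phi, glue. destruct (Rle_dec x l); auto. assert (x = l) as -> by lra. auto. }
  assert (Hsin : forall x, 0 <= x <= l -> 0 <= sin (ga + om * x)).
  { intros x Hx. assert (0 <= om * x) by (apply Rmult_le_pos; lra).
    assert (om * x <= om * l) by (apply Rmult_le_compat_l; lra). apply sin_ge_0; lra. }
  assert (Hgc : forall x, 0 <= x -> c <= g x).
  { intros x Hx. unfold g. rewrite <- (Rmult_1_r c) at 1. apply Rmult_le_compat_l; [lra|]. rewrite <- exp_0.
    apply exp_le. apply Rmult_le_pos; lra. }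
  assert (Hec : 0 < eta * c) by (apply Rmult_lt_0_compat; auto).
  set (Ph := exp (a1 / d1 * L) + eta * (c * exp (a1 / d1 * L))).
  assert (HPh1 : eta * c <= Ph).
  { assert (1 <= exp (a1 / d1 * L)) by (rewrite <- exp_0; apply exp_le; apply Rmult_le_pos; lra).
    assert (eta * c * 1 <= eta * c * exp (a1 / d1 * L)) by (apply Rmult_le_compat_l; lra). unfold Ph. lra. }
  assert (HPh : forall x, 0 <= x <= l -> g1 x <= Ph).
  { intros x Hx. unfold g1, Ph. apply Rplus_le_compat.
    - unfold f0. pose proof (SIN_bound (ga + om * x)) as [_ Hsb]. specialize (Hsin x Hx).
      apply Rle_trans with (exp (a1 / (2 * d1) * x) * 1).
      + apply Rmult_le_compat_l; [left; apply exp_pos|auto].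
      + rewrite Rmult_1_r. apply exp_le. replace (a1 / (2 * d1) * x) with (a1 / d1 * (x / 2)) by (field; lra).
        apply Rmult_le_compat_l; lra.
    - apply Rmult_le_compat_l; [lra|]. apply Rmult_le_compat_l; [lra|]. apply exp_le. apply Rmult_le_compat_l; lra. }
  set (del := eta * c * r / Ph).
  assert (Hdel : 0 < del) by (apply Rdiv_lt_0_compat; [apply Rmult_lt_0_compat|]; lra).
  assert (HdelP : del * Ph = eta * c * r) by (unfold del; field; lra).
  assert (Hdelr : del <= r).
  { apply Rmult_le_reg_r with Ph; [lra|]. rewrite HdelP, (Rmult_comm r). apply Rmult_le_compat_r; lra. }
  exists phi, del, l. split; auto. split; [|split].
  - intros x. apply glue_cont; auto; intros y; [apply (is_derive_cont _ _ _ (D1 y))|apply (is_derive_cont _ _ _ (D2 y))].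
  - intros x Hx. destruct (Rle_dec x l) as [Hle|Hgt].
    + rewrite <- E1 by lra. unfold g1, f0.
      assert (0 <= exp (a1 / (2 * d1) * x) * sin (ga + om * x)) by (apply Rmult_le_pos; [left; apply exp_pos|apply Hsin; lra]).
      assert (eta * c <= eta * g x) by (apply Rmult_le_compat_l; [lra|apply Hgc; lra]). lra.
    + rewrite <- E2 by lra. unfold g2. apply Rmult_lt_0_compat; auto.
  - apply (steady_Sub_kink d1 a1 0 L x1 l phi v1 v2); auto.
    + apply (deriv_on_ext 0 l g1); auto. apply is_derive_deriv_on; auto.
    + apply (deriv_on_ext l L g2); auto. apply is_derive_deriv_on; auto.
    + unfold v1, f0', v2. rewrite Hf0l, Hcl, Hgl.
      assert (HeB : eta * Bd = om) by (unfold eta; field; lra). unfold Bd in HeB.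
      assert (1 <= exp (a1 / (2 * d1) * l)).
      { rewrite <- exp_0. apply exp_le. apply Rmult_le_pos; [left; apply Rdiv_lt_0_compat; lra|lra]. }
      assert (om * 1 <= om * exp (a1 / (2 * d1) * l)) by (apply Rmult_le_compat_l; lra). lra.
    + rewrite <- E1 by lra. unfold g1, v1, f0, f0', g. rewrite !Rmult_0_r, Rplus_0_r, exp_0.
      replace (d1 * (1 * (a1 / (2 * d1) * sin ga + om * cos ga) + eta * (a1 / d1 * (c * 1))))
        with ((a1 * sin ga + s * cos ga) / 2 + a1 * (eta * c)) by (unfold om; field; lra).
      rewrite Hbal. lra.
    + unfold v2, psi'. replace (L - L) with 0 by ring. rewrite !Rmult_0_r, exp_0. lra.
    + intros x Hx _.
      set (z0 := exp (a1 / (2 * d1) * x) * ((a1 / (2 * d1)) ^ 2 * sin (ga + om * x) + 2 * (a1 / (2 * d1)) * om * cos (ga + om * x) - om ^ 2 * sin (ga + om * x))).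
      exists (z0 + eta * ((a1 / d1) ^ 2 * g x)). split.
      * unfold v1, f0', g, z0. auto_derive; auto. field. lra.
      * rewrite chi_left by (unfold l in *; lra). rewrite <- E1 by lra.
        assert (HL0 : d1 * z0 - a1 * f0' x + r * f0 x = 0).
        { unfold z0, f0', f0, om. replace r with ((s ^ 2 + a1 ^ 2) / (4 * d1)) by (rewrite Hs2; field; lra). field. lra. }
        pose proof (HPh x ltac:(lra)) as HP. pose proof (Hgc x ltac:(lra)) as HG.
        assert (Hdg : del * g1 x <= del * Ph) by (apply Rmult_le_compat_l; lra).
        assert (Heg : eta * c * r <= eta * g x * r).
        { apply Rmult_le_compat_r; [lra|]. apply Rmult_le_compat_l; lra. }
        replace (d1 * (z0 + eta * ((a1 / d1) ^ 2 * g x)) - a1 * v1 x + (r - m * 0 * w0 x - del) * g1 x)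
          with ((d1 * z0 - a1 * f0' x + r * f0 x) + eta * g x * r - del * g1 x) by (unfold v1, g1; field; lra).
        lra.
    + intros x Hx _. exists (eta * (k ^ 2 * psi x)). split.
      * unfold v2, psi', psi. auto_derive; auto. unfold Rminus. ring.
      * rewrite <- E2 by lra. unfold v2, g2.
        assert (Hcw : m * chi x1 x * w0 x <= m * B).
        { destruct (Rle_dec x x1); [rewrite chi_left by auto; lra|]. rewrite chi_right by lra. rewrite Rmult_1_r.
          apply Rmult_le_compat_l; [lra|]. apply Hw0. lra. }
        replace (d1 * (eta * (k ^ 2 * psi x)) - a1 * (eta * psi' x) + (r - m * chi x1 x * w0 x - del) * (eta * psi x))
          with (eta * (psi x * (d1 * k ^ 2 + r - m * chi x1 x * w0 x - del) + a1 * - psi' x)) by ring.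
        apply Rmult_le_pos; [lra|]. apply Rplus_le_le_0_compat.
        -- apply Rmult_le_pos; [left; auto|lra].
        -- apply Rmult_le_pos; [lra|]. specialize (Hps' x ltac:(lra)). lra.
Qed.

Lemma deriv_on_mult (a b : R) (f f' g g' : R -> R) : deriv_on a b f f' -> (forall x, is_derive g x (g' x)) ->
  deriv_on a b (fun x => f x * g x) (fun x => f' x * g x + f x * g' x).
Proof.
  intros Hf Hg. apply deriv_on_eps. intros x Hx eps He.
  set (A := Rabs (g x) + 1). set (B := Rabs (f' x) + 1). set (C := Rabs (f x) + 1).
  assert (HA : 0 < A) by (unfold A; pose proof (Rabs_pos (g x)); lra).
  assert (HB : 0 < B) by (unfold B; pose proof (Rabs_pos (f' x)); lra).
  assert (HC : 0 < C) by (unfold C; pose proof (Rabs_pos (f x)); lra).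
  destruct (proj1 (deriv_on_eps a b f f') Hf x Hx (eps / (3 * A)) ltac:(apply Rdiv_lt_0_compat; lra)) as [r1 [Hr1 D1]].
  destruct (proj1 (continuous_eps _ _) (is_derive_cont _ _ _ (Hg x)) (Rmin 1 (eps / (3 * B))) ltac:(apply Rmin_pos; [lra|apply Rdiv_lt_0_compat; lra])) as [r2 [Hr2 D2]].
  destruct (proj1 (is_derive_eps _ _ _) (Hg x) (eps / (3 * C)) ltac:(apply Rdiv_lt_0_compat; lra)) as [r3 [Hr3 D3]].
  exists (Rmin r1 (Rmin r2 r3)). split; [repeat apply Rmin_pos; auto|]. intros y Hy Hyx.
  apply Rmin_Rgt in Hyx. destruct Hyx as [Y1 Y2]. apply Rmin_Rgt in Y2. destruct Y2 as [Y2 Y3].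
  specialize (D1 y Hy Y1). specialize (D2 y Y2). specialize (D3 y Y3).
  apply Rmin_Rgt in D2. destruct D2 as [D2 D2']. apply Rgt_lt in D2. apply Rgt_lt in D2'.
  set (h := Rabs (y - x)) in *. assert (Hh : 0 <= h) by apply Rabs_pos.
  replace (f y * g y - f x * g x - (f' x * g x + f x * g' x) * (y - x))
    with ((f y - f x - f' x * (y - x)) * g y + f' x * (y - x) * (g y - g x) + f x * (g y - g x - g' x * (y - x))) by ring.
  assert (Hgy : Rabs (g y) <= A).
  { unfold A. pose proof (Rabs_triang (g x) (g y - g x)). replace (g x + (g y - g x)) with (g y) in * by ring. lra. }
  assert (T1 : Rabs ((f y - f x - f' x * (y - x)) * g y) <= eps / 3 * h).
  { rewrite Rabs_mult. apply Rle_trans with (eps / (3 * A) * h * A); [|right; field; lra].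
    apply Rmult_le_compat; auto; apply Rabs_pos. }
  assert (T2 : Rabs (f' x * (y - x) * (g y - g x)) <= eps / 3 * h).
  { rewrite !Rabs_mult. fold h. apply Rle_trans with (B * h * (eps / (3 * B))); [|right; field; lra].
    apply Rmult_le_compat; [apply Rmult_le_pos; [apply Rabs_pos|auto]|apply Rabs_pos| |lra].
    apply Rmult_le_compat_r; auto. unfold B; lra. }
  assert (T3 : Rabs (f x * (g y - g x - g' x * (y - x))) <= eps / 3 * h).
  { rewrite Rabs_mult. apply Rle_trans with (C * (eps / (3 * C) * h)); [|right; field; lra].
    apply Rmult_le_compat; auto; try apply Rabs_pos. unfold C; lra. }
  eapply Rle_trans; [apply Rabs_triang|]. pose proof (Rabs_triang ((f y - f x - f' x * (y - x)) * g y) (f' x * (y - x) * (g y - g x))).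
  lra.
Qed.

Lemma finite_isolated (E : list R) (x : R) : exists de, 0 < de /\ forall y, Rabs (y - x) < de -> y <> x -> ~ In y E.
Proof.
  induction E as [|e E [de [Hd H]]].
  - exists 1. split; [lra|]. intros y _ _ [].
  - destruct (Req_dec e x) as [->|Hne].
    + exists de. split; auto. intros y Hy Hyx [Heq|Hin]; [auto|]. apply (H y Hy Hyx Hin).
    + exists (Rmin de (Rabs (e - x))). split; [apply Rmin_pos; auto; apply Rabs_pos_lt; lra|].
      intros y Hy Hyx. apply Rmin_Rgt in Hy. destruct Hy as [Y1 Y2]. intros [->|Hin]; [lra|]. apply (H y Y1 Hyx Hin).
Qed.

Lemma growth_profile_small_zone (d1 r m ms L a1 x1 : R) (wt w0 : R -> R) :
  0 < d1 -> 0 < m -> m < ms -> 0 <= a1 -> 0 <= x1 < L ->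
  cont_on x1 L wt -> (forall x, x1 <= x <= L -> 0 < wt x) ->
  (forall x, x1 <= x <= L -> w0 x = (1 + (ms - m) / (2 * m)) * wt x) ->
  principal_eig d1 a1 (fun x => r - ms * chi x1 x * wt x) 0 L 0 ->
  growth_profile d1 r m L a1 x1 w0.
Proof.
  intros Hd Hm Hms Ha Hx1 Cw Pw Hw0 [ps [ps' [D1 [C1 [P1 [B1 [B2 [E HE]]]]]]]].
  assert (Cp : cont_on 0 L ps) by (eapply deriv_on_cont_on; eauto).
  set (S := fun x => r - ms * chi x1 x * wt x).
  set (ps'' := fun x => (a1 * ps' x - S x * ps x) / d1).
  assert (CS : forall x, 0 < x < L -> x <> x1 -> continuous S x).
  { intros x Hx Hne. destruct (Rlt_dec x x1) as [Hlt|Hge].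
    - apply continuous_eps. intros eps He. exists (x1 - x). split; [lra|]. intros y Hy. apply Rabs_lt_iff in Hy.
      unfold S. rewrite !chi_left by lra. replace (r - ms * 0 * wt y - (r - ms * 0 * wt x)) with 0 by ring. rewrite Rabs_R0. auto.
    - apply continuous_eps. intros eps He. assert (Hms0 : 0 < ms) by lra.
      destruct (proj1 (cont_on_eps x1 L wt) Cw x ltac:(lra) (eps / ms) ltac:(apply Rdiv_lt_0_compat; lra)) as [de [Hde D]].
      exists (Rmin de (Rmin (x - x1) (L - x))). split; [repeat apply Rmin_pos; lra|]. intros y Hy.
      apply Rmin_Rgt in Hy. destruct Hy as [Y1 Y2]. apply Rmin_Rgt in Y2. destruct Y2 as [Y2 Y3].
      apply Rgt_lt, Rabs_lt_iff in Y2. apply Rgt_lt, Rabs_lt_iff in Y3.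
      specialize (D y ltac:(lra) Y1). unfold S. rewrite !chi_right by lra.
      replace (r - ms * 1 * wt y - (r - ms * 1 * wt x)) with (- ms * (wt y - wt x)) by ring.
      rewrite Rabs_mult, Rabs_Ropp, (Rabs_right ms) by lra.
      apply Rmult_lt_compat_l with (r := ms) in D; auto. replace (ms * (eps / ms)) with eps in D by (field; lra). auto. }
  assert (Cint : forall f, cont_on 0 L f -> forall x, 0 < x < L -> continuous f x).
  { intros f Hf x Hx. apply continuous_eps. intros eps He.
    destruct (proj1 (cont_on_eps 0 L f) Hf x ltac:(lra) eps He) as [de [Hde D]].
    exists (Rmin de (Rmin x (L - x))). split; [repeat apply Rmin_pos; lra|]. intros y Hy.
    apply Rmin_Rgt in Hy. destruct Hy as [Y1 Y2]. apply Rmin_Rgt in Y2. destruct Y2 as [Y2 Y3].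
    apply Rgt_lt, Rabs_lt_iff in Y2. apply Rgt_lt, Rabs_lt_iff in Y3. apply D; auto. lra. }
  (* The equation extends to the exceptional points, where its right-hand side is continuous. *)
  assert (D2 : forall x, 0 < x < L -> x <> x1 -> is_derive ps' x (ps'' x)).
  { intros x Hx Hne. destruct (finite_isolated E x) as [de [Hde Hiso]].
    assert (Hpos : 0 < Rabs (x - x1)) by (apply Rabs_pos_lt; lra).
    apply (derive_at_puncture ps' ps'' x (Rmin de (Rmin x (L - x)))).
    - repeat apply Rmin_pos; lra.
    - apply Cint; auto.
    - unfold ps''. apply (continuous_mult (fun x => a1 * ps' x - S x * ps x) (fun _ => / d1)); [|apply continuous_const].
      apply (continuous_minus (fun x => a1 * ps' x) (fun x => S x * ps x)).
      + apply (continuous_mult (fun _ => a1) ps'); [apply continuous_const|apply Cint; auto].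
      + apply (continuous_mult S ps); [apply CS; auto|apply Cint; auto].
    - intros y Hy Hyx. apply Rmin_Rgt in Hy. destruct Hy as [Y1 Y2]. apply Rmin_Rgt in Y2. destruct Y2 as [Y2 Y3].
      apply Rgt_lt, Rabs_lt_iff in Y2. apply Rgt_lt, Rabs_lt_iff in Y3.
      destruct (HE y ltac:(lra) (Hiso y Y1 Hyx)) as [z [Z1 Z2]].
      assert (Ez : ps'' y = z).
      { unfold ps'', S. replace (a1 * ps' y - (r - ms * chi x1 y * wt y) * ps y) with (d1 * z) by lra. field. lra. }
      rewrite Ez. auto. }
  destruct (cont_on_min 0 L ps ltac:(lra) Cp) as [xl [Hxl Hlo]]. set (lo := ps xl) in *.
  assert (Hlo0 : 0 < lo) by (apply P1; auto).
  destruct (cont_on_bounded 0 L ps ltac:(lra) Cp) as [hi [Hhi0 Hhi]].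
  destruct (cont_on_bounded 0 L ps' ltac:(lra) C1) as [Dm [HDm0 HDm]].
  destruct (cont_on_min x1 L wt ltac:(lra) Cw) as [xw [Hxw Hwlo]]. set (wlo := wt xw) in *.
  assert (Hwlo0 : 0 < wlo) by (apply Pw; auto).
  set (NN := (2 * d1 * Dm + (d1 * hi + 1) / (L - x1)) / lo). set (K := (NN + a1) / d1).
  assert (HNN : 0 < NN).
  { apply Rdiv_lt_0_compat; auto. assert (0 < (d1 * hi + 1) / (L - x1)) by (apply Rdiv_lt_0_compat; nra).
    assert (0 < d1 * Dm) by (apply Rmult_lt_0_compat; auto). lra. }
  assert (HK0 : 0 < K) by (apply Rdiv_lt_0_compat; lra).
  assert (HdK : d1 * K - a1 = NN) by (unfold K; field; lra).
  assert (HloNN : lo * NN = 2 * d1 * Dm + (d1 * hi + 1) / (L - x1)) by (unfold NN; field; lra).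
  set (g := fun x => exp (K * x) * ((L - x) / K + / K ^ 2)).
  set (g' := fun x => exp (K * x) * (L - x)).
  set (g'' := fun x => exp (K * x) * (K * (L - x) - 1)).
  assert (Dg : forall x, is_derive g x (g' x)).
  { intros x. unfold g, g'. auto_derive; auto. unfold Rminus. field. lra. }
  assert (Dg' : forall x, is_derive g' x (g'' x)).
  { intros x. unfold g', g''. auto_derive; auto. unfold Rminus. ring. }
  assert (Hgpos : forall x, x <= L -> 0 < g x).
  { intros x Hx. unfold g. apply Rmult_lt_0_compat; [apply exp_pos|].
    assert (0 <= (L - x) / K) by (apply Rmult_le_pos; [lra|left; apply Rinv_0_lt_compat; auto]).
    assert (0 < / K ^ 2) by (apply Rinv_0_lt_compat; apply pow_lt; auto). lra. }
  set (Q := fun x => ps x * (d1 * g'' x - a1 * g' x) + 2 * d1 * (ps' x * g' x)).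
  assert (HQl : forall x, 0 <= x <= x1 -> 1 <= Q x).
  { intros x Hx. unfold Q, g'', g'.
    replace (ps x * (d1 * (exp (K * x) * (K * (L - x) - 1)) - a1 * (exp (K * x) * (L - x))) + 2 * d1 * (ps' x * (exp (K * x) * (L - x))))
      with (exp (K * x) * ((L - x) * (ps x * (d1 * K - a1) + 2 * d1 * ps' x) - d1 * ps x)) by ring.
    rewrite HdK.
    assert (1 <= exp (K * x)) by (rewrite <- exp_0; apply exp_le; apply Rmult_le_pos; lra).
    assert (Hin : 1 <= (L - x) * (ps x * NN + 2 * d1 * ps' x) - d1 * ps x).
    { specialize (Hlo x ltac:(lra)). specialize (Hhi x ltac:(lra)). specialize (HDm x ltac:(lra)).
      apply Rabs_le_iff in Hhi. apply Rabs_le_iff in HDm.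
      assert (Q1 : lo * NN <= ps x * NN) by (apply Rmult_le_compat_r; lra).
      assert (Q2 : 2 * d1 * - Dm <= 2 * d1 * ps' x) by (apply Rmult_le_compat_l; lra).
      assert (Q3 : (d1 * hi + 1) / (L - x1) <= ps x * NN + 2 * d1 * ps' x) by lra.
      assert (Q4 : 0 < (d1 * hi + 1) / (L - x1)) by (apply Rdiv_lt_0_compat; nra).
      assert (Q5 : (L - x1) * ((d1 * hi + 1) / (L - x1)) = d1 * hi + 1) by (field; lra).
      assert (Q6 : (L - x1) * ((d1 * hi + 1) / (L - x1)) <= (L - x) * (ps x * NN + 2 * d1 * ps' x)) by (apply Rmult_le_compat; lra).
      assert (Q7 : d1 * ps x <= d1 * hi) by (apply Rmult_le_compat_l; lra). lra. }
    rewrite <- (Rmult_1_r 1). apply Rmult_le_compat; lra. }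
  assert (Cg : forall f f' : R -> R, (forall x, is_derive f x (f' x)) -> cont_on 0 L f).
  { intros f f' Hf. apply continuous_cont_on. intros x _. apply (is_derive_cont _ _ _ (Hf x)). }
  assert (CQ : cont_on 0 L Q).
  { unfold Q. assert (Cg1 : cont_on 0 L g') by (apply (Cg _ _ Dg')).
    assert (Cg2 : cont_on 0 L g'').
    { apply continuous_cont_on. intros x _. unfold g''. apply (ex_derive_continuous (fun x => exp (K * x) * (K * (L - x) - 1))). auto_derive; auto. }
    apply cont_on_plus; [apply cont_on_mult; auto; apply cont_on_minus; apply cont_on_mult; auto; apply cont_on_const|].
    apply cont_on_mult; [apply cont_on_const|apply cont_on_mult; auto]. }
  destruct (cont_on_bounded 0 L Q ltac:(lra) CQ) as [QB [HQB0 HQB]].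
  set (A := wlo * ((ms - m) / 2)). assert (HA : 0 < A) by (apply Rmult_lt_0_compat; lra).
  set (eta := A * lo / (2 * QB)).
  assert (Heta : 0 < eta) by (apply Rdiv_lt_0_compat; [apply Rmult_lt_0_compat|]; lra).
  assert (HetaQ : eta * QB = A * lo / 2) by (unfold eta; field; lra).
  set (G := fun x => 1 + eta * g x). set (G' := fun x => eta * g' x). set (G'' := fun x => eta * g'' x).
  assert (DG : forall x, is_derive G x (G' x)).
  { intros x. unfold G, G'. replace (eta * g' x) with (0 + eta * g' x) by ring.
    apply (is_derive_plus (fun _ => 1) (fun x => eta * g x)); [apply (is_derive_const 1)|apply (is_derive_scal g); auto]. }
  assert (DG' : forall x, is_derive G' x (G'' x)) by (intros x; apply (is_derive_scal g'); auto).
  assert (HG1 : forall x, x <= L -> 1 <= G x).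
  { intros x Hx. unfold G. pose proof (Rmult_lt_0_compat _ _ Heta (Hgpos x Hx)). lra. }
  set (phi := fun x => ps x * G x). set (phi' := fun x => ps' x * G x + ps x * G' x).
  assert (Dphi : deriv_on 0 L phi phi') by (apply deriv_on_mult; auto).
  assert (Cphi : cont_on 0 L phi) by (eapply deriv_on_cont_on; eauto).
  destruct (cont_on_bounded 0 L phi ltac:(lra) Cphi) as [PB [HPB0 HPB]].
  assert (Hphilo : forall x, 0 <= x <= L -> lo <= phi x).
  { intros x Hx. unfold phi. specialize (Hlo x Hx). rewrite <- (Rmult_1_r lo). apply Rmult_le_compat; try lra. apply HG1; lra. }
  set (del := Rmin (A / 2) (eta / PB)).
  assert (Hep : 0 < eta / PB) by (apply Rdiv_lt_0_compat; auto).
  assert (Hdel : 0 < del) by (apply Rmin_pos; lra).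
  assert (HdelA : del <= A / 2) by apply Rmin_l. assert (HdelP : del <= eta / PB) by apply Rmin_r.
  exists (fun x => phi (clamp 0 L x)), del, x1. split; auto. split; [|split].
  - intros x. apply cont_on_clamp; auto. lra.
  - intros x Hx. rewrite clamp_id by auto. specialize (Hphilo x Hx). lra.
  - apply (steady_Sub d1 a1 0 L x1 x1 (fun x => phi (clamp 0 L x)) phi').
    + apply (deriv_on_ext 0 L phi); auto. intros x Hx. rewrite clamp_id; auto.
    + rewrite clamp_id by lra. unfold phi, phi'.
      assert (Hg0 : 0 <= G' 0) by (unfold G', g'; rewrite Rmult_0_r, exp_0; apply Rmult_le_pos; lra).
      assert (0 <= d1 * (ps 0 * G' 0)) by (apply Rmult_le_pos; [lra|apply Rmult_le_pos; [left; apply P1; lra|auto]]).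
      replace (a1 * (ps 0 * G 0)) with ((a1 * ps 0) * G 0) by ring. replace (a1 * ps 0) with (d1 * ps' 0) by lra. lra.
    + unfold phi', G', g'. rewrite B2. replace (L - L) with 0 by ring. lra.
    + intros x Hx Hne. exists (ps'' x * G x + ps' x * G' x + (ps' x * G' x + ps x * G'' x)). split.
      * unfold phi'.
        apply (is_derive_plus (fun x => ps' x * G x) (fun x => ps x * G' x)).
        -- apply (is_derive_mult ps' G); auto. intros; apply Rmult_comm.
        -- apply (is_derive_mult ps G'); auto; [apply (deriv_on_is_derive 0 L); auto|intros; apply Rmult_comm].
      * rewrite clamp_id by lra.
        assert (Eode : d1 * (ps'' x * G x + ps' x * G' x + (ps' x * G' x + ps x * G'' x)) - a1 * phi' x + (r - m * chi x1 x * w0 x - del) * phi x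
          = eta * Q x + (ms * chi x1 x * wt x - m * chi x1 x * w0 x) * phi x - del * phi x).
        { unfold phi, phi', ps'', Q, G', G'', S. field. lra. }
        rewrite Eode. pose proof (Hphilo x ltac:(lra)) as Hpl.
        destruct (Rlt_dec x x1) as [Hlt|Hge].
        -- rewrite chi_left by lra. specialize (HQl x ltac:(lra)). specialize (HPB x ltac:(lra)). apply Rabs_le_iff in HPB.
           assert (eta * 1 <= eta * Q x) by (apply Rmult_le_compat_l; lra).
           assert (del * phi x <= eta / PB * PB) by (apply Rmult_le_compat; lra).
           replace (eta / PB * PB) with eta in * by (field; lra). lra.
        -- rewrite chi_right by lra. rewrite Hw0 by lra.
           replace (ms * 1 * wt x - m * 1 * ((1 + (ms - m) / (2 * m)) * wt x)) with (wt x * ((ms - m) / 2)) by (field; lra).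
           specialize (HQB x ltac:(lra)). apply Rabs_le_iff in HQB.
           assert (eta * - QB <= eta * Q x) by (apply Rmult_le_compat_l; lra).
           assert (A * phi x <= wt x * ((ms - m) / 2) * phi x).
           { apply Rmult_le_compat_r; [lra|]. unfold A. apply Rmult_le_compat_r; [lra|]. apply Hwlo. lra. }
           assert (del * phi x <= A / 2 * phi x) by (apply Rmult_le_compat_r; lra).
           assert (A * lo <= A * phi x) by (apply Rmult_le_compat_l; lra). lra.
Qed.

(** * Global attraction *)

Section Global.

Context (d1 d2 r m p q h L a1 a2 x1 : R).
Context (Hd1 : 0 < d1) (Hd2 : 0 < d2) (Hr : 0 < r) (Hm : 0 < m) (Hp : 0 < p)
  (Hq : 0 < q) (Hh : 0 < h) (Ha1 : 0 <= a1) (Ha2 : 0 <= a2) (Hx1 : 0 <= x1 < L).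
Context (wt : R -> R) (Hwt : tilde_w d2 a2 h q x1 L wt).

Lemma tilde_w_Sol : Sol d2 a2 x1 L x1 (fun x _ => wt (clamp x1 L x)) (fun x _ => h - q * wt (clamp x1 L x)).
Proof.
  destruct Hwt as [wt' [T1 [T2 [T3 [T4 [T5 T6]]]]]].
  apply (steady_Sol d2 a2 x1 L x1 (fun x => wt (clamp x1 L x)) wt' (fun x => h - q * wt (clamp x1 L x))); auto.
  - apply (deriv_on_ext x1 L wt); auto. intros x Hx. rewrite clamp_id; auto.
  - rewrite clamp_id by lra. auto.
  - intros x Hx _. destruct (T6 x Hx) as [z [A B]]. exists z. split; auto. rewrite clamp_id by lra. lra.
Qed.

Lemma tilde_w_cont_on : cont_on x1 L wt.
Proof. destruct Hwt as [wt' [T1 _]]. eapply deriv_on_cont_on; eauto. Qed.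

Lemma tilde_w_pos (x : R) : x1 <= x <= L -> 0 < wt x.
Proof. destruct Hwt as [wt' [_ [_ [T3 _]]]]. auto. Qed.

Lemma steady_eqs_SolW (U W : R -> R) : steady_eqs d1 d2 r m p q h L a1 a2 x1 U W ->
  Sol d2 a2 x1 L x1 (fun x _ => W x) (fun x _ => h - q * W x - p * U x * W x).
Proof.
  intros [U' [W' [A1 [A2 [A3 [A4 [A5 [A6 [A7 [A8 [A9 A10]]]]]]]]]]].
  apply (steady_Sol d2 a2 x1 L x1 W W' (fun x => h - q * W x - p * U x * W x)); auto.
  intros x Hx _. destruct (A10 x Hx) as [z [B C]]. exists z. split; auto. lra.
Qed.

Lemma steady_W_le_tilde (U W : R -> R) : steady_eqs d1 d2 r m p q h L a1 a2 x1 U W ->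
  (forall x, 0 <= x <= L -> 0 <= U x) -> (forall x, x1 <= x <= L -> 0 <= W x) ->
  forall x, x1 <= x <= L -> W x <= wt x.
Proof.
  intros HS HU HW x Hx.
  pose proof (Sub_plus _ _ _ _ _ _ _ _ _ _ (Sol_Sub _ _ _ _ _ x1 1 _ _ (steady_eqs_SolW U W HS))
    (Sol_Sub _ _ _ _ _ x1 (-1) _ _ tilde_w_Sol)) as S.
  assert (1 * W x + -1 * wt (clamp x1 L x) <= 0); [|rewrite clamp_id in * by auto; lra].
  apply (steady_le d2 a2 x1 L x1 x1 q (fun x => 1 * W x + -1 * wt (clamp x1 L x)) _ Hd2 Ha2 (proj2 Hx1) Hq S); auto.
  intros y Hy _ _ _. simpl.
  assert (0 <= p * U y * W y).
  { apply Rmult_le_pos; [apply Rmult_le_pos; [lra|apply HU; lra]|apply HW; lra]. }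
  lra.
Qed.

Lemma steady_W_pos (U W : R -> R) (M : R) : 0 < M -> steady_eqs d1 d2 r m p q h L a1 a2 x1 U W ->
  (forall x, 0 <= x <= L -> 0 <= U x <= M) -> (forall x, x1 <= x <= L -> 0 <= W x) ->
  forall x, x1 <= x <= L -> 0 < W x.
Proof.
  intros HM HS HU HW x Hx.
  pose proof (tilde_w_le_end d2 a2 h q x1 L wt Hd2 Ha2 Hq (proj2 Hx1) Hwt) as Hmax.
  pose proof (tilde_w_pos L ltac:(lra)) as HwL.
  set (D := h + p * M * wt L).
  assert (HpM : 0 < p * M * wt L) by (repeat apply Rmult_lt_0_compat; auto).
  set (c := h / D). assert (Hc : 0 < c) by (apply Rdiv_lt_0_compat; unfold D; lra).
  assert (HcD : c * D = h) by (unfold c; field; unfold D; lra).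
  pose proof (Sub_plus _ _ _ _ _ _ _ _ _ _ (Sol_Sub _ _ _ _ _ x1 c _ _ tilde_w_Sol)
    (Sol_Sub _ _ _ _ _ x1 (-1) _ _ (steady_eqs_SolW U W HS))) as S.
  assert (Hle : c * wt (clamp x1 L x) + -1 * W x <= 0).
  { apply (steady_le d2 a2 x1 L x1 x1 q (fun x => c * wt (clamp x1 L x) + -1 * W x) _ Hd2 Ha2 (proj2 Hx1) Hq S); auto.
    intros y Hy _ _ Hz. simpl in *. rewrite clamp_id in * by lra.
    specialize (Hmax y ltac:(lra)). specialize (HU y ltac:(lra)). specialize (HW y ltac:(lra)).
    assert (c * wt y <= c * wt L) by (apply Rmult_le_compat_l; lra).
    assert (p * U y * W y <= p * M * (c * wt L)).
    { apply Rmult_le_compat; try lra; [apply Rmult_le_pos; lra|apply Rmult_le_compat_l; lra]. }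
    assert (c * h + p * M * (c * wt L) = h) by (rewrite <- HcD at 2; unfold D; ring). lra. }
  rewrite clamp_id in Hle by auto. pose proof (Rmult_lt_0_compat _ _ Hc (tilde_w_pos x Hx)). lra.
Qed.

Context (ee del l : R) (phi : R -> R) (Hee : 0 < ee) (Hdel : 0 < del)
  (Cphi : forall x, continuous phi x) (Pphi : forall x, 0 <= x <= L -> 0 < phi x).

Let w0 : R -> R := fun x => (1 + ee) * wt (clamp x1 L x).

Context (Sphi : Sub d1 a1 0 L x1 l (fun x _ => phi x) (fun x _ => (r - m * chi x1 x * w0 x - del) * phi x)).

Let HL0 : 0 < L := Rle_lt_trans _ _ _ (proj1 Hx1) (proj2 Hx1).

Lemma w0_pos (x : R) : x1 <= x <= L -> 0 < w0 x.
Proof. intros Hx. unfold w0. rewrite clamp_id by auto. apply Rmult_lt_0_compat; [lra|apply tilde_w_pos; auto]. Qed.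

Lemma phi_bounded : exists PB, 0 < PB /\ forall x, 0 <= x <= L -> phi x <= PB.
Proof.
  destruct (cont_on_bounded 0 L phi ltac:(lra)) as [PB [H1 H2]].
  { apply continuous_cont_on. auto. }
  exists PB. split; auto. intros x Hx. specialize (H2 x Hx). apply Rabs_le_iff in H2. lra.
Qed.

Definition trapped (dl M T : R) (u w : R -> R -> R) : Prop :=
  forall t, T <= t -> (forall x, 0 <= x <= L -> dl * phi x <= u x t <= M) /\
                      (forall x, x1 <= x <= L -> 0 <= w x t <= w0 x).

Lemma orbit_trapped (u0 v0 : R -> R) (u w : R -> R -> R) : init_data x1 L u0 v0 ->
  solution d1 d2 r m p q h L a1 a2 x1 u0 v0 u w ->
  exists dl M T, 0 < dl /\ 0 <= T /\ trapped dl M T u w.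
Proof.
  intros [I1 [I2 [I3 [I4 [I5 I6]]]]] HS.
  pose proof (solution_SolU _ _ _ _ _ _ _ _ _ _ _ _ _ _ _ HS) as SU.
  pose proof (solution_SolW _ _ _ _ _ _ _ _ _ _ _ _ _ _ _ HS) as SW.
  destruct HS as [_ [_ [E1 [E2 _]]]].
  assert (Hu : forall x t, 0 <= x <= L -> 0 <= t -> 0 <= u x t).
  { apply (orbit_u_nonneg d1 d2 r m p q h L a1 a2 x1 Hd1 Hm Ha1 Hx1 u w SU SW).
    intros x Hx. rewrite E1 by auto. auto. }
  assert (Hw : forall x t, x1 <= x <= L -> 0 <= t -> 0 <= w x t).
  { apply (orbit_w_nonneg d2 p q h L a2 x1 Hd2 Hp Hq Hh Ha2 Hx1 u w SW Hu).
    intros x Hx. rewrite E2 by auto. auto. }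
  destruct (cont_on_bounded 0 L u0 ltac:(lra) I1) as [B [HB HBu]].
  set (M := r + B).
  assert (HuM : forall x t, 0 <= x <= L -> 0 <= t -> u x t <= M).
  { apply (orbit_u_le d1 r m L a1 x1 Hd1 Hr Hm Ha1 Hx1 u w SU M ltac:(unfold M; lra) Hw).
    intros x Hx. rewrite E1 by auto. specialize (HBu x Hx). apply Rabs_le_iff in HBu. unfold M. lra. }
  destruct (orbit_w_le d2 p q h L a2 x1 Hd2 Hp Hq Ha2 Hx1 u w SW wt Hwt Hu Hw) as [C [HC HwC]].
  pose proof (tilde_w_le_end d2 a2 h q x1 L wt Hd2 Ha2 Hq (proj2 Hx1) Hwt) as Hmax.
  pose proof (tilde_w_pos L ltac:(lra)) as HwL.
  set (Wb := wt L + C).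
  assert (HwW : forall x t, x1 <= x <= L -> 0 <= t -> 0 <= w x t <= Wb).
  { intros x t Hx Ht. split; [apply Hw; auto|]. specialize (HwC x t Hx Ht). specialize (Hmax x Hx).
    assert (exp (- q * t) <= 1) by (rewrite <- exp_0; apply exp_le; nra).
    assert (C * exp (- q * t) <= C * 1) by (apply Rmult_le_compat_l; lra). unfold Wb. lra. }
  assert (HWb : 0 < Wb) by (unfold Wb; lra).
  destruct (orbit_u_pos d1 r m L a1 x1 Hd1 Hr Hm Ha1 Hx1 u w SU M Wb ltac:(unfold M; lra) ltac:(lra)) as [tau [Htau Hpos]]; auto.
  { destruct I5 as [x [Hx Hne]]. exists x. split; auto. rewrite E1 by auto. auto. }
  destruct (cont_on_min 0 L (fun x => u x tau) ltac:(lra)) as [xm [Hxm Hum]].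
  { apply cont_strip_cont_on; [lra|apply SU]. }
  set (um := u xm tau) in *. assert (Hum0 : 0 < um) by (apply Hpos; auto).
  destruct phi_bounded as [PB [HPB0 HPB]].
  set (c1 := Rmin um del / PB). assert (Hmin : 0 < Rmin um del) by (apply Rmin_pos; auto).
  assert (Hc1 : 0 < c1) by (apply Rdiv_lt_0_compat; auto).
  assert (Hc1P : forall x, 0 <= x <= L -> c1 * phi x <= Rmin um del).
  { intros x Hx. replace (Rmin um del) with (c1 * PB) by (unfold c1; field; lra). apply Rmult_le_compat_l; [lra|auto]. }
  destruct (cont_on_min x1 L wt ltac:(lra) tilde_w_cont_on) as [xw [Hxw Hwm]].
  set (wm := wt xw) in *. assert (Hwm0 : 0 < wm) by (apply tilde_w_pos; auto).
  destruct (exp_decay C q (ee * wm) Hq ltac:(apply Rmult_lt_0_compat; auto) HC) as [T1 [HT1 Hdec]].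
  set (T := tau + T1).
  assert (Hww0 : forall x t, x1 <= x <= L -> T <= t -> 0 <= w x t <= w0 x).
  { intros x t Hx Ht. assert (0 <= t) by (unfold T in Ht; lra). split; [apply Hw; auto|].
    specialize (HwC x t Hx ltac:(auto)). specialize (Hdec t ltac:(unfold T in Ht; lra)). specialize (Hwm x Hx).
    assert (ee * wm <= ee * wt x) by (apply Rmult_le_compat_l; lra). unfold w0. rewrite clamp_id by auto. lra. }
  assert (Hphi0 : forall x, 0 <= x <= L -> 0 <= phi x) by (intros; left; auto).
  assert (Hw00 : forall x, x1 <= x <= L -> 0 <= w0 x) by (intros; left; apply w0_pos; auto).
  assert (HmW : 0 < m * Wb) by (apply Rmult_lt_0_compat; auto).
  assert (Hbar1 : forall x t, 0 <= x <= L -> tau <= t -> c1 * exp (- (m * Wb) * (t - tau)) * phi x <= u x t).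
  { apply (orbit_u_barrier d1 r m L a1 x1 Hd1 Hm Ha1 Hx1 u w SU c1 del (m * Wb) tau l phi w0); auto; try lra.
    - intros x Hx. apply Rle_trans with (1 := Hc1P x Hx). apply Rle_trans with um; [apply Rmin_l|apply Hum; auto].
    - intros x t Hx Ht. specialize (Hc1P x Hx). pose proof (Rmin_r um del).
      assert (m * chi x1 x * (w x t - w0 x) <= m * Wb); [|lra].
      destruct (Rle_dec x x1); [rewrite chi_left by auto; lra|]. rewrite chi_right by lra. rewrite Rmult_1_r.
      apply Rmult_le_compat_l; [lra|]. specialize (HwW x t ltac:(lra) ltac:(lra)). specialize (Hw00 x ltac:(lra)). lra. }
  set (c2 := c1 * exp (- (m * Wb) * (T - tau))).
  assert (Hc2 : 0 < c2) by (apply Rmult_lt_0_compat; auto; apply exp_pos).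
  assert (Hc21 : c2 <= c1).
  { unfold c2. rewrite <- (Rmult_1_r c1) at 2. apply Rmult_le_compat_l; [lra|]. rewrite <- exp_0. apply exp_le.
    unfold T. assert (0 <= m * Wb * T1) by (apply Rmult_le_pos; lra). lra. }
  assert (Hbar2 : forall x t, 0 <= x <= L -> T <= t -> c2 * exp (- 0 * (t - T)) * phi x <= u x t).
  { apply (orbit_u_barrier d1 r m L a1 x1 Hd1 Hm Ha1 Hx1 u w SU c2 del 0 T l phi w0); auto; try lra; try (unfold T; lra).
    - intros x Hx. apply (Hbar1 x T Hx). unfold T. lra.
    - intros x t Hx Ht. specialize (Hc1P x Hx). pose proof (Rmin_r um del).
      assert (c2 * phi x <= c1 * phi x) by (apply Rmult_le_compat_r; auto).
      assert (m * chi x1 x * (w x t - w0 x) <= 0); [|lra].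
      destruct (Rle_dec x x1); [rewrite chi_left by auto; lra|]. rewrite chi_right by lra. rewrite Rmult_1_r.
      specialize (Hww0 x t ltac:(lra) Ht). nra. }
  exists c2, M, T. split; auto. split; [unfold T; lra|]. intros t Ht. split; intros x Hx; auto.
  split; [|apply HuM; auto; unfold T in Ht; lra].
  specialize (Hbar2 x t Hx Ht). replace (- 0 * (t - T)) with 0 in Hbar2 by ring. rewrite exp_0, Rmult_1_r in Hbar2. auto.
Qed.

Context (HwL : wt L ^ 2 <= h) (Hmp : m * p <= exp (- Rabs (a1 / d1 - a2 / d2) * L))
  (Hcase : 0 < x1 \/ m * p < exp (- Rabs (a1 / d1 - a2 / d2) * L)).

Lemma trapped_attractor (PB dl M : R) : (forall x, 0 <= x <= L -> phi x <= PB) ->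
  0 < dl -> dl * PB <= del -> r + del <= M ->
  exists U W, coexistence_ss d1 d2 r m p q h L a1 a2 x1 U W /\
    forall u0 v0 u w T, solution d1 d2 r m p q h L a1 a2 x1 u0 v0 u w -> 0 <= T -> trapped dl M T u w ->
      converges_to x1 L u w U W.
Proof.
  intros HPB Hdl HdP HM.
  pose proof (tilde_w_le_end d2 a2 h q x1 L wt Hd2 Ha2 Hq (proj2 Hx1) Hwt) as Hmax.
  pose proof (tilde_w_pos L ltac:(lra)) as HwLp.
  set (Wm := (1 + ee) * wt L). assert (HWm : 0 < Wm) by (apply Rmult_lt_0_compat; lra).
  assert (HMp : 0 < M) by lra.
  destruct (shift_K_large d1 a1 (2 * M + m * Wm) Hd1 Ha1) as [k1 [Hk1 HK1]].
  { pose proof (Rmult_lt_0_compat m Wm Hm HWm). lra. }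
  destruct (shift_K_large d2 a2 (q + p * M) Hd2 Ha2) as [k2 [Hk2 HK2]].
  { pose proof (Rmult_lt_0_compat p M Hp HMp). lra. }
  set (X := (fun x : R => dl * phi x, w0)). set (Y := (fun _ : R => M, fun _ : R => 0)).
  assert (CX1 : forall x, continuous (fst X) x).
  { intros x. apply (continuous_mult (fun _ => dl) phi); auto. apply continuous_const. }
  assert (CX2 : forall x, continuous (snd X) x).
  { intros x. apply (continuous_mult (fun _ => 1 + ee) (fun x => wt (clamp x1 L x))); [apply continuous_const|].
    apply cont_on_clamp; [lra|apply tilde_w_cont_on]. }
  assert (CY1 : forall x, continuous (fst Y) x) by (intros x; apply continuous_const).
  assert (CY2 : forall x, continuous (snd Y) x) by (intros x; apply continuous_const).
  assert (Hdphi : forall x, 0 <= x <= L -> 0 < dl * phi x <= del).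
  { intros x Hx. split; [apply Rmult_lt_0_compat; auto|]. apply Rle_trans with (2 := HdP). apply Rmult_le_compat_l; [lra|auto]. }
  assert (HX : inbox L x1 M Wm X).
  { repeat split; auto; simpl.
    - specialize (Hdphi x H). lra.
    - specialize (Hdphi x H). lra.
    - left. apply w0_pos; auto.
    - unfold w0, Wm. rewrite clamp_id by auto. apply Rmult_le_compat_l; [lra|auto]. }
  assert (HY : inbox L x1 M Wm Y) by (repeat split; auto; simpl; lra).
  assert (HXY : ordc L x1 0 X Y).
  { split; simpl; intros x Hx; [specialize (Hdphi x Hx)|pose proof (w0_pos x Hx)]; lra. }
  assert (HX1 : ordc L x1 0 X (step d1 d2 r m p q h L a1 a2 x1 k1 k2 X)).
  { split; intros x Hx; rewrite Rplus_0_r.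
    - rewrite <- (Rmult_1_l (fst X x)), <- (Rmult_1_l (fst (step _ _ _ _ _ _ _ _ _ _ _ _ _ X) x)).
      apply (step_barrierU d1 d2 r m p q h L a1 a2 x1 k1 k2 Hd1 Ha1 Hx1 Hk1 1 l X
        (fun x => dl * ((r - m * chi x1 x * w0 x - del) * phi x))); auto.
      + eapply Sub_ext; [| |apply (Sub_scale d1 a1 0 L x1 l dl _ _ (Rlt_le _ _ Hdl) Sphi)]; intros; simpl; ring.
      + intros y Hy _ _. simpl. specialize (Hdphi y ltac:(lra)).
        assert (dl * phi y * (dl * phi y) <= dl * phi y * del) by (apply Rmult_le_compat_l; lra). lra.
    - assert (Hb : -1 * snd X x <= -1 * snd (step d1 d2 r m p q h L a1 a2 x1 k1 k2 X) x); [|lra].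
      apply (step_barrierW d1 d2 r m p q h L a1 a2 x1 k1 k2 Hd2 Ha2 Hx1 Hk2 (-1) x1 X
        (fun x => - (1 + ee) * (h - q * wt (clamp x1 L x)))); auto.
      + eapply Sub_ext; [| |apply (Sol_Sub d2 a2 x1 L x1 x1 (- (1 + ee)) _ _ tilde_w_Sol)]; intros; simpl; unfold w0; ring.
      + intros y Hy _. simpl. specialize (Hdphi y ltac:(lra)). pose proof (w0_pos y ltac:(lra)) as Hw0y.
        assert (0 <= p * (dl * phi y) * w0 y) by (apply Rmult_le_pos; [apply Rmult_le_pos|]; lra).
        assert (0 < ee * h) by (apply Rmult_lt_0_compat; auto).
        replace (q * w0 y) with ((1 + ee) * (q * wt (clamp x1 L y))) by (unfold w0; ring). lra. }
  assert (HY1 : ordc L x1 0 (step d1 d2 r m p q h L a1 a2 x1 k1 k2 Y) Y).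
  { split; intros x Hx; rewrite Rplus_0_r.
    - assert (Hb : -1 * fst Y x <= -1 * fst (step d1 d2 r m p q h L a1 a2 x1 k1 k2 Y) x); [|lra].
      apply (step_barrierU d1 d2 r m p q h L a1 a2 x1 k1 k2 Hd1 Ha1 Hx1 Hk1 (-1) x1 Y (fun _ => 0)); auto.
      + eapply Sub_ext; [| |apply (Sub_neg_time d1 a1 0 L x1 x1 (fun _ => M) (fun _ => 0) Ha1 (fun t => is_derive_const M t) (fun _ => Rlt_le _ _ HMp))];
          intros; simpl; ring.
      + intros y Hy _ _. simpl. assert (0 <= M * (M - r)) by (apply Rmult_le_pos; lra). lra.
    - rewrite <- (Rmult_1_l (snd Y x)), <- (Rmult_1_l (snd (step _ _ _ _ _ _ _ _ _ _ _ _ _ Y) x)).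
      apply (step_barrierW d1 d2 r m p q h L a1 a2 x1 k1 k2 Hd2 Ha2 Hx1 Hk2 1 x1 Y (fun _ => 0)); auto.
      + eapply Sub_ext; [| |apply (Sub_neg_time d2 a2 x1 L x1 x1 (fun _ => 0) (fun _ => 0) Ha2 (fun t => is_derive_const 0 t) (fun _ => Rle_refl 0))];
          intros; simpl; ring.
      + intros y Hy _. simpl. lra. }
  destruct (trapping d1 d2 r m p q h L a1 a2 x1 M Wm k1 k2 Hd1 Hd2 Hr Hm Hp Hq Hh Ha1 Ha2 Hx1 HMp HWm Hk1 Hk2 HK1 HK2
     X Y HX HY HXY HX1 HY1) as [UX [WX [UY [WY [SX [SY [O1 [O2 [O3 Hconv]]]]]]]]].
  assert (PU : forall x, 0 <= x <= L -> 0 < UX x /\ UX x <= UY x /\ UY x <= M).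
  { intros x Hx. pose proof (proj1 O1 x Hx) as Q1. pose proof (proj1 O2 x Hx) as Q2. pose proof (proj1 O3 x Hx) as Q3.
    simpl in Q1, Q2, Q3. specialize (Hdphi x Hx). lra. }
  assert (PW : forall x, x1 <= x <= L -> 0 <= WY x /\ WY x <= WX x).
  { intros x Hx. pose proof (proj2 O2 x Hx) as Q2. pose proof (proj2 O3 x Hx) as Q3. simpl in Q2, Q3. lra. }
  assert (PWY : forall x, x1 <= x <= L -> 0 < WY x).
  { apply (steady_W_pos UY WY M HMp SY); [|intros; apply PW; auto]. intros x Hx. specialize (PU x Hx). lra. }
  assert (LX : forall x, x1 <= x <= L -> WX x <= wt x).
  { apply (steady_W_le_tilde UX WX SX); intros x Hx; [specialize (PU x Hx)|specialize (PW x Hx)]; lra. }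
  assert (CX : coexistence_ss d1 d2 r m p q h L a1 a2 x1 UX WX).
  { destruct SX as [U' [W' [A1 [A2 [A3 [A4 [A5 [A6 [A7 [A8 [A9 A10]]]]]]]]]]]. exists U', W'.
    repeat (split; [assumption|]). split; intros x Hx; [apply PU; auto|]. specialize (PW x Hx). specialize (PWY x Hx). lra. }
  assert (CY : coexistence_ss d1 d2 r m p q h L a1 a2 x1 UY WY).
  { destruct SY as [U' [W' [A1 [A2 [A3 [A4 [A5 [A6 [A7 [A8 [A9 A10]]]]]]]]]]]. exists U', W'.
    repeat (split; [assumption|]). split; intros x Hx; [|auto]. specialize (PU x Hx). lra. }
  destruct (ordered_coexistence_unique d1 d2 r m p q h L a1 a2 x1 UX WX UY WY Hd1 Hd2 Hm Hp Hh Hx1 CX CY) as [EU EW]; auto.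
  { intros x Hx. apply PU; auto. }
  { intros x Hx. apply PW; auto. }
  { intros x Hx. apply Rle_trans with (2 := HwL). simpl. rewrite Rmult_1_r.
    specialize (PW x Hx). specialize (LX x Hx). specialize (Hmax x Hx). apply Rmult_le_compat; lra. }
  exists UX, WX. split; auto. intros u0 v0 u w T HS HT Htr eps He.
  destruct (Hconv u w T HT (solution_SolU _ _ _ _ _ _ _ _ _ _ _ _ _ _ _ HS) (solution_SolW _ _ _ _ _ _ _ _ _ _ _ _ _ _ _ HS)) with (eps := eps / 2) as [T' HT'].
  { intros t Ht. destruct (Htr t Ht) as [Q1 Q2]. split; split; intros x Hx; simpl;
      first [specialize (Q1 x Hx); lra | specialize (Q2 x Hx); lra]. }
  { lra. }
  exists T'. intros t Ht. destruct (HT' t Ht) as [[Q1 Q2] [Q3 Q4]]. split; intros x Hx.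
  - specialize (Q1 x Hx). specialize (Q3 x Hx). simpl in Q1, Q3. rewrite <- EU in Q3 by auto. apply Rabs_lt_iff. lra.
  - specialize (Q2 x Hx). specialize (Q4 x Hx). simpl in Q2, Q4. rewrite <- EW in Q4 by auto. apply Rabs_lt_iff. lra.
Qed.

Lemma trapped_weaken (dl dl' M M' T T' : R) (u w : R -> R -> R) : dl' <= dl -> M <= M' -> T <= T' ->
  trapped dl M T u w -> trapped dl' M' T' u w.
Proof.
  intros H1 H2 H3 H t Ht. destruct (H t ltac:(lra)) as [A B]. split; auto. intros x Hx.
  specialize (A x Hx). pose proof (Pphi x Hx). assert (dl' * phi x <= dl * phi x) by (apply Rmult_le_compat_r; lra). lra.
Qed.

Lemma converges_const (U W U2 W2 : R -> R) : converges_to x1 L (fun x _ => U2 x) (fun x _ => W2 x) U W ->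
  (forall x, 0 <= x <= L -> U2 x = U x) /\ (forall x, x1 <= x <= L -> W2 x = W x).
Proof.
  intros H. assert (Hz : forall y, (forall eps, 0 < eps -> Rabs y < eps) -> y = 0).
  { intros y Hy. destruct (Req_dec y 0) as [|Hn]; auto. pose proof (Rabs_pos_lt y Hn) as Hp'. specialize (Hy _ Hp'). lra. }
  split; intros x Hx; apply Rminus_diag_uniq; apply Hz; intros eps He; destruct (H eps He) as [T HT];
  destruct (HT T (Rle_refl T)) as [A B]; auto.
Qed.

Lemma common_attractor (u0 v0 u0' v0' : R -> R) (u w u' w' : R -> R -> R) :
  init_data x1 L u0 v0 -> solution d1 d2 r m p q h L a1 a2 x1 u0 v0 u w ->
  init_data x1 L u0' v0' -> solution d1 d2 r m p q h L a1 a2 x1 u0' v0' u' w' ->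
  exists U W, converges_to x1 L u w U W /\ converges_to x1 L u' w' U W.
Proof.
  intros I S I' S'. destruct phi_bounded as [PB [HPB0 HPB]].
  destruct (orbit_trapped u0 v0 u w I S) as [dl [M [T [Hdl [HT Htr]]]]].
  destruct (orbit_trapped u0' v0' u' w' I' S') as [dl' [M' [T' [Hdl' [HT' Htr']]]]].
  set (e := Rmin (del / PB) (Rmin dl dl')). set (N := Rmax (r + del) (Rmax M M')).
  assert (HdP : 0 < del / PB) by (apply Rdiv_lt_0_compat; auto).
  assert (He : 0 < e) by (repeat apply Rmin_pos; auto).
  assert (E1 : e <= del / PB) by apply Rmin_l.
  assert (E2 : e <= Rmin dl dl') by apply Rmin_r.
  pose proof (Rmin_l dl dl'). pose proof (Rmin_r dl dl').
  assert (N1 : r + del <= N) by apply Rmax_l. assert (N2 : Rmax M M' <= N) by apply Rmax_r.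
  pose proof (Rmax_l M M'). pose proof (Rmax_r M M').
  destruct (trapped_attractor PB e N HPB He) as [U [W [_ Hc]]]; auto.
  { apply Rle_trans with (del / PB * PB); [apply Rmult_le_compat_r; lra|right; field; lra]. }
  exists U, W. split.
  - apply (Hc u0 v0 u w T S HT). apply (trapped_weaken dl e M N T T); auto; lra.
  - apply (Hc u0' v0' u' w' T' S' HT'). apply (trapped_weaken dl' e M' N T' T'); auto; lra.
Qed.

Lemma unique_GAS_of_profile : unique_GAS_coexistence d1 d2 r m p q h L a1 a2 x1.
Proof.
  destruct phi_bounded as [PB [HPB0 HPB]].
  assert (HdP : 0 < del / PB) by (apply Rdiv_lt_0_compat; auto).
  destruct (trapped_attractor PB (del / PB) (r + del) HPB HdP) as [U [W [CUW _]]].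
  { right; field; lra. }
  { lra. }
  destruct (coexistence_solution d1 d2 r m p q h L a1 a2 x1 U W Hx1 CUW) as [I0 S0].
  exists U, W. split; auto. split.
  - intros U2 W2 C2. destruct (coexistence_solution d1 d2 r m p q h L a1 a2 x1 U2 W2 Hx1 C2) as [I2 S2].
    destruct (common_attractor _ _ _ _ _ _ _ _ I0 S0 I2 S2) as [U3 [W3 [L0 L2]]].
    apply converges_const in L0. apply converges_const in L2. destruct L0 as [A B]. destruct L2 as [C D].
    split; intros x Hx; [rewrite C, A|rewrite D, B]; auto.
  - intros u0 v0 u w I S.
    destruct (common_attractor _ _ _ _ _ _ _ _ I0 S0 I S) as [U3 [W3 [L0 L2]]].
    apply converges_const in L0. destruct L0 as [A B].
    intros eps He. destruct (L2 eps He) as [T HT]. exists T. intros t Ht. destruct (HT t Ht) as [C D].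
    split; intros x Hx; [rewrite A|rewrite B]; auto.
Qed.

End Global.

Theorem theorem2p4 (d1 d2 r m p q h L a1 a2 x1 : R)
  (Hd1 : 0 < d1) (Hd2 : 0 < d2) (Hr : 0 < r) (Hm : 0 < m) (Hp : 0 < p)
  (Hq : 0 < q) (Hh : 0 < h) (HL0 : 0 < L) (Ha1 : 0 < a1) (Ha2 : 0 <= a2)
  (Hx1 : 0 <= x1 < L)
  (wt : R -> R) (Hwt : tilde_w d2 a2 h q x1 L wt)
  (Ha1r : a1 < sqrt (4 * d1 * r)) (HL : Lstar1 d1 a1 r < L) :
  (Lstar d1 a1 r <= x1 ->
     m <= / p * exp (- Rabs (a1 / d1 - a2 / d2) * L) ->
     wt L ^ 2 <= h ->
     unique_GAS_coexistence d1 d2 r m p q h L a1 a2 x1) /\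
  (x1 < Lstar d1 a1 r ->
     (exists mstar : R,
        principal_eig d1 a1 (fun x => r - mstar * chi x1 x * wt x) 0 L 0 /\
        m < mstar) ->
     m < / p * exp (- Rabs (a1 / d1 - a2 / d2) * L) ->
     wt L ^ 2 <= h ->
     unique_GAS_coexistence d1 d2 r m p q h L a1 a2 x1).
Proof.
  assert (Hpp : forall y, p * (/ p * y) = y) by (intros; field; lra).
  split.
  - intros HLs Hmle HwL.
    assert (Hx1p : 0 < x1).
    { apply Rlt_le_trans with (2 := HLs). unfold Lstar.
      assert (0 < d1 * r) by (apply Rmult_lt_0_compat; auto).
      assert (a1 ^ 2 < 4 * d1 * r).
      { replace (4 * d1 * r) with (sqrt (4 * d1 * r) ^ 2) by (apply pow2_sqrt; lra).
        simpl. rewrite !Rmult_1_r. apply Rmult_le_0_lt_compat; lra. }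
      apply Rdiv_lt_0_compat; [|apply sqrt_lt_R0; lra]. apply Rmult_lt_0_compat; [lra|].
      pose proof (atan_bound (sqrt (4 * d1 * r - a1 ^ 2) / a1)). pose proof PI_RGT_0. lra. }
    destruct (growth_profile_large_zone d1 r m L a1 x1 (2 * wt L) (fun x => (1 + 1) * wt (clamp x1 L x)))
      as [phi [del [l [Hdel [Cphi [Pphi Sphi]]]]]]; auto; try lra.
    { intros x Hx. rewrite clamp_id by auto.
      pose proof (tilde_w_le_end d2 a2 h q x1 L wt Hd2 Ha2 Hq (proj2 Hx1) Hwt x Hx). lra. }
    { pose proof (tilde_w_pos d2 q h L a2 x1 wt Hwt L ltac:(lra)). lra. }
    assert (Hmp : m * p <= exp (- Rabs (a1 / d1 - a2 / d2) * L)).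
    { rewrite Rmult_comm, <- (Hpp (exp _)). apply Rmult_le_compat_l; [lra|auto]. }
    exact (unique_GAS_of_profile d1 d2 r m p q h L a1 a2 x1 Hd1 Hd2 Hr Hm Hp Hq Hh (Rlt_le _ _ Ha1) Ha2 Hx1 wt Hwt
      1 del l phi Rlt_0_1 Hdel Cphi Pphi Sphi HwL Hmp (or_introl Hx1p)).
  - intros _ [ms [Heig Hms]] Hmlt HwL.
    assert (Hee : 0 < (ms - m) / (2 * m)) by (apply Rdiv_lt_0_compat; lra).
    destruct (growth_profile_small_zone d1 r m ms L a1 x1 wt (fun x => (1 + (ms - m) / (2 * m)) * wt (clamp x1 L x)))
      as [phi [del [l [Hdel [Cphi [Pphi Sphi]]]]]]; auto; try lra.
    { apply (tilde_w_cont_on d2 q h L a2 x1 wt Hwt). }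
    { intros x Hx. apply (tilde_w_pos d2 q h L a2 x1 wt Hwt x Hx). }
    { intros x Hx. rewrite clamp_id by auto. auto. }
    assert (Hmp : m * p < exp (- Rabs (a1 / d1 - a2 / d2) * L)).
    { rewrite Rmult_comm, <- (Hpp (exp _)). apply Rmult_lt_compat_l; auto. }
    exact (unique_GAS_of_profile d1 d2 r m p q h L a1 a2 x1 Hd1 Hd2 Hr Hm Hp Hq Hh (Rlt_le _ _ Ha1) Ha2 Hx1 wt Hwt
      ((ms - m) / (2 * m)) del l phi Hee Hdel Cphi Pphi Sphi HwL (Rlt_le _ _ Hmp) (or_intror Hmp)).
Qed.
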